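(* Let $\rho:B\twoheadrightarrow\Gamma$ be a Fell bundle over an étale groupoid $\Gamma$. Then $$\mathcal{B}^\rho=\{a\in\mathcal{S}^\rho_{\mathsf b}:a^*a\text{ and }aa^*\text{ are defined}\}$$ is a C*-algebra (under convolution and the involution $a^*(\gamma)=a(\gamma^{-1})^*$) with norm $\|\cdot\|_{\mathsf b}$.
   Context: Groupoids. For a groupoid $\Gamma$, $\mathsf{s}(\gamma)=\gamma^{-1}\gamma$, $\mathsf{r}(\gamma)=\gamma\gamma^{-1}$, $\Gamma^0\subseteq\Gamma$ is the set of units, and $\Gamma^2$ is the set of composable pairs ($(\alpha,\beta)\in\Gamma^2$ iff $\mathsf{s}(\alpha)=\mathsf{r}(\beta)$). For $x\in\Gamma^0$, $\Gamma x=\{\gamma:\mathsf{s}(\gamma)=x\}$. An étale groupoid is a groupoid with a topology making product and inverse continuous and such that $\mathsf{s}$ is an open map. No Hausdorff, local compactness or countability assumption is made, even on $\Gamma^0$. Fell bundles. A semigroupoid is a set with a partial binary operation such that $(ab)c$ is defined iff $a(bc)$ is, in which case they are equal; a *-semigroupoid also has an involution with $a^{**}=a$ and $(ab)^*=b^*a^*$ whenever $ab$ is defined. A Banach bundle is an open continuous surjection $\rho:B\twoheadrightarrow X$ of topological spaces such that each fibre $B_x=\rho^{-1}\{x\}$ is a complex Banach space (zero $0_x$); for each $\lambda\in\mathbb{C}$, $b\mapsto\lambda b$ is continuous on $B$; addition is continuous on $\{(a,b):\rho(a)=\rho(b)\}$; the norm is upper semicontinuous on $B$; and $\rho(b_\lambda)\to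 x$, $\|b_\lambda\|\to0$ imply $b_\lambda\to0_x$ for nets. A Fell bundle is a Banach bundle $\rho:B\twoheadrightarrow\Gamma$ such that: (1) $B$ is a *-semigroupoid with continuous product and involution, products are bilinear and $*$ is antilinear; (2) the norm is submultiplicative, $\Gamma$ is an étale groupoid, $ab$ is defined iff $(\rho(a),\rho(b))\in\Gamma^2$, in which case $\rho(ab)=\rho(a)\rho(b)$, and $\rho(a^* )=\rho(a)^{-1}$; (3) for all $b\in B$, $\|b^*b\|=\|b\|^2$ and there is $a\in B_{\rho(b^*b)}$ with $a^*a=b^*b$. Sections. $\mathcal{S}^\rho$ is the vector space (pointwise operations) of all, possibly discontinuous, sections $a:\Gamma\to B$, $\rho\circ a=\mathrm{id}_\Gamma$. Put $\mathrm{supp}(a)=\{\gamma:a(\gamma)\ne0_\gamma\}$ and $a^*(\gamma)=a(\gamma^{-1})^*$. The convolution $ab(\gamma)=\sum_{\gamma=\alpha\beta}a(\alpha)b(\beta)$ is ''defined'' if for every $\gamma\in\Gamma$ the net of finite partial sums converges in norm in $B_\gamma$. $\mathcal{F}^\rho$ denotes the finitely supported sections. Define $[0,\infty]$-valued norms by $$\|a\|_2=\sup_{x\in\Gamma^0}\ \sup_{F\subseteq\Gamma x\text{ finite}}\Big\|\sum_{\gamma\in F}a(\gamma)^*a(\gamma)\Big\|^{1/2},\qquad \|a\|_{\mathsf b}=\sup_{f\in\mathcal{F}^\rho}\frac{\|af\|_2}{\|f\|_2}\quad(0/0=0).$$ Let $\mathcal{S}^\rho_{\mathsf b}=\{a\in\mathcal{S}^\rho:\|a\|_{\mathsf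 b}<\infty\}$. *)

(* Defs.v *)
From HB Require Import structures.
From mathcomp Require Import all_boot all_order all_algebra.
From mathcomp Require Import complex.
From mathcomp Require Import all_classical all_reals all_analysis.

Set Implicit Arguments.
Unset Strict Implicit.
Unset Printing Implicit Defensive.

Import Order.TTheory GRing.Theory Num.Theory.
Import numFieldNormedType.Exports.

Local Open Scope classical_set_scope.
Local Open Scope ring_scope.

(* Partial binary operations are represented by a total_space function [mul]
   together with a domain [dom]; the values of [mul] outside [dom] are never
   used. *)

Definition is_semigroupoid (T : Type) (dom : T -> T -> Prop)
    (mul : T -> T -> T) : Prop :=
  forall a b c,
    (dom a b /\ dom (mul a b) c <-> dom b c /\ dom a (mul b c)) /\
    (dom a b -> dom (mul a b) c -> mul (mul a b) c = mul a (mul b c)).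

Definition is_star_semigroupoid (T : Type) (dom : T -> T -> Prop)
    (mul : T -> T -> T) (star : T -> T) : Prop :=
  [/\ is_semigroupoid dom mul,
      forall a, star (star a) = a &
      forall a b, dom a b ->
        dom (star b) (star a) /\ star (mul a b) = mul (star b) (star a)].

Section GroupoidDefs.
Variables (T : Type) (mul : T -> T -> T) (inv : T -> T).

Definition src_of (a : T) : T := mul (inv a) a.
Definition rng_of (a : T) : T := mul a (inv a).
Definition composable_of (a b : T) : Prop := src_of a = rng_of b.

Record is_groupoid : Prop := IsGroupoid {
  groupoid_invK : forall a, inv (inv a) = a;
  groupoid_srcM : forall a b, composable_of a b -> src_of (mul a b) = src_of b;
  groupoid_rngM : forall a b, composable_of a b -> rng_of (mul a b) = rng_of a;
  groupoid_mulA : forall a b c, composable_of a b -> composable_of b c ->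
    mul (mul a b) c = mul a (mul b c);
  groupoid_mulKV : forall a b, composable_of a b -> mul (inv a) (mul a b) = b;
  groupoid_mulVK : forall a b, composable_of a b -> mul (mul a b) (inv b) = a
}.

End GroupoidDefs.

(* The source map is required to be open as a map from the groupoid to
   itself, not merely onto its unit space with the subspace topology. *)
Record etaleGroupoid := EtaleGroupoid {
  arrow :> topologicalType;
  gmul : arrow -> arrow -> arrow;
  ginv : arrow -> arrow;
  gaxioms : is_groupoid gmul ginv;
  gmul_continuous :
    {within [set p : arrow * arrow | composable_of gmul ginv p.1 p.2],
      continuous (fun p : arrow * arrow => gmul p.1 p.2)};
  ginv_continuous : continuous ginv;
  gsrc_open : forall U : set arrow, open U -> open (src_of gmul ginv @` U)
}.

Section GroupoidNotions.
Variable G : etaleGroupoid.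

Definition src (g : G) : G := src_of (@gmul G) (@ginv G) g.
Definition rng (g : G) : G := rng_of (@gmul G) (@ginv G) g.
Definition composable (g h : G) : Prop := src g = rng h.

Definition units : set G := [set x | src x = x].

Definition src_fibre (x : G) : set G := [set g | src g = x].

Definition factorizations (g : G) : set (G * G) :=
  [set p | composable p.1 p.2 /\ gmul p.1 p.2 = g].

End GroupoidNotions.

(* The fibre over [x] is a Banach space [fib x] identified, through the
   injection [inc], with the preimage of [x] under the projection. *)
Record banachField (R : realType) (X : topologicalType) := BanachField {
  total_space :> topologicalType;
  proj : total_space -> X;
  fib : X -> completeNormedModType R[i];
  inc : forall x, fib x -> total_space;
  inc_inj : forall x, injective (@inc x);
  inc_range : forall x, range (@inc x) = proj @^-1` [set x]
}.

Arguments inc {R X} b {x} v.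

Section BanachFieldOperations.
Variables (R : realType) (X : topologicalType) (B : banachField R X).

(* [fib_at x b] inverts [inc] when [proj b = x]; it is [0] otherwise. *)
Definition fib_at (x : X) (b : B) : fib B x := xget 0 [set v | inc B v = b].

Definition bval (b : B) : fib B (proj b) := fib_at (proj b) b.

Definition bzero (x : X) : B := inc B (0 : fib B x).

Definition badd (a b : B) : B := inc B (bval a + fib_at (proj a) b).

Definition bscale (k : R[i]) (b : B) : B := inc B (k *: bval b).

Definition bnorm (b : B) : R := complex.Re `|bval b|.

End BanachFieldOperations.

(* Nets are rendered by (proper) filters. *)
Record banachBundle (R : realType) (X : topologicalType) := BanachBundle {
  bfield :> banachField R X;
  proj_continuous : continuous (@proj R X bfield);
  proj_open : forall U : set bfield, open U -> open (@proj R X bfield @` U);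
  proj_surj : range (@proj R X bfield) = setT;
  bscale_continuous : forall k : R[i], continuous (@bscale R X bfield k);
  badd_continuous :
    {within [set p : bfield * bfield | proj p.1 = proj p.2],
      continuous (fun p : bfield * bfield => badd p.1 p.2)};
  bnorm_usc : forall t : R, open [set b : bfield | bnorm b < t];
  bnorm_cvg0 : forall (x : X) (F : set_system bfield), ProperFilter F ->
    @proj R X bfield @ F --> x -> @bnorm R X bfield @ F --> (0 : R) ->
    F --> bzero bfield x
}.

Record fellBundle (R : realType) (G : etaleGroupoid) := FellBundle {
  fbundle :> banachBundle R G;
  fmul : fbundle -> fbundle -> fbundle;
  fstar : fbundle -> fbundle;
  fell_semigroupoid :
    is_star_semigroupoid
      (fun a b : fbundle => composable (proj a) (proj b)) fmul fstar;
  fmul_continuous :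
    {within [set p : fbundle * fbundle | composable (proj p.1) (proj p.2)],
      continuous (fun p : fbundle * fbundle => fmul p.1 p.2)};
  fstar_continuous : continuous fstar;
  proj_mul : forall a b : fbundle, composable (proj a) (proj b) ->
    proj (fmul a b) = gmul (proj a) (proj b);
  proj_star : forall a : fbundle, proj (fstar a) = ginv (proj a);
  fmulDl : forall a a' b : fbundle,
    proj a = proj a' -> composable (proj a) (proj b) ->
    fmul (badd a a') b = badd (fmul a b) (fmul a' b);
  fmulDr : forall a b b' : fbundle,
    proj b = proj b' -> composable (proj a) (proj b) ->
    fmul a (badd b b') = badd (fmul a b) (fmul a b');
  fmulZl : forall (k : R[i]) (a b : fbundle),
    composable (proj a) (proj b) ->
    fmul (bscale k a) b = bscale k (fmul a b);
  fmulZr : forall (k : R[i]) (a b : fbundle),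
    composable (proj a) (proj b) ->
    fmul a (bscale k b) = bscale k (fmul a b);
  fstarD : forall a a' : fbundle, proj a = proj a' ->
    fstar (badd a a') = badd (fstar a) (fstar a');
  fstarZ : forall (k : R[i]) (a : fbundle),
    fstar (bscale k a) = bscale (conjc k) (fstar a);
  fmul_norm : forall a b : fbundle, composable (proj a) (proj b) ->
    bnorm (fmul a b) <= bnorm a * bnorm b;
  fstar_norm : forall b : fbundle, bnorm (fmul (fstar b) b) = bnorm b ^+ 2;
  fstar_pos : forall b : fbundle, exists a : fbundle,
    proj a = proj (fmul (fstar b) b) /\ fmul (fstar a) a = fmul (fstar b) b
}.

(* The finite subsets of [D], directed by inclusion. *)
Definition finite_subsets_filter (I : choiceType) (D : set I) :
    set_system (set I) :=
  filter_from (fsets D) (fun F0 => [set F | fsets D F /\ F0 `<=` F]).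

Section Sections.
Variables (R : realType) (G : etaleGroupoid) (B : fellBundle R G).

(* All sections, possibly discontinuous; [a g] lies in the fibre over [g], so
   that [proj (inc B (a g)) = g] holds by construction. *)
Definition bsection : Type := forall g : G, fib B g.

Definition supp (a : bsection) : set G := [set g | a g != 0].

Definition sstar (a : bsection) : bsection :=
  fun g => fib_at g (fstar (inc B (a (ginv g)))).

(* The product of [a] at [p.1] and [b] at [p.2], as an element of the fibre
   over [g]; meaningful when [p] is a factorization of [g]. *)
Definition convolution_term (a b : bsection) (g : G) (p : G * G) : fib B g :=
  fib_at g (fmul (inc B (a p.1)) (inc B (b p.2))).

Definition convolution_partial (a b : bsection) (g : G) (F : set (G * G)) :
    fib B g :=
  \sum_(p \in F) convolution_term a b g p.

Definition convolution_defined (a b : bsection) : Prop :=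
  forall g : G,
    cvg (convolution_partial a b g @ finite_subsets_filter (factorizations g)).

(* The value is irrelevant when the convolution is not defined. *)
Definition convolution (a b : bsection) : bsection :=
  fun g =>
    lim (convolution_partial a b g @ finite_subsets_filter (factorizations g)).

Definition finitely_supported : set bsection :=
  [set f | finite_set (supp f)].

Definition square_sum (a : bsection) (x : G) (F : set G) : fib B x :=
  \sum_(g \in F) fib_at x (fmul (fstar (inc B (a g))) (inc B (a g))).

(* [0] is adjoined because suprema are taken in [0, +oo]: over the empty
   groupoid the supremum is [0], not [-oo]. *)
Definition norm2 (a : bsection) : \bar R :=
  ereal_sup (0%E |` [set t | exists x F, [/\ units x, fsets (src_fibre x) F &
    t = (Num.sqrt (complex.Re `|square_sum a x F|))%:E]]).

(* In [\bar R], [0^-1 = +oo] and [0 * +oo = 0], so that [0 / 0 = 0]. *)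
Definition normb (a : bsection) : \bar R :=
  ereal_sup
    [set (norm2 (convolution a f) / norm2 f)%E | f in finitely_supported].

Definition bounded_sections : set bsection := [set a | (normb a < +oo)%E].

Definition Bsections : set bsection :=
  [set a | [/\ bounded_sections a, convolution_defined (sstar a) a &
               convolution_defined a (sstar a)]].

End Sections.

(* C*-algebras, non-unital ones included. *)
HB.mixin Record isCStarAlgebra (R : realType) A
    of CompleteNormedModule R[i] A := {
  cmul : A -> A -> A;
  cstar : A -> A;
  cmulA : forall x y z, cmul x (cmul y z) = cmul (cmul x y) z;
  cmulPl : forall (k : R[i]) x y z,
    cmul (k *: x + y) z = k *: cmul x z + cmul y z;
  cmulPr : forall (k : R[i]) x y z,
    cmul x (k *: y + z) = k *: cmul x y + cmul x z;
  cstarK : forall x, cstar (cstar x) = x;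
  cstarP : forall (k : R[i]) x y,
    cstar (k *: x + y) = conjc k *: cstar x + cstar y;
  cstarM : forall x y, cstar (cmul x y) = cmul (cstar y) (cstar x);
  cmul_norm : forall x y, `|cmul x y| <= `|x| * `|y|;
  cstar_norm : forall x, `|cmul (cstar x) x| = `|x| ^+ 2
}.

#[short(type="cstarAlgType")]
HB.structure Definition CStarAlgebra (R : realType) :=
  {A of CompleteNormedModule R[i] A & isCStarAlgebra R A}.

(* Main.v *)
(** A section [a] acts by convolution on the columns [(u_g)], [src g = x], and
    [normb a] is the norm of this action on finitely supported columns.  The
    columns over [x] form a Hilbert module over the C*-algebra [B_x]: as
    [b^* b] has the form [a^* a] with [a] in [B_x], all the sums of squares
    [\sum u_g^* u_g] are positive, which gives the Cauchy-Schwarz inequality.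
    By Cauchy-Schwarz, [a^* a] and [a a^*] are defined iff the columns of [a]
    and of [a^*] are square summable, and then the convolution of two such
    sections is defined.  Columns are norm limits of finitely supported ones,
    and this reduces associativity, stability under products, adjoints and the
    C*-identity to finite sums.  Completeness is proved entrywise, using
    [|a g| <= normb a].

    Positivity of [a^* a] in a C*-algebra [A] is obtained without spectral
    theory, in the unital C*-algebra of adjointable operators on [A]: the only
    analytic input is the square root [1 - y] of [1 - w] for [|w| <= 1], where
    [y] is the limit of the iteration [y' = (w + y^2) / 2]. *)

Require Import Defs.
From HB Require Import structures.
From mathcomp Require Import all_boot all_order all_algebra.
From mathcomp Require Import complex.
From mathcomp Require Import all_classical all_reals all_analysis.
From mathcomp Require Import ring lra.

Set Implicit Arguments.
Unset Strict Implicit.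
Unset Printing Implicit Defensive.

Import Order.TTheory GRing.Theory Num.Theory.
Import numFieldNormedType.Exports.

Local Open Scope classical_set_scope.
Local Open Scope ring_scope.

(** * Positive elements of a unital C*-algebra *)

(** Norm bounds are relations ([bd], [op_bound], [col_bounded], [op_bounded]) and not suprema, so
    that estimates stay in the real field; the extended-real quotients of [normb] are translated
    once and for all in [normb_leP]. Positivity is handled among the operators on a fibre because a
    fibre over a unit need not have an identity, while 1 is needed both for the square root and to
    compare h with a scalar. Bounded columns in a Hilbert module need not be square summable, unlike
    in a Hilbert space: hence square summability of the columns of a and of a^* is carried along
    with boundedness, and the convergence of a product pairs a bounded column on one side with a
    summable one on the other. In a convolution a f the columns of f over distinct units do not
    interact, so operator bounds can be tested on one column at a time. *)

Section SqrtIteration.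
Variable R : realType.

(* A scalar majorant: if [|w| <= 1], the iterates [y_n] approximating
   [1 - sqrt (1 - w)] satisfy [|y_n| <= sqrt_iter n] and
   [|y_n.+1 - y_n| <= sqrt_iter n.+1 - sqrt_iter n], and [sqrt_iter n] tends
   to [1]. *)
Fixpoint sqrt_iter (n : nat) : R :=
  if n is m.+1 then 2^-1 * (1 + sqrt_iter m ^+ 2) else 0.

Lemma sqrt_iter_ge0 n : 0 <= sqrt_iter n.
Proof.
by case: n => //= n; apply: mulr_ge0 => //; apply: addr_ge0 => //; apply: sqr_ge0.
Qed.

(** The defect d = 1 - r of an iterate r becomes d - d^2 / 2 at the next step, hence decays like 2 /
    n. *)
Lemma sqrt_iter_bounds n : 1 - 2 / n.+1%:R <= sqrt_iter n <= 1.
Proof.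
elim: n => [|n /andP[lo hi]] /=; first by rewrite divr1; apply/andP; split; lra.
have r0 := sqrt_iter_ge0 n; move: (sqrt_iter n) lo hi r0 => r lo hi r0.
apply/andP; split; last by nra.
have n0 : 0 < n.+1%:R :> R by rewrite ltr0n.
have e : n.+2%:R = n.+1%:R + 1 :> R by rewrite -natr1.
(* From here [m] is an arbitrary positive real. Squaring the induction hypothesis needs 1 - 2 / m >=
   0, so small values of [m] are treated separately. *)
rewrite e; move: (n.+1%:R) n0 lo => m m0 lo.
case: (lerP m 1) => m1.
  have : 1 <= 2 / (m + 1) by rewrite ler_pdivlMr; lra.
  by nra.
have h0 : 0 <= 1 - 2 / m \/ m < 2.
  case: (lerP 2 m) => h; [left|by right].
  by rewrite subr_ge0 ler_pdivrMr; lra.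
case: h0 => [h0|m2].
  have sq : (1 - 2 / m) ^+ 2 <= r ^+ 2 by rewrite ler_sqr ?nnegrE.
  apply: (@le_trans _ _ (2^-1 * (1 + (1 - 2 / m) ^+ 2))); last by lra.
  rewrite -subr_ge0.
  have -> : 2^-1 * (1 + (1 - 2 / m) ^+ 2) - (1 - 2 / (m + 1)) =
     2 / (m ^+ 2 * (m + 1)) by field; rewrite ?gt_eqF //; lra.
  by rewrite divr_ge0 // mulr_ge0 ?sqr_ge0 //; lra.
have : 2/3 <= 2 / (m + 1) by rewrite ler_pdivlMr; lra.
by nra.
Qed.

Lemma sqrt_iter_le1 n : sqrt_iter n <= 1.
Proof. by case/andP: (sqrt_iter_bounds n). Qed.

Lemma sqrt_iter_nd n : sqrt_iter n <= sqrt_iter n.+1.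
Proof.
have := sqrt_iter_le1 n; have := sqrt_iter_ge0 n => /=.
by move: (sqrt_iter n) => r; nra.
Qed.

Lemma le0_sqrt_iter (x K : R) :
  0 <= K -> (forall n, x <= K * (1 - sqrt_iter n)) -> x <= 0.
Proof.
move=> K0 h; rewrite leNgt; apply/negP => x0.
pose n := `|Num.ceil (2 * K / x)|%N.
have c0 : 0 <= 2 * K / x by rewrite divr_ge0 ?mulr_ge0 // ltW.
have nb : 2 * K / x < n.+1%:R.
  rewrite -[n.+1]addn1 natrD; apply: (@le_lt_trans _ _ n%:R); last by lra.
  by rewrite /n natr_absz ger0_norm ?ceil_ge // ceil_ge0; apply: lt_le_trans c0; lra.
move: nb; move: n => n nb; have := h n; case/andP: (sqrt_iter_bounds n) => lo _.
have n0 : 0 < n.+1%:R :> R by rewrite ltr0n.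
have : K * (1 - sqrt_iter n) <= K * (2 / n.+1%:R).
  by apply: ler_wpM2l => //; rewrite lerBlDr addrC -lerBlDr.
have : K * (2 / n.+1%:R) < x.
  move: nb; rewrite ltr_pdivrMr // => nb.
  by rewrite mulrA [K * 2]mulrC ltr_pdivrMr // [x * _]mulrC.
by move=> a b c; have := le_lt_trans (le_trans c b) a; rewrite ltxx.
Qed.

End SqrtIteration.

(* [bd x M] stands for [|x| <= M]; [sc] embeds the real scalars and [ic] is the
   imaginary unit. *)
Record cstar_bound (R : realType) (U : pzRingType) (star : U -> U)
    (sc : {rmorphism R -> U}) (ic : U) (bd : U -> R -> Prop) : Prop := CStarBound {
  starD : forall x y, star (x + y) = star x + star y;
  starM : forall x y, star (x * y) = star y * star x;
  starK : forall x, star (star x) = x;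
  star_sc : forall t, star (sc t) = sc t;
  star_ic : star ic = - ic;
  ic2 : ic * ic = -1;
  sc_comm : forall t x, GRing.comm (sc t) x;
  ic_comm : forall x, GRing.comm ic x;
  bd_ge0 : forall x M, bd x M -> 0 <= M;
  bd_le : forall x M N, bd x M -> M <= N -> bd x N;
  bd_ex : forall x, exists M, bd x M;
  bd_eq0 : forall x, (forall e : R, 0 < e -> bd x e) -> x = 0;
  bd_sc : forall t, bd (sc t) `|t|;
  bd_ic : bd ic 1;
  bdD : forall x y M N, bd x M -> bd y N -> bd (x + y) (M + N);
  bdM : forall x y M N, bd x M -> bd y N -> bd (x * y) (M * N);
  bd_star : forall x M, bd x M -> bd (star x) M;
  bd_cstar : forall x (M : R), 0 <= M -> bd (star x * x) (M ^+ 2) -> bd x M;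
  bd_complete : forall (u : nat -> U) (r : nat -> R) (l : R),
    (forall n, r n <= r n.+1) -> (forall n, r n <= l) ->
    (forall n, bd (u n.+1 - u n) (r n.+1 - r n)) ->
    exists y, forall n, bd (y - u n) (l - r n)
}.

Section UnitalCStar.
Variables (R : realType) (U : pzRingType) (star : U -> U)
    (sc : {rmorphism R -> U}) (ic : U) (bd : U -> R -> Prop).
Hypothesis ax : cstar_bound star sc ic bd.
Implicit Types (x y z h k : U) (t M : R).

Let comm := @GRing.comm U.

Lemma star0 : star 0 = 0.
Proof. by apply: (addIr (star 0)); rewrite -(starD ax) !add0r. Qed.

Lemma starN x : star (- x) = - star x.
Proof. by apply: (addIr (star x)); rewrite -(starD ax) !addNr star0. Qed.

Lemma starB x y : star (x - y) = star x - star y.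
Proof. by rewrite (starD ax) starN. Qed.

Lemma star1 : star 1 = 1.
Proof. by rewrite -(rmorph1 sc) (star_sc ax). Qed.

Lemma bdN x M : bd x M -> bd (- x) M.
Proof.
move=> h; have := bdM ax (bd_sc ax (-1)) h.
by rewrite normrN normr1 mul1r rmorphN1 mulN1r.
Qed.

Lemma bdB x y M N : bd x M -> bd y N -> bd (x - y) (M + N).
Proof. by move=> hx /bdN; exact: (bdD ax hx). Qed.

Lemma bd0 M : 0 <= M -> bd 0 M.
Proof. by move=> M0; have := bd_sc ax 0; rewrite rmorph0 normr0 => h; apply: (bd_le ax h). Qed.

Lemma bd_scM t x M : 0 <= t -> bd x M -> bd (sc t * x) (t * M).
Proof. by move=> t0 h; have := bdM ax (bd_sc ax t) h; rewrite ger0_norm. Qed.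

Lemma bd_sc_le t M : 0 <= t -> t <= M -> bd (sc t) M.
Proof. by move=> t0; apply: (bd_le ax); have := bd_sc ax t; rewrite ger0_norm. Qed.

(** The properties of the limit of the iteration are proved by this criterion: the error made with
    the n-th iterate is a multiple of 1 - [sqrt_iter] n. *)
Lemma bd_sqrt_iter0 x (K : R) : 0 <= K ->
  (forall n, bd x (K * (1 - sqrt_iter R n))) -> x = 0.
Proof.
move=> K0 h; apply: (bd_eq0 ax) => e e0.
have [n hn] : exists n, K * (1 - sqrt_iter R n) < e.
  apply: contrapT => /forallNP hn.
  have : e <= 0.
    by apply: (le0_sqrt_iter K0) => n; rewrite leNgt; apply/negP/hn.
  lra.
exact: (bd_le ax (h n) (ltW hn)).
Qed.

Let half := sc 2^-1.

Lemma half2 x : half * x + half * x = x.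
Proof. by rewrite -mulrDl -rmorphD -[2^-1]div1r -splitr rmorph1 mul1r. Qed.

Fixpoint root_iter (w : U) (n : nat) : U :=
  if n is m.+1 then half * (w + root_iter w m * root_iter w m) else 0.

Lemma root_iter_comm w z n : comm z w -> comm z (root_iter w n).
Proof.
move=> zw; elim: n => [|n IH] /=; first exact: commr0.
apply: commrM; first exact/commr_sym/(sc_comm ax).
by apply: commrD => //; apply: commrM.
Qed.

Lemma root_iter_star w n : star w = w -> star (root_iter w n) = root_iter w n.
Proof.
move=> sw; elim: n => [|n IH] /=; first exact: star0.
by rewrite (starM ax) (star_sc ax) (starD ax) (starM ax) IH sw (sc_comm ax _).
Qed.

Lemma root_iter_bd w n : bd w 1 -> bd (root_iter w n) (sqrt_iter R n).
Proof.
move=> bw; elim: n => [|n IH] /=; first exact: bd0.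
apply: bd_scM => //; apply: (bdD ax) => //; rewrite expr2; exact: (bdM ax).
Qed.

(** The iterates commute, so a difference of squares factors exactly as for the scalar majorant. *)
Lemma root_iterB w n :
  bd w 1 -> bd (root_iter w n.+1 - root_iter w n) (sqrt_iter R n.+1 - sqrt_iter R n).
Proof.
move=> bw; elim: n => [|n IH].
  by rewrite !subr0; apply: root_iter_bd.
have e : root_iter w n.+2 - root_iter w n.+1 =
  half * ((root_iter w n.+1 + root_iter w n) * (root_iter w n.+1 - root_iter w n)).
  have cm : comm (root_iter w n.+1) (root_iter w n).
    by apply/root_iter_comm/commr_sym/root_iter_comm.
  rewrite -[LHS]/(half * (w + root_iter w n.+1 * root_iter w n.+1) -
     half * (w + root_iter w n * root_iter w n)).
  move: cm; set a := root_iter w n.+1; set b := root_iter w n => cm.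
  rewrite -mulrBr; congr (_ * _).
  by rewrite opprD addrACA subrr add0r mulrDl !mulrBr cm addrA subrK.
rewrite e.
have -> : sqrt_iter R n.+2 - sqrt_iter R n.+1 = 2^-1 *
   ((sqrt_iter R n.+1 + sqrt_iter R n) * (sqrt_iter R n.+1 - sqrt_iter R n)).
  rewrite -[LHS]/(2^-1 * (1 + sqrt_iter R n.+1 ^+ 2) - 2^-1 * (1 + sqrt_iter R n ^+ 2)).
  by ring.
apply: bd_scM => //; apply: (bdM ax) => //; apply: (bdD ax); exact: root_iter_bd.
Qed.

(** The limit y solves y = (w + y^2) / 2, which is (1 - y)^2 = 1 - w. The commutation clause is what
    later makes square roots of commuting elements commute. *)
Lemma sqrt_one_sub w : star w = w -> bd w 1 ->
  exists y, [/\ star y = y, bd y 1, (1 - y) * (1 - y) = 1 - w &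
    forall z, comm z w -> comm z y].
Proof.
move=> sw bw.
have [y hy] := bd_complete ax (@sqrt_iter_nd R) (@sqrt_iter_le1 R)
  (fun n => root_iterB n bw).
have by1 : bd y 1.
  by have := bdD ax (hy 0%N) (root_iter_bd 0 bw); rewrite !subrK.
(* With r = [sqrt_iter] n, writing y^2 - y_n^2 = (y - y_n) y + y_n (y - y_n) bounds the error by (1
   - r) (1 + (1 + r) / 2), whence the constant 2. *)
have ey : y - half * (w + y * y) = 0.
  apply: (@bd_sqrt_iter0 _ 2) => // n.
  have -> : y - half * (w + y * y) = (y - root_iter w n.+1) -
     half * ((y - root_iter w n) * y + root_iter w n * (y - root_iter w n)).
    rewrite -[root_iter w n.+1]/(half * (w + root_iter w n * root_iter w n)).
    rewrite mulrBl mulrBr addrA subrK -[RHS]addrA -opprD -mulrDr.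
    by congr (_ - _ * _); rewrite -addrA; congr (_ + _); rewrite addrC subrK.
  have h1 : bd (y - root_iter w n.+1) (1 - sqrt_iter R n).
    by apply: (bd_le ax (hy n.+1)); have := sqrt_iter_nd R n; lra.
  have := bdB h1 (@bd_scM 2^-1 _ _ _ (bdD ax (bdM ax (hy n) by1)
     (bdM ax (root_iter_bd n bw) (hy n)))).
  move=> h; apply: (bd_le ax (h _)) => //.
  have := sqrt_iter_le1 R n; have := sqrt_iter_ge0 R n.
  by move: (sqrt_iter R n) => r; nra.
exists y; split => //.
- apply/eqP; rewrite -subr_eq0; apply/eqP; apply: (@bd_sqrt_iter0 _ 2) => // n.
  have -> : star y - y = star (y - root_iter w n) - (y - root_iter w n).
    by rewrite starB root_iter_star // opprB addrA subrK.
  apply: (bd_le ax (bdB (bd_star ax (hy n)) (hy n))); lra.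
- have : y + y = w + y * y.
    by rewrite -[RHS]half2; congr (_ + _); apply/eqP; rewrite -subr_eq0 ey.
  move=> e; rewrite mulrBl mul1r mulrBr mulr1 opprB addrA.
  by rewrite addrAC -[1 - y - y]addrA -opprD e opprD addrA subrK.
- move=> z zw; apply/eqP; rewrite -subr_eq0; apply/eqP.
  have [K hK] := bd_ex ax z; have K0 := bd_ge0 ax hK.
  apply: (@bd_sqrt_iter0 _ (2 * K)) => [|n]; first by rewrite mulr_ge0.
  have -> : z * y - y * z = z * (y - root_iter w n) - (y - root_iter w n) * z.
    by rewrite mulrBl mulrBr (root_iter_comm n zw) opprB addrA subrK.
  apply: (bd_le ax (bdB (bdM ax hK (hy n)) (bdM ax (hy n) hK))).
  by have := sqrt_iter_le1 R n; nra.
Qed.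

(** A spectrum-free form of positivity: for self-adjoint h, the bound |t - h| <= t says that the
    spectrum lies in [0, 2t]. Closure under sums is then the triangle inequality, while positivity
    of squares becomes a theorem. *)
Definition pos h := star h = h /\ exists t, bd (sc t - h) t.

Lemma bd_pos_ge0 h t : bd (sc t - h) t -> 0 <= t.
Proof. exact: (bd_ge0 ax). Qed.

Lemma pos_bd_le h t t' : bd (sc t - h) t -> t <= t' -> bd (sc t' - h) t'.
Proof.
move=> b tt'; have -> : sc t' - h = sc (t' - t) + (sc t - h).
  by rewrite addrA -rmorphD subrK.
have h1 : bd (sc (t' - t)) (t' - t) by apply: bd_sc_le; rewrite ?subr_ge0.
by have := bdD ax h1 b; rewrite subrK.
Qed.

Lemma posD h k : pos h -> pos k -> pos (h + k).
Proof.
move=> [sh [t bt]] [sk [s bs]]; split; first by rewrite (starD ax) sh sk.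
by exists (t + s); rewrite rmorphD opprD addrACA; apply: (bdD ax).
Qed.

Lemma pos_scM t h : 0 <= t -> pos h -> pos (sc t * h).
Proof.
move=> t0 [sh [s bs]]; split.
  by rewrite (starM ax) sh (star_sc ax) (sc_comm ax).
by exists (t * s); rewrite rmorphM -mulrBr; apply: bd_scM.
Qed.

Lemma pos0 : pos 0.
Proof. by split; [exact: star0 | exists 0; rewrite rmorph0 subr0; apply: bd0]. Qed.

Lemma sc_inv t : t != 0 -> sc t * sc t^-1 = 1.
Proof. by move=> t0; rewrite -rmorphM divff // rmorph1. Qed.

(** For w = 1 - h / t, of norm at most 1, the root 1 - y of 1 - w = h / t is rescaled by the square
    root of t; [t0 + 1] serves as t to make it positive. *)
Lemma pos_sqrt h : pos h -> exists k, [/\ star k = k, k * k = h, pos k &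
  forall z, comm z h -> comm z k].
Proof.
move=> [sh [t0 bt0]].
have t0_ge0 := bd_pos_ge0 bt0.
pose t := t0 + 1; have t_gt0 : 0 < t by rewrite /t; lra.
have {}bt : bd (sc t - h) t by apply: (pos_bd_le bt0); rewrite /t; lra.
pose s := Num.sqrt t; have s_gt0 : 0 < s by rewrite sqrtr_gt0.
have ss : s * s = t by rewrite -expr2 sqr_sqrtr // ltW.
have tN0 : t != 0 by rewrite gt_eqF.
pose w := 1 - sc t^-1 * h.
have sw : star w = w by rewrite /w starB star1 (starM ax) sh (star_sc ax) (sc_comm ax).
have bw : bd w 1.
  have := @bd_scM t^-1 _ _ _ bt; rewrite mulVf // mulrBr -rmorphM mulVf // rmorph1.
  by apply; rewrite invr_ge0 ltW.
have [y [sy by1 ey cy]] := sqrt_one_sub sw bw.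
exists (sc s * (1 - y)); split.
- by rewrite (starM ax) starB star1 sy (star_sc ax) (sc_comm ax).
- rewrite -mulrA [(1 - y) * _]mulrA -[(1 - y) * sc s](sc_comm ax) !mulrA -rmorphM ss -mulrA ey.
  by rewrite /w opprB addrC subrK mulrA sc_inv // mul1r.
- apply: pos_scM; first exact: ltW.
  split; first by rewrite starB star1 sy.
  by exists 1; rewrite rmorph1 opprB addrC subrK.
- move=> z zh; apply: commrM; first exact/commr_sym/(sc_comm ax).
  apply: commrB; first exact: commr1.
  apply: cy; apply: commrB; first exact: commr1.
  by apply: commrM => //; apply/commr_sym/(sc_comm ax).
Qed.

(* [u = k + i m] satisfies [u^* u = t], and [k = (u + u^* ) / 2]. *)
Lemma bd_unitary k m t : 0 < t -> star k = k -> star m = m -> comm k m ->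
  k * k + m * m = sc t -> bd k (Num.sqrt t).
Proof.
move=> t0 sk sm km e.
pose u := k + ic * m.
have su : star u = k - ic * m.
  by rewrite /u (starD ax) sk (starM ax) sm (star_ic ax) mulrN (ic_comm ax).
have iim : ic * m * (ic * m) = - (m * m).
  by rewrite -mulrA [m * (ic * m)]mulrA -(ic_comm ax m) -mulrA mulrA (ic2 ax) mulN1r.
have kim : k * (ic * m) = ic * m * k.
  by rewrite mulrA -(ic_comm ax k) -!mulrA km.
have uu : star u * u = sc t.
  by rewrite su /u mulrDr !mulrBl iim kim opprK addrA subrK.
have bu : bd u (Num.sqrt t).
  apply: (bd_cstar ax); first exact: sqrtr_ge0.
  by rewrite uu sqr_sqrtr ?(ltW t0) //; apply: bd_sc_le => //; apply: ltW.
have -> : k = half * (u + star u).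
  by rewrite su /u addrACA addrN addr0 mulrDr half2.
apply: (bd_le ax (bd_scM _ (bdD ax bu (bd_star ax bu)))); first by rewrite invr_ge0.
lra.
Qed.

(** With k and m the square roots of h and M - h, one has k^2 + m^2 = M, so [bd_unitary] bounds k by
    the square root of M. *)
Lemma pos_bd h M : 0 < M -> pos h -> pos (sc M - h) -> bd h M.
Proof.
move=> M0 /pos_sqrt[k [sk kk _ ck]] /pos_sqrt[m [sm mm _ cm]].
have km : comm k m.
  apply: cm; apply: commrB; first exact/commr_sym/(sc_comm ax).
  by rewrite -kk; apply: commrM.
have e : k * k + m * m = sc M by rewrite kk mm addrC subrK.
have := bd_unitary M0 sk sm km e => bk.
by have := bdM ax bk bk; rewrite kk -expr2 sqr_sqrtr // ltW.
Qed.

(** After scaling k to l of norm at most 1, the root 1 - y of 1 - l^2 satisfies l^2 + (1 - y)^2 = 1;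
    [bd_unitary] then bounds 1 - y, hence also 1 - l^2, by 1. *)
Lemma pos_subr_sqr k M : 0 < M -> star k = k -> bd k M ->
  bd (sc (M ^+ 2) - k * k) (M ^+ 2).
Proof.
move=> M0 sk bk.
have MN0 : M != 0 by rewrite gt_eqF.
pose l := sc M^-1 * k.
have sl : star l = l by rewrite /l (starM ax) sk (star_sc ax) (sc_comm ax).
have bl : bd l 1.
  by have := @bd_scM M^-1 _ _ _ bk; rewrite mulVf //; apply; rewrite invr_ge0 ltW.
have sll : star (l * l) = l * l by rewrite (starM ax) sl.
have bll : bd (l * l) 1 by have := bdM ax bl bl; rewrite mulr1.
have [y [sy by1 ey cy]] := sqrt_one_sub sll bll.
have bm : bd (1 - y) 1.
  rewrite -sqrtr1; apply: (@bd_unitary _ l) => //.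
  - by rewrite starB star1 sy.
  - apply/commr_sym/commrB; first exact: commr1.
    by apply: cy; apply: commrM.
  - by rewrite ey subrK rmorph1.
have -> : sc (M ^+ 2) - k * k = sc (M ^+ 2) * ((1 - y) * (1 - y)).
  rewrite ey mulrBr mulr1; congr (_ - _).
  rewrite /l -mulrA [k * (_ * k)]mulrA -(sc_comm ax _ k) !mulrA -!rmorphM.
  by rewrite expr2 mulfK // divff // rmorph1 mul1r.
have := @bd_scM (M ^+ 2) _ _ _ (bdM ax bm bm).
by rewrite !mulr1; apply; apply: sqr_ge0.
Qed.

Lemma bd_gt0 x : exists2 M : R, 0 < M & bd x M.
Proof.
have [M b] := bd_ex ax x; have := bd_ge0 ax b => M0.
by exists (M + 1); [lra | apply: (bd_le ax b); lra].
Qed.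

Lemma pos_sqr k : star k = k -> pos (k * k).
Proof.
move=> sk; have [M M0 bk] := bd_gt0 k.
by split; [rewrite (starM ax) sk | exists (M ^+ 2); apply: pos_subr_sqr].
Qed.

Lemma pos_sub_bd h M : 0 < M -> pos h -> bd h M -> bd (sc M - h) M.
Proof.
move=> M0 ph bh.
have [k [sk kk _ _]] := pos_sqrt ph.
have bk : bd k (Num.sqrt M).
  apply: (bd_cstar ax); first exact: sqrtr_ge0.
  by rewrite sqr_sqrtr ?(ltW M0) // sk kk.
have s0 : 0 < Num.sqrt M by rewrite sqrtr_gt0.
by have := pos_subr_sqr s0 sk bk; rewrite kk sqr_sqrtr ?(ltW M0).
Qed.

Lemma pos_sub h M : 0 < M -> pos h -> bd h M -> pos (sc M - h).
Proof.
move=> M0 ph bh; have [sh _] := ph; split; first by rewrite starB sh (star_sc ax).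
by exists M; rewrite opprB addrC subrK.
Qed.

(** An order argument: M - h = k + (M - (h + k)) is a sum of positive elements. *)
Lemma bd_monotone h k M : 0 < M -> pos h -> pos k -> bd (h + k) M -> bd h M.
Proof.
move=> M0 ph pk b; apply: pos_bd => //.
have -> : sc M - h = k + (sc M - (h + k)).
  by rewrite opprD [RHS]addrC !addrA subrK.
by apply: posD => //; apply: pos_sub => //; apply: posD.
Qed.

Lemma star_mul_eq0 x : star x * x = 0 -> x = 0.
Proof.
move=> e; apply: (bd_eq0 ax) => t t0; apply: (bd_cstar ax); first exact: ltW.
by rewrite e; apply: bd0; apply: sqr_ge0.
Qed.

Lemma posM h k : pos h -> pos k -> comm h k -> pos (h * k).
Proof.
move=> /pos_sqrt[r [sr rr _ cr]] /pos_sqrt[s [ss es _ cs]] hk.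
have rk : comm r k by apply/commr_sym/cr/commr_sym.
have rs : comm r s by apply: cs.
have -> : h * k = (r * s) * (r * s).
  by rewrite -rr -es -!mulrA; congr (_ * _); rewrite !mulrA rs.
by apply: pos_sqr; rewrite (starM ax) sr ss.
Qed.

Lemma posMn h n : pos h -> pos (h *+ n).
Proof. by move=> ph; elim: n => [|n IH]; [exact: pos0 | rewrite mulrS; apply: posD]. Qed.

(** Bernoulli's inequality (1 + a)^n >= 1 + n a. Commutation with a is part of the induction because
    [posM] applies to commuting elements. *)
Lemma pos_bernoulli a n : pos a ->
  pos ((1 + a) ^+ n - 1 - a *+ n) /\ comm ((1 + a) ^+ n - 1 - a *+ n) a.
Proof.
move=> pa; elim: n => [|n [IH1 IH2]].
  by rewrite expr0 subrr mulr0n subr0; split; [exact: pos0 | exact/commr_sym/commr0].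
have e : (1 + a) ^+ n.+1 - 1 - a *+ n.+1 = ((1 + a) ^+ n - 1 - a *+ n) +
   ((1 + a) ^+ n - 1 - a *+ n + a *+ n) * a.
  rewrite subrK exprSr mulrDr mulr1 mulrSr mulrBl mul1r opprD.
  rewrite -!addrA; congr (_ + _); rewrite addrCA; congr (_ + _).
  by rewrite addrCA.
have cm : comm ((1 + a) ^+ n - 1 - a *+ n + a *+ n) a.
  by apply/commr_sym/commrD; [exact/commr_sym | exact: commrMn].
rewrite e; split.
  apply: posD => //; apply: posM => //; apply: posD => //; exact: posMn.
by apply/commr_sym/commrD; [exact/commr_sym | apply: commrM => //; exact/commr_sym].
Qed.

(** Bernoulli's inequality gives n a^2 <= a (1 + a)^n, so n |a^2| stays bounded and a^2 = 0. *)
Lemma pos_powers_bounded a C : pos a -> (forall n, bd (a * (1 + a) ^+ n) C) -> a = 0.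
Proof.
move=> pa b.
have C0 : 0 <= C := bd_ge0 ax (b 0%N).
have [sa _] := pa.
apply: star_mul_eq0; rewrite sa; apply: (bd_eq0 ax) => e e0.
have bn n : bd (a * a *+ n) (C + 1).
  have [p1 c1] := pos_bernoulli n pa.
  apply: (@bd_monotone _ (a + a * ((1 + a) ^+ n - 1 - a *+ n))); first by lra.
  - by apply: posMn; apply: pos_sqr.
  - by apply: posD => //; apply: posM => //; apply/commr_sym.
  - have -> : a * a *+ n + (a + a * ((1 + a) ^+ n - 1 - a *+ n)) = a * (1 + a) ^+ n.
      rewrite !mulrBr mulr1 mulrnAr [_ - a - _]addrAC [a + _]addrC subrK.
      by rewrite addrCA subrr addr0.
    by apply: (bd_le ax (b n)); lra.
pose n := (Num.trunc ((C + 1) / e)).+1.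
have n0 : 0 < n%:R :> R by rewrite ltr0n.
have hn : (C + 1) / e < n%:R by apply: truncnS_gt.
have -> : a * a = sc n%:R^-1 * (a * a *+ n).
  rewrite -[a * a *+ n]mulr_natl -(rmorph_nat sc) mulrA -rmorphM mulVf ?gt_eqF //.
  by rewrite rmorph1 mul1r.
have := bd_scM _ (bn n); move=> /(_ n%:R^-1) h.
apply: (bd_le ax (h _)); first by rewrite invr_ge0 ltW.
rewrite mulrC ler_pdivrMr // mulrC -ler_pdivrMr //; exact: ltW.
Qed.

(* Since [c^* (1 - P / s)^n c = - k (1 + k / s)^n] for [P = c c^*], the powers
   on the right are bounded, which forces [k = 0]. *)
Lemma neg_starM c k : pos k -> pos (c * star c) -> star c * c = - k -> k = 0.
Proof.
move=> pk pP e; set P := c * star c in pP.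
have [s s0 bs] := bd_gt0 P; have sN0 : s != 0 by rewrite gt_eqF.
have [C C0 bc] := bd_gt0 c.
pose a := sc s^-1 * k.
have pa : pos a by apply: pos_scM => //; rewrite invr_ge0 ltW.
have b1 : bd (1 - sc s^-1 * P) 1.
  have := @bd_scM s^-1 _ _ _ (pos_sub_bd s0 pP bs).
  by rewrite mulrBr -rmorphM mulVf // rmorph1; apply; rewrite invr_ge0 ltW.
have b1n n : bd ((1 - sc s^-1 * P) ^+ n) 1.
  elim: n => [|n IH]; first by rewrite expr0 -(rmorph1 sc); apply: bd_sc_le.
  by have := bdM ax b1 IH; rewrite mulr1 -exprS.
(* Since P c = c (c^* c) = - c k, the element c intertwines 1 - P / s and 1 + k / s. *)
have int1 : (1 - sc s^-1 * P) * c = c * (1 + a).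
  rewrite mulrBl mulrDr mul1r mulr1; congr (_ + _).
  by rewrite /P /a -!mulrA e mulrN mulrN opprK mulrA (sc_comm ax) -mulrA.
have intn n : (1 - sc s^-1 * P) ^+ n * c = c * (1 + a) ^+ n.
  elim: n => [|n IH]; first by rewrite !expr0 mul1r mulr1.
  by rewrite exprS -mulrA IH mulrA int1 -mulrA -exprS.
have bk n : bd (k * (1 + a) ^+ n) (C * C).
  have := bdN (bdM ax (bd_star ax bc) (bdM ax (b1n n) bc)).
  by rewrite intn mulrA e mul1r mulNr opprK.
have a0 : a = 0.
  apply: (@pos_powers_bounded _ (s^-1 * (C * C))) => // n.
  by rewrite -mulrA; apply: bd_scM => //; rewrite invr_ge0 ltW.
by rewrite -[k]mul1r -(sc_inv sN0) -mulrA -/a a0 mulr0.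
Qed.

(* Write [h = a^* a] and [y = |h| - h], so that [h y = - y |h|].  Then
   [c = a y] has [c^* c = - (y |h|^(1/2))^2 <= 0] while
   [c c^* = (real part)^2 + (imaginary part)^2 - c^* c >= 0], up to a scalar. *)
Lemma pos_starM a : pos (star a * a).
Proof.
set h := star a * a.
have sh : star h = h by rewrite (starM ax) (starK ax).
have [H [sH HH pH cH]] := pos_sqrt (pos_sqr sh).
have hH : comm h H by apply: cH; apply: commrM.
have [K [sK KK _ cK]] := pos_sqrt pH.
pose y := H - h.
have sy : star y = y by rewrite starB sH sh.
have yH : comm y H by apply/commr_sym/commrB => //; exact/commr_sym.
have yK : comm y K by apply: cK.
have hy : h * y = - (y * H) by rewrite mulrBl mulrBr -HH opprB hH.
have yh : y * h = - (y * H) by rewrite -hy mulrBl mulrBr hH.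
pose g := y * K; have sg : star g = g by rewrite (starM ax) sy sK.
have gg : g * g = y * y * H by rewrite /g -!mulrA [K * (y * K)]mulrA -yK -[y * K * K]mulrA KK.
pose c := a * y.
have cc : star c * c = - (g * g).
  by rewrite (starM ax) sy gg mulrA -[_ * star a * a]mulrA -/h -mulrA hy mulrN mulrA.
pose u := c + star c; pose v := ic * (c - star c).
have su : star u = u by rewrite (starD ax) (starK ax) addrC.
have sv : star v = v.
  by rewrite (starM ax) starB (starK ax) (star_ic ax) mulrN -mulNr opprB -(ic_comm ax).
have vv : v * v = - ((c - star c) * (c - star c)).
  by rewrite /v -mulrA [_ * (ic * _)]mulrA -(ic_comm ax (c - _)) -mulrA mulrA (ic2 ax) mulN1r.
have uv : u * u + v * v = (star c * c + c * star c) + (star c * c + c * star c).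
  rewrite vv /u !mulrDl !mulrDr !mulrN !mulNr !opprD !opprK.
  set A := c * c; set B := c * star c; set C := star c * c; set D := star c * star c.
  rewrite addrACA [A + B + _]addrACA addrN add0r [C + D + _]addrACA addrN addr0.
  by rewrite addrACA [C + B]addrC.
have ccs : c * star c = half * (u * u + v * v) + g * g.
  by rewrite uv mulrDr half2 cc addrAC addNr add0r.
have g0 : g * g = 0.
  apply: (@neg_starM c) => //; first exact: pos_sqr.
  rewrite ccs; apply: posD; last exact: pos_sqr.
  by apply: pos_scM; [rewrite invr_ge0 | apply: posD; exact: pos_sqr].
(* Here y^3 = y^2 [H] - y^2 h, where y^2 h = - y^2 [H] and y^2 [H] = g^2 = 0. A self-adjoint
   nilpotent element vanishes, so h = [H]. *)
have y3 : y * y * y = 0.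
  by rewrite {3}/y mulrBr -gg g0 -[y * y * h]mulrA yh mulrN mulrA -gg g0 !oppr0 addr0.
have y2 : y * y = 0.
  by apply: star_mul_eq0; rewrite (starM ax) sy mulrA y3 mul0r.
have y0 : y = 0 by apply: star_mul_eq0; rewrite sy.
by have -> : h = H by apply/esym/eqP; rewrite -subr_eq0 -/y y0.
Qed.

End UnitalCStar.

(** * Adjointable operators and positivity in a C*-algebra *)

Section RealNorm.
Variables (R : realType) (V : normedModType R[i]).
Implicit Types (x y z : V).

(** Norms over R[i] take values in R[i]; the real part keeps all estimates in the ordered field
    R. *)
Definition rnorm x : R := complex.Re `|x|.

Lemma rnormE x : `|x| = real_complex R (rnorm x).
Proof. by rewrite /rnorm RRe_real // normr_real. Qed.

Lemma ReM_real (k : R[i]) (t : R) : complex.Re (k * real_complex R t) = complex.Re k * t.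
Proof. by case: k => a b; rewrite /= mulr0 subr0. Qed.

Lemma rnorm_ge0 x : 0 <= rnorm x.
Proof. by rewrite -lecR -rnormE normr_ge0. Qed.

Lemma rnorm0 : rnorm (0 : V) = 0.
Proof. by rewrite /rnorm normr0. Qed.

Lemma rnorm_eq0 x : rnorm x = 0 -> x = 0.
Proof. by move=> h; apply/eqP; rewrite -normr_eq0 rnormE h. Qed.

Lemma rnorm_le0 x : rnorm x <= 0 -> x = 0.
Proof. by move=> h; apply: rnorm_eq0; apply/eqP; rewrite eq_le h rnorm_ge0. Qed.

Lemma rnormD x y : rnorm (x + y) <= rnorm x + rnorm y.
Proof. by rewrite -lecR rmorphD /= -!rnormE ler_normD. Qed.

Lemma rnormN x : rnorm (- x) = rnorm x.
Proof. by rewrite /rnorm normrN. Qed.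

Lemma rnormB x y : rnorm (x - y) <= rnorm x + rnorm y.
Proof. by have := rnormD x (- y); rewrite rnormN. Qed.

Lemma rnormC x y : rnorm (x - y) = rnorm (y - x).
Proof. by rewrite -rnormN opprB. Qed.

Lemma rnorm_tri x y z : rnorm (x - z) <= rnorm (x - y) + rnorm (y - z).
Proof. by have := rnormD (x - y) (y - z); rewrite addrA subrK. Qed.

Lemma rnormZ (k : R[i]) x : rnorm (k *: x) = complex.Re `|k| * rnorm x.
Proof. by rewrite /rnorm normrZ rnormE ReM_real -rnormE. Qed.

Lemma norm_real (t : R) : complex.Re `|real_complex R t| = `|t|.
Proof. by rewrite normc_def /= expr0n addr0 sqrtr_sqr. Qed.

Lemma rnormZr (t : R) x : rnorm (real_complex R t *: x) = `|t| * rnorm x.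
Proof. by rewrite rnormZ norm_real. Qed.

Lemma Re_norm_ge0 (k : R[i]) : 0 <= complex.Re `|k|.
Proof. by rewrite normc_def /= sqrtr_ge0. Qed.

Lemma rnorm_sum (I : Type) (s : seq I) (P : pred I) (f : I -> V) :
  rnorm (\sum_(i <- s | P i) f i) <= \sum_(i <- s | P i) rnorm (f i).
Proof.
apply: (big_ind2 (fun a b => rnorm a <= b)) => //; first by rewrite rnorm0.
by move=> x1 x2 y1 y2 h1 h2; apply: le_trans (rnormD _ _) _; apply: lerD.
Qed.

Section Limits.
Variables (T : Type) (F : set_system T).

Definition rlim (v : T -> V) (l : V) :=
  forall e : R, 0 < e -> F [set t | rnorm (l - v t) <= e].

Lemma rlimP {FF : Filter F} v l : rlim v l <-> v @ F --> l.
Proof.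
split=> [h|/cvgrPdist_le h e e0].
  apply/cvgrPdist_le => e; rewrite ltcE /= => /andP[/eqP im re].
  have := h _ re; apply: filterS => t /=.
  by rewrite -lecR -rnormE; case: e im {re} => a b /= ->.
have e0' : 0 < real_complex R e by rewrite ltcR.
have := h _ e0'; apply: filterS => t /=.
by rewrite rnormE lecR.
Qed.

Context {FF : ProperFilter F}.

Lemma rlim_lim v l : rlim v l -> lim (v @ F) = l.
Proof. by move=> /rlimP h; apply/norm_cvg_lim. Qed.

Lemma rlim_le v l a (M : R) : rlim v l -> F [set t | rnorm (v t - a) <= M] ->
  rnorm (l - a) <= M.
Proof.
move=> h hM; apply/ler_addgt0Pr => e e0.
have [t [/= ht hMt]] := filter_ex (filterI (h _ e0) hM).
by apply: le_trans (rnorm_tri l (v t) a) _; rewrite addrC lerD.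
Qed.

Lemma rlim_cst (a : V) : rlim (fun=> a) a.
Proof. by move=> e e0; apply: filterE => t /=; rewrite subrr rnorm0 ltW. Qed.

Lemma rlim_near v v' l : F [set t | v t = v' t] -> rlim v l -> rlim v' l.
Proof. by move=> E h e e0; apply: filterS2 E (h _ e0) => t /= ->. Qed.

Lemma rlimD v v' l l' : rlim v l -> rlim v' l' -> rlim (fun t => v t + v' t) (l + l').
Proof.
move=> h h' e e0; have e2 : 0 < e / 2 by rewrite divr_gt0.
apply: filterS2 (h _ e2) (h' _ e2) => t /= a b.
rewrite opprD addrACA; apply: le_trans (rnormD _ _) _; lra.
Qed.

Lemma rlimZ (k : R[i]) v l : rlim v l -> rlim (fun t => k *: v t) (k *: l).
Proof.
move=> h e e0; have k0 := Re_norm_ge0 k.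
have e2 : 0 < e / (complex.Re `|k| + 1) by rewrite divr_gt0 //; lra.
apply: filterS (h _ e2) => t /= a.
rewrite -scalerBr rnormZ.
apply: (@le_trans _ _ (complex.Re `|k| * (e / (complex.Re `|k| + 1)))).
  exact: ler_wpM2l.
rewrite mulrA ler_pdivrMr; last by lra.
nra.
Qed.

Lemma rlim_sum (I : eqType) (s : seq I) (v : I -> T -> V) (l : I -> V) :
  {in s, forall i, rlim (v i) (l i)} ->
  rlim (fun t => \sum_(i <- s) v i t) (\sum_(i <- s) l i).
Proof.
elim: s => [|i s IH] h.
  rewrite big_nil; apply: rlim_near (rlim_cst 0).
  by apply: filterE => t /=; rewrite big_nil.
have hi : rlim (v i) (l i) by apply: h; rewrite inE eqxx.
have hs : {in s, forall i, rlim (v i) (l i)}.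
  by move=> j js; apply: h; rewrite inE js orbT.
rewrite big_cons; apply: rlim_near (rlimD hi (IH hs)).
by apply: filterE => t /=; rewrite big_cons.
Qed.

End Limits.
End RealNorm.

Lemma rcauchy_lim (R : realType) (V : completeNormedModType R[i]) (T : Type)
    (F : set_system T) {FF : ProperFilter F} (v : T -> V) :
  (forall e : R, 0 < e -> exists2 S, F S & forall s t, S s -> S t -> rnorm (v s - v t) <= e) ->
  exists l, rlim F v l.
Proof.
move=> h.
have cv : cauchy (v @ F).
  apply: cauchy_exP => e e0.
  have re : 0 < complex.Re e / 2.
    by move: e0; rewrite ltcE /= => /andP[_ re]; rewrite divr_gt0.
  have [S FS hS] := h _ re; have [s0 Ss0] := filter_ex FS.
  exists (v s0); rewrite /= /fmap /=; apply: filterS FS => t St /=.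
  rewrite -ball_normE /= rnormE.
  move: e0; rewrite ltcE /= => /andP[/eqP im p].
  have := hS _ _ Ss0 St => q.
  by rewrite ltcE /= im eqxx /=; lra.
have /cauchy_cvg/cvg_ex[l hl] := cv.
by exists l; apply/rlimP.
Qed.

Section CStarNorm.
Variables (R : realType) (A : cstarAlgType R).
Implicit Types (a x y z : A).

Lemma cmulDl x y z : cmul (x + y) z = cmul x z + cmul y z.
Proof. by have := cmulPl 1 x y z; rewrite !scale1r. Qed.

Lemma cmulDr x y z : cmul x (y + z) = cmul x y + cmul x z.
Proof. by have := cmulPr 1 x y z; rewrite !scale1r. Qed.

Lemma cmul0l y : cmul 0 y = 0.
Proof. by apply: (addIr (cmul 0 y)); rewrite -cmulDl !add0r. Qed.

Lemma cmul0r y : cmul y 0 = 0.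
Proof. by apply: (addIr (cmul y 0)); rewrite -cmulDr !add0r. Qed.

Lemma cmulZl k x y : cmul (k *: x) y = k *: cmul x y.
Proof. by have := cmulPl k x 0 y; rewrite cmul0l !addr0. Qed.

Lemma cmulZr k x y : cmul x (k *: y) = k *: cmul x y.
Proof. by have := cmulPr k x y 0; rewrite cmul0r !addr0. Qed.

Lemma cmulNl x y : cmul (- x) y = - cmul x y.
Proof. by rewrite -scaleN1r cmulZl scaleN1r. Qed.

Lemma cmulNr x y : cmul x (- y) = - cmul x y.
Proof. by rewrite -scaleN1r cmulZr scaleN1r. Qed.

Lemma cstarD x y : cstar (x + y) = cstar x + cstar y.
Proof. by have := cstarP 1 x y; rewrite !scale1r conjc1 scale1r. Qed.

Lemma cstar0 : cstar 0 = 0 :> A.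
Proof. by apply: (addIr (cstar 0)); rewrite -cstarD !add0r. Qed.

Lemma cstarZ k x : cstar (k *: x) = conjc k *: cstar x.
Proof. by have := cstarP k x 0; rewrite cstar0 !addr0. Qed.

Lemma cstarN x : cstar (- x) = - cstar x.
Proof. by rewrite -scaleN1r cstarZ rmorphN1 scaleN1r. Qed.

Lemma rnorm_cmul x y : rnorm (cmul x y) <= rnorm x * rnorm y.
Proof. by rewrite -lecR rmorphM /= -!rnormE cmul_norm. Qed.

Lemma rnorm_cstar_mul x : rnorm (cmul (cstar x) x) = rnorm x ^+ 2.
Proof. by apply: complexI; rewrite rmorphXn /= -!rnormE cstar_norm. Qed.

Lemma cstar_mul_eq0 x : cmul (cstar x) x = 0 -> x = 0.
Proof.
move=> e; apply: rnorm_eq0; apply/eqP.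
by rewrite -sqrf_eq0 -rnorm_cstar_mul e rnorm0.
Qed.

Lemma rnorm_cstar x : rnorm (cstar x) = rnorm x.
Proof.
have h y : rnorm y <= rnorm (cstar y).
  have [->|y0] := eqVneq (rnorm y) 0; first exact: rnorm_ge0.
  have p : 0 < rnorm y by rewrite lt_neqAle eq_sym y0 rnorm_ge0.
  by rewrite -(ler_pM2r p) -expr2 -rnorm_cstar_mul rnorm_cmul.
by apply/eqP; rewrite eq_le h -{2}[x]cstarK h.
Qed.

End CStarNorm.

(** * Adjointable operators on a C*-algebra seen as a Hilbert module over itself *)

Section AdjointableOperators.
Variables (R : realType) (A : cstarAlgType R).
Implicit Types (x y z : A).

(** Adjointness for the inner product <x, y> = x^* y, which makes A a right Hilbert module over
    itself. *)
Definition adjoint_pair (f g : A -> A) :=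
  forall x y, cmul (cstar (f x)) y = cmul (cstar x) (g y).

Definition op_bound (f : A -> A) (M : R) :=
  0 <= M /\ forall x, rnorm (f x) <= M * rnorm x.

Definition adjointable : {pred A -> A} :=
  fun f => `[< (exists g, adjoint_pair f g) /\ exists M, op_bound f M >].

Lemma cstar_eq0l x : (forall y, cmul (cstar x) y = 0) -> x = 0.
Proof. by move=> h; apply: cstar_mul_eq0. Qed.

Lemma adjoint_sym f g : adjoint_pair f g -> adjoint_pair g f.
Proof.
move=> h x y; rewrite -[LHS]cstarK cstarM cstarK -h cstarM cstarK //.
Qed.

Lemma adjoint_unique f g g' : adjoint_pair f g -> adjoint_pair f g' -> g = g'.
Proof.
move=> h h'; apply/funext => y; apply/eqP; rewrite -subr_eq0; apply/eqP.
apply: cstar_eq0l => z; rewrite cstarD cstarN cmulDl cmulNl.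
by rewrite (adjoint_sym h) (adjoint_sym h') subrr.
Qed.

(** Nondegeneracy of the inner product forces linearity, which is why [adjointable] does not ask for
    it. *)
Lemma adjoint_linear f g : adjoint_pair f g ->
  forall k x y, f (k *: x + y) = k *: f x + f y.
Proof.
move=> h k x y; apply/eqP; rewrite -subr_eq0; apply/eqP.
apply: cstar_eq0l => z.
rewrite cstarD cstarN cmulDl cmulNl h !cstarP !cmulPl !h.
by rewrite subrr.
Qed.

Lemma adjoint_pairB f g f' g' : adjoint_pair f g -> adjoint_pair f' g' ->
  adjoint_pair (f - f') (g - g').
Proof.
by move=> h h' x y; rewrite [(f - f') x]/(f x - f' x) cstarD cstarN cmulDl cmulNl h h'
  -cmulNr -cmulDr.
Qed.

Lemma op_boundB f g M N : op_bound f M -> op_bound g N -> op_bound (f - g) (M + N).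
Proof.
move=> [M0 h] [N0 h']; split; first exact: addr_ge0.
move=> x; rewrite mulrDl; apply: le_trans (rnormB _ _) _; exact: lerD.
Qed.

(** |g x|^2 = |<f (g x), x>| <= M |g x| |x|. *)
Lemma op_bound_adjoint f g M : adjoint_pair f g -> op_bound f M -> op_bound g M.
Proof.
move=> h [M0 b]; split=> // x.
have [->|p] := eqVneq (rnorm (g x)) 0; first by rewrite mulr_ge0 ?rnorm_ge0.
have {}p : 0 < rnorm (g x) by rewrite lt_neqAle eq_sym p rnorm_ge0.
rewrite -(ler_pM2r p) -expr2 -rnorm_cstar_mul -h.
apply: le_trans (rnorm_cmul _ _) _; rewrite rnorm_cstar mulrAC.
by apply: ler_wpM2r; [exact: rnorm_ge0 | exact: b].
Qed.

Lemma adjointable_zmod : zmod_closed adjointable.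
Proof.
split=> [|f f' /asboolP[[g h] [M b]] /asboolP[[g' h'] [M' b']]]; apply/asboolP; split.
- by exists (fun=> 0) => x y; rewrite [(0 : A -> A) x]/0 cstar0 cmul0l cmul0r.
- by exists 0; split=> // x; rewrite [(0 : A -> A) x]/0 rnorm0 mul0r.
- by exists (g - g'); apply: adjoint_pairB.
- by exists (M + M'); apply: op_boundB.
Qed.

HB.instance Definition _ := GRing.isZmodClosed.Build (A -> A) adjointable adjointable_zmod.

Record adjop := AdjOp { adjop_fun :> A -> A; adjopP : adjop_fun \in adjointable }.

HB.instance Definition _ := [isSub for adjop_fun].
HB.instance Definition _ := [Choice of adjop by <:].
HB.instance Definition _ := [SubChoice_isSubZmodule of adjop by <:].

End AdjointableOperators.

Section AdjointableAlgebra.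
Variables (R : realType) (A : cstarAlgType R).
Implicit Types (x y z : A) (S T U : adjop A).

Lemma adjop_ext S T : (forall x, S x = T x) -> S = T.
Proof. by move=> h; apply: val_inj; apply/funext. Qed.

Lemma adjopDE S T x : (S + T) x = S x + T x. Proof. by []. Qed.
Lemma adjopNE S x : (- S) x = - S x. Proof. by []. Qed.
Lemma adjopBE S T x : (S - T) x = S x - T x. Proof. by []. Qed.
Lemma adjop0E x : (0 : adjop A) x = 0. Proof. by []. Qed.

Lemma adjop_exP T : (exists g, adjoint_pair T g) /\ exists M, op_bound T M.
Proof. exact/asboolP/adjopP. Qed.

Definition adj_fun T : A -> A := projT1 (cid (adjop_exP T).1).

Lemma adj_funP T : adjoint_pair T (adj_fun T).
Proof. exact: (projT2 (cid (adjop_exP T).1)). Qed.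

Lemma adj_fun_in T : adj_fun T \in @adjointable R A.
Proof.
apply/asboolP; split; first by exists T; apply/adjoint_sym/adj_funP.
by have [_ [M b]] := adjop_exP T; exists M; apply: op_bound_adjoint (adj_funP T) b.
Qed.

Definition adj_star T := AdjOp (adj_fun_in T).

Lemma adj_starP T : adjoint_pair T (adj_star T).
Proof. exact: adj_funP. Qed.

Lemma adj_star_eq T T' : adjoint_pair T T' -> adj_star T = T'.
Proof. by move=> h; apply: val_inj; apply: adjoint_unique (adj_starP T) h. Qed.

Lemma adjop_linear T k x y : T (k *: x + y) = k *: T x + T y.
Proof. exact: (adjoint_linear (adj_starP T)). Qed.

Lemma adjop_D T x y : T (x + y) = T x + T y.
Proof. by have := adjop_linear T 1 x y; rewrite !scale1r. Qed.

Lemma adjop_0 T : T 0 = 0.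
Proof. by apply: (addIr (T 0)); rewrite -adjop_D !add0r. Qed.

Lemma adjop_Z T k x : T (k *: x) = k *: T x.
Proof. by have := adjop_linear T k x 0; rewrite adjop_0 !addr0. Qed.

Lemma op_boundM (f g : A -> A) (M N : R) :
  op_bound f M -> op_bound g N -> op_bound (f \o g) (M * N).
Proof.
move=> [M0 h] [N0 h']; split; first exact: mulr_ge0.
move=> x /=; rewrite -mulrA; apply: le_trans (h _) _; exact: ler_wpM2l.
Qed.

Lemma adjop_mul_in S T : S \o T \in @adjointable R A.
Proof.
apply/asboolP; split.
  by exists (adj_star T \o adj_star S) => x y /=; rewrite !adj_starP.
have [_ [M b]] := adjop_exP S; have [_ [N c]] := adjop_exP T.
by exists (M * N); apply: op_boundM.
Qed.

Definition adjop_mul S T := AdjOp (adjop_mul_in S T).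

Lemma scale_adjoint (k : R[i]) : @adjoint_pair R A (fun x => k *: x) (fun x => conjc k *: x).
Proof. by move=> x y; rewrite cstarZ cmulZl cmulZr. Qed.

Lemma scale_bound (k : R[i]) : @op_bound R A (fun x => k *: x) (complex.Re `|k|).
Proof. by split=> [|x]; [exact: Re_norm_ge0 | rewrite rnormZ]. Qed.

Lemma adjop_scale_in (k : R[i]) : (fun x : A => k *: x) \in @adjointable R A.
Proof.
apply/asboolP; split; first by eexists; exact: scale_adjoint.
by eexists; exact: scale_bound.
Qed.

Definition adjop_scale k := AdjOp (adjop_scale_in k).

Fact adjop_mulA : associative adjop_mul.
Proof. by move=> S T U; apply: adjop_ext. Qed.

Fact adjop_mul1 : left_id (adjop_scale 1) adjop_mul.
Proof. by move=> T; apply: adjop_ext => x /=; rewrite scale1r. Qed.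

Fact adjop_mulr1 : right_id (adjop_scale 1) adjop_mul.
Proof. by move=> T; apply: adjop_ext => x /=; rewrite scale1r. Qed.

Fact adjop_mulDl : left_distributive adjop_mul +%R.
Proof. by move=> S T U; apply: adjop_ext. Qed.

Fact adjop_mulDr : right_distributive adjop_mul +%R.
Proof.
by move=> S T U; apply: adjop_ext => x; exact: adjop_D.
Qed.

HB.instance Definition _ := GRing.Zmodule_isPzRing.Build (adjop A)
  adjop_mulA adjop_mul1 adjop_mulr1 adjop_mulDl adjop_mulDr.

Lemma adjopME S T x : (S * T) x = S (T x). Proof. by []. Qed.

Definition adjop_real (t : R) : adjop A := adjop_scale (real_complex R t).

Lemma adjop_realE t x : adjop_real t x = real_complex R t *: x. Proof. by []. Qed.

Fact adjop_real_zmod : zmod_morphism adjop_real.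
Proof.
by move=> s t; apply: adjop_ext => x; rewrite adjopBE !adjop_realE rmorphB scalerBl.
Qed.

Fact adjop_real_monoid : monoid_morphism adjop_real.
Proof.
split; first by [].
by move=> s t; apply: adjop_ext => x; rewrite adjopME !adjop_realE rmorphM scalerA.
Qed.

HB.instance Definition _ := GRing.isZmodMorphism.Build R (adjop A) adjop_real adjop_real_zmod.
HB.instance Definition _ := GRing.isMonoidMorphism.Build R (adjop A) adjop_real adjop_real_monoid.

Definition adj_bd T M := op_bound T M.

(** The operators converge pointwise, and so do their adjoints, which satisfy the same bounds; the
    two limits form an adjoint pair by continuity of the inner product, so the limit is again
    adjointable. *)
Lemma op_bound_lim (u : nat -> adjop A) (r : nat -> R) (l : R) :
    (forall n, r n <= r n.+1) -> (forall n, r n <= l) ->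
    (forall n, adj_bd (u n.+1 - u n) (r n.+1 - r n)) ->
  exists y : adjop A, forall n, adj_bd (y - u n) (l - r n).
Proof.
move=> rn rl ru.
have ndr : nondecreasing_seq r by apply/nondecreasing_seqP.
have cr : cvgn r by apply: nondecreasing_is_cvgn => //; exists l => _ [n _ <-].
have ud n d : adj_bd (u (n + d)%N - u n) (r (n + d)%N - r n).
  elim: d => [|d [p0 pb]].
    by rewrite addn0 !subrr; split=> // x; rewrite adjop0E rnorm0 mul0r.
  have [q0 qb] := ru (n + d)%N; rewrite addnS.
  split; first by have := ndr _ _ (leq_addr d.+1 n); rewrite addnS subr_ge0.
  move=> x; have := rnormD ((u (n + d).+1 - u (n + d)%N) x) ((u (n + d)%N - u n) x).
  rewrite !adjopBE addrA subrK => h; apply: le_trans h _.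
  have := qb x; have := pb x; rewrite !adjopBE => h1 h2.
  by apply: le_trans (lerD h2 h1) _; rewrite -mulrDl addrA subrK.
have um n m : (n <= m)%N -> adj_bd (u m - u n) (r m - r n).
  by move=> /subnKC <-.
(* Stated for a general sequence, to apply both to [u] and to its adjoints. *)
have ulim (v : nat -> A -> A) : (forall n m x, (n <= m)%N ->
    rnorm (v m x - v n x) <= (r m - r n) * rnorm x) ->
    forall x, exists y, rlim \oo (v ^~ x) y.
  move=> hv x; apply: rcauchy_lim => e e0.
  have xp : 0 < rnorm x + 1 by have := rnorm_ge0 x; lra.
  have e2 : 0 < e / 2 / (rnorm x + 1) by rewrite !divr_gt0.
  have /cvgrPdist_lt/(_ _ e2) [N _ hN] := cr.
  exists [set n | (N <= n)%N]; first by exists N.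
  have key m : (N <= m)%N -> rnorm (v m x - v N x) <= e / 2.
    move=> Nm; apply: le_trans (hv _ _ x Nm) _.
    have a1 := hN N (leqnn N); have r1 := nondecreasing_cvgn_le ndr cr m.
    have : r m - r N <= e / 2 / (rnorm x + 1).
      by move: a1 => /=; move/ltr_normlW; lra.
    move=> h; apply: le_trans (ler_wpM2r (rnorm_ge0 x) h) _.
    rewrite mulrAC ler_pdivrMr //; nra.
  move=> m n /= /key h1 /key h2.
  apply: le_trans (rnorm_tri _ (v N x) _) _; rewrite [X in _ + X]rnormC; lra.
have h1 x : exists y, rlim \oo (fun n => u n x) y.
  apply: (ulim (fun n => u n)) => n m z nm.
  by have [_ b] := um _ _ nm; exact: b.
have h2 x : exists y, rlim \oo (fun n => adj_star (u n) x) y.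
  apply: (ulim (fun n => adj_star (u n))) => n m z nm.
  have ap : adjoint_pair (u m - u n) (adj_star (u m) - adj_star (u n)).
    exact: adjoint_pairB (adj_starP _) (adj_starP _).
  by have [_ b] := op_bound_adjoint ap (um _ _ nm); exact: b.
have [f hf] := choice h1; have [g hg] := choice h2.
have fb n x : rnorm (f x - u n x) <= (l - r n) * rnorm x.
  apply: (rlim_le (hf x)); exists n => // m /= nm.
  have [_ b] := um _ _ nm; apply: le_trans (b x) _.
  by apply: ler_wpM2r; [exact: rnorm_ge0 | rewrite lerB].
have fg : adjoint_pair f g.
  move=> x y; apply/eqP; rewrite -subr_eq0; apply/eqP/rnorm_le0/ler_addgt0Pr => e e0.
  have p1 : 0 < e / 2 / (rnorm y + 1) by rewrite !divr_gt0 //; have := rnorm_ge0 y; lra.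
  have p2 : 0 < e / 2 / (rnorm x + 1) by rewrite !divr_gt0 //; have := rnorm_ge0 x; lra.
  have [n [/= a b]] := filter_ex (filterI (hf x _ p1) (hg y _ p2)).
  have -> : cmul (cstar (f x)) y - cmul (cstar x) (g y) =
    cmul (cstar (f x - u n x)) y - cmul (cstar x) (g y - adj_star (u n) y).
    rewrite cstarD cstarN cmulDl cmulNl cmulDr cmulNr (adj_starP (u n)).
    by rewrite opprB addrA subrK.
  apply: le_trans (rnormB _ _) _.
  have c1 := rnorm_cmul (cstar (f x - u n x)) y.
  have c2 := rnorm_cmul (cstar x) (g y - adj_star (u n) y).
  rewrite !rnorm_cstar in c1 c2.
  have d1 : rnorm (f x - u n x) * rnorm y <= e / 2.
    apply: le_trans (ler_wpM2r (rnorm_ge0 y) a) _.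
    have := rnorm_ge0 y => y0; rewrite mulrAC ler_pdivrMr; [nra|lra].
  have d2 : rnorm x * rnorm (g y - adj_star (u n) y) <= e / 2.
    apply: le_trans (ler_wpM2l (rnorm_ge0 x) b) _.
    have := rnorm_ge0 x => y0; rewrite mulrC mulrAC ler_pdivrMr; [nra|lra].
  lra.
have fin : f \in @adjointable R A.
  apply/asboolP; split; first by exists g.
  have [_ [M [M0 b]]] := adjop_exP (u 0%N).
  exists (M + (l - r 0%N)); split; first by rewrite addr_ge0 ?subr_ge0.
  move=> x; rewrite -[f x](subrK (u 0%N x)).
  apply: le_trans (rnormD _ _) _.
  by rewrite mulrDl addrC lerD.
exists (AdjOp fin) => n; split; first by rewrite subr_ge0.
by move=> x; rewrite adjopBE; apply: fb.
Qed.

Lemma adjop_cstar_bound :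
  cstar_bound adj_star adjop_real (adjop_scale 'i%C) adj_bd.
Proof.
split.
- move=> S T; apply: adj_star_eq => x y.
  by rewrite !adjopDE cstarD cmulDl cmulDr !adj_starP.
- by move=> S T; apply: adj_star_eq => x y; rewrite !adjopME !adj_starP.
- by move=> T; apply: adj_star_eq; apply/adjoint_sym/adj_starP.
- move=> t; apply: adj_star_eq => x y.
  by rewrite !adjop_realE cstarZ cmulZl cmulZr conjc_real.
- apply: adj_star_eq => x y; rewrite adjopNE /= cstarZ cmulZl cmulNr cmulZr -scaleNr.
  by congr (_ *: _); apply/eqP; rewrite eq_complex /= oppr0 !eqxx.
- apply: adjop_ext => x; rewrite adjopME adjopNE /= !scalerA -scaleNr.
  by congr (_ *: _); rewrite -expr2 sqr_i.
- by move=> t T; apply: adjop_ext => x; rewrite !adjopME !adjop_realE adjop_Z.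
- by move=> T; apply: adjop_ext => x; rewrite !adjopME /= adjop_Z.
- by move=> T M [].
- move=> T M N [M0 b] MN; split; first exact: le_trans MN.
  by move=> x; apply: le_trans (b x) _; apply: ler_wpM2r => //; exact: rnorm_ge0.
- by move=> T; have [_] := adjop_exP T.
- move=> T h; apply: adjop_ext => x; rewrite adjop0E; apply/rnorm_le0/ler_addgt0Pr => e e0.
  have xp : 0 < rnorm x + 1 by have := rnorm_ge0 x; lra.
  have [_ b] := h (e / (rnorm x + 1)) (divr_gt0 e0 xp).
  apply: le_trans (b x) _; rewrite add0r mulrAC ler_pdivrMr //.
  by have := rnorm_ge0 x; nra.
- by move=> t; have := scale_bound (real_complex R t); rewrite norm_real.
- have := scale_bound 'i%C; congr op_bound.
  by rewrite normc_def /= expr0n add0r expr1n sqrtr1.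
- move=> S T M N [M0 b] [N0 c]; split; first exact: addr_ge0.
  move=> x; rewrite adjopDE mulrDl; apply: le_trans (rnormD _ _) _; exact: lerD.
- by move=> S T M N; exact: op_boundM.
- by move=> T M b; apply: op_bound_adjoint (adj_starP T) b.
(* |T x|^2 = |x^* (T^* T x)| <= |x| |T^* T x|. *)
- move=> T M M0 [_ b]; split=> // x.
  rewrite -ler_sqr ?nnegrE ?mulr_ge0 ?rnorm_ge0 //.
  rewrite -rnorm_cstar_mul adj_starP exprMn.
  apply: le_trans (rnorm_cmul _ _) _; rewrite rnorm_cstar.
  have := b x; rewrite adjopME => h.
  by rewrite expr2 mulrCA; apply: ler_wpM2l => //; exact: rnorm_ge0.
- exact: op_bound_lim.
Qed.

End AdjointableAlgebra.

(** * Positive elements of a C*-algebra, possibly without identity *)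

Section Positivity.
Variables (R : realType) (A : cstarAlgType R).
Implicit Types (a c h k x y : A) (t : R).

Lemma lmul_adjoint a : adjoint_pair (cmul a) (cmul (cstar a)).
Proof. by move=> x y; rewrite cstarM cmulA. Qed.

Lemma lmul_bound a : op_bound (cmul a) (rnorm a).
Proof. by split=> [|x]; [exact: rnorm_ge0 | exact: rnorm_cmul]. Qed.

Lemma lmul_in a : cmul a \in @adjointable R A.
Proof.
apply/asboolP; split; first by eexists; exact: lmul_adjoint.
by eexists; exact: lmul_bound.
Qed.

Definition lmul a := AdjOp (lmul_in a).

Lemma lmul_bd a : adj_bd (lmul a) (rnorm a).
Proof. exact: lmul_bound. Qed.

Lemma lmulE a x : lmul a x = cmul a x. Proof. by []. Qed.

Lemma lmulD a c : lmul (a + c) = lmul a + lmul c.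
Proof. by apply: adjop_ext => x; rewrite adjopDE !lmulE cmulDl. Qed.

Lemma lmulZ t a : lmul (real_complex R t *: a) = adjop_real A t * lmul a.
Proof. by apply: adjop_ext => x; rewrite adjopME adjop_realE !lmulE cmulZl. Qed.

(** Testing on a^* gives |a a^*| = |a|^2, so bounds proved for operators descend to A. *)
Lemma rnorm_lmul a M : adj_bd (lmul a) M -> rnorm a <= M.
Proof.
move=> [M0 b]; have [->//|p] := eqVneq (rnorm a) 0.
have {}p : 0 < rnorm a by rewrite lt_neqAle eq_sym p rnorm_ge0.
by have := b (cstar a); rewrite lmulE -{1}[a]cstarK rnorm_cstar_mul rnorm_cstar expr2 ler_pM2r.
Qed.

Definition cpos h := pos (@adj_star R A) (@adjop_real R A) (@adj_bd R A) (lmul h).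

Let ax := adjop_cstar_bound A.

Lemma cposD h k : cpos h -> cpos k -> cpos (h + k).
Proof. by rewrite /cpos lmulD; exact: (posD ax). Qed.

Lemma cposZ t h : 0 <= t -> cpos h -> cpos (real_complex R t *: h).
Proof. by rewrite /cpos lmulZ; exact: (pos_scM ax). Qed.

Lemma cpos0 : cpos 0.
Proof.
rewrite /cpos; have -> : lmul 0 = 0 by apply: adjop_ext => x; rewrite lmulE cmul0l.
exact: (pos0 ax).
Qed.

Lemma cpos_sum (I : Type) (s : seq I) (P : pred I) (f : I -> A) :
  (forall i, P i -> cpos (f i)) -> cpos (\sum_(i <- s | P i) f i).
Proof. by move=> h; apply: big_ind => //; [exact: cpos0 | exact: cposD]. Qed.

Lemma cpos_cstar_mul a : cpos (cmul (cstar a) a).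
Proof.
have -> : cpos (cmul (cstar a) a) = pos (@adj_star R A) (@adjop_real R A)
  (@adj_bd R A) (adj_star (lmul a) * lmul a).
  congr pos; apply: adjop_ext => x; rewrite adjopME.
  have ap : adjoint_pair (lmul a) (lmul (cstar a)) := lmul_adjoint a.
  by rewrite (adj_star_eq ap) !lmulE cmulA.
exact: (pos_starM ax).
Qed.

Lemma rnorm_cpos_le h k : cpos h -> cpos k -> rnorm h <= rnorm (h + k).
Proof.
move=> ph pk; apply/ler_addgt0Pr => e e0; apply: rnorm_lmul.
apply: (bd_monotone ax _ ph pk); first by have := rnorm_ge0 (h + k); lra.
rewrite -lmulD; apply: (bd_le ax (lmul_bd _)); lra.
Qed.

(** The square root z of t - c is an operator and need not be a left multiplication, but z a lies in
    A and (z a)^* (z a) = a^* (t - c) a. *)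
Lemma cpos_conj t a c : 0 < t -> rnorm c <= t -> cpos c ->
  cpos (real_complex R t *: cmul (cstar a) a - cmul (cstar a) (cmul c a)).
Proof.
move=> t0 ct pc.
have /(pos_sqrt ax)[z [sz zz _ _]] := pos_sub ax t0 pc (bd_le ax (lmul_bd c) ct).
have <- : cmul (cstar (z a)) (z a) =
    real_complex R t *: cmul (cstar a) a - cmul (cstar a) (cmul c a).
  rewrite adj_starP sz -adjopME zz adjopBE adjop_realE lmulE cmulDr cmulZr cmulNr //.
exact: cpos_cstar_mul.
Qed.

(** To be used with p = <u, u>, q = <v, v> and a = <u, v>. When |p| <= t, adding t a^* a - a^* p a
    >= 0 to the hypothesis leaves t^2 q >= t a^* a, so |a|^2 <= t |q|; then t decreases to |p|. *)
Lemma cpos_cauchy_schwarz (p q a : A) : cpos p ->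
  (forall t, 0 < t -> cpos (real_complex R (t ^+ 2) *: q
     - real_complex R (2 * t) *: cmul (cstar a) a + cmul (cstar a) (cmul p a))) ->
  rnorm a ^+ 2 <= rnorm p * rnorm q.
Proof.
move=> pp h.
have key t : 0 < t -> rnorm p <= t -> rnorm a ^+ 2 <= t * rnorm q.
  move=> t0 pt.
  have p1 := cposD (h t t0) (cpos_conj a t0 pt pp).
  have p2 : cpos (real_complex R t *: cmul (cstar a) a).
    by apply: cposZ; [exact: ltW | exact: cpos_cstar_mul].
  have := rnorm_cpos_le p2 p1.
  have -> : real_complex R t *: cmul (cstar a) a +
     (real_complex R (t ^+ 2) *: q - real_complex R (2 * t) *: cmul (cstar a) a +
      cmul (cstar a) (cmul p a) +
      (real_complex R t *: cmul (cstar a) a - cmul (cstar a) (cmul p a))) =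
    real_complex R (t ^+ 2) *: q.
    set X := cmul (cstar a) a; set Y := cmul _ (cmul p a).
    have -> : real_complex R (2 * t) *: X = real_complex R t *: X + real_complex R t *: X.
      by rewrite -scalerDl -rmorphD; congr (real_complex R _ *: _); lra.
    set Z := _ *: X; set W := _ *: q.
    rewrite [_ + Y]addrC [Z - Y]addrC addrACA addrN add0r -addrA.
    by rewrite opprD -[- Z - Z + Z]addrA addNr addr0 [LHS]addrC subrK.
  rewrite !rnormZr rnorm_cstar_mul (ger0_norm (sqr_ge0 t)) (ger0_norm (ltW t0)).
  by rewrite expr2 -mulrA ler_pM2l.
apply/ler_addgt0Pr => e e0.
have q0 := rnorm_ge0 q; have p0 := rnorm_ge0 p.
have d0 : 0 < e / (rnorm q + 1) by rewrite divr_gt0 //; lra.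
apply: (@le_trans _ _ ((rnorm p + e / (rnorm q + 1)) * rnorm q)).
  by apply: key; lra.
rewrite mulrDl lerD2l mulrAC ler_pdivrMr; [nra|lra].
Qed.

End Positivity.

(** * Fibres of a Fell bundle *)

Section GroupoidTheory.
Variable G : etaleGroupoid.
Implicit Types g h k x : G.

Let ga := gaxioms G.

Lemma ginvK g : ginv (ginv g) = g. Proof. exact: groupoid_invK ga g. Qed.

Lemma src_ginv g : src (ginv g) = rng g.
Proof. by rewrite /src /rng /src_of /rng_of ginvK. Qed.

Lemma rng_ginv g : rng (ginv g) = src g.
Proof. by rewrite /src /rng /src_of /rng_of ginvK. Qed.

Lemma composable_Vg g : composable (ginv g) g.
Proof. by rewrite /composable src_ginv. Qed.

Lemma composable_gV g : composable g (ginv g).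
Proof. by rewrite /composable rng_ginv. Qed.

Lemma src_gmul g h : composable g h -> src (gmul g h) = src h.
Proof. exact: (groupoid_srcM ga). Qed.

Lemma rng_gmul g h : composable g h -> rng (gmul g h) = rng g.
Proof. exact: (groupoid_rngM ga). Qed.

Lemma gmulA g h k : composable g h -> composable h k ->
  gmul (gmul g h) k = gmul g (gmul h k).
Proof. exact: (groupoid_mulA ga). Qed.

Lemma gmulKV g h : composable g h -> gmul (ginv g) (gmul g h) = h.
Proof. exact: (groupoid_mulKV ga). Qed.

Lemma gmulVK g h : composable g h -> gmul (gmul g h) (ginv h) = g.
Proof. exact: (groupoid_mulVK ga). Qed.

Lemma src_src g : src (src g) = src g.
Proof. exact: (src_gmul (composable_Vg g)). Qed.

Lemma rng_src g : rng (src g) = src g.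
Proof. by rewrite {1}/src rng_gmul ?rng_ginv //; exact: composable_Vg. Qed.

Lemma src_rng g : src (rng g) = rng g.
Proof. by rewrite -(src_ginv g) src_src. Qed.

Lemma rng_rng g : rng (rng g) = rng g.
Proof. by rewrite -(src_ginv g) rng_src. Qed.

Lemma gmul_src g : gmul g (src g) = g.
Proof.
have := gmulKV (composable_Vg (ginv g)); rewrite ginvK.
have := gmulKV (composable_gV (ginv g)).
by rewrite !ginvK.
Qed.

Lemma gmul_rng g : gmul (rng g) g = g.
Proof. by have := gmulVK (composable_gV g); rewrite ginvK. Qed.

Lemma gmulK g h k : composable g h -> composable g k -> gmul g h = gmul g k -> h = k.
Proof. by move=> gh gk e; rewrite -(gmulKV gh) e gmulKV. Qed.

Lemma ginv_gmul g h : composable g h -> ginv (gmul g h) = gmul (ginv h) (ginv g).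
Proof.
move=> gh; set x := gmul g h.
have c1 : composable (ginv h) (ginv g).
  by rewrite /composable src_ginv rng_ginv gh.
have xh : composable x (ginv h) by rewrite /composable rng_ginv src_gmul.
have xhg : composable x (gmul (ginv h) (ginv g)).
  by rewrite /composable rng_gmul.
apply: (@gmulK x) => //; first exact: composable_gV.
by rewrite -gmulA // /x gmulVK // -[LHS]/(rng x) rng_gmul.
Qed.

Lemma rng_unit x : src x = x -> rng x = x.
Proof. by move=> <-; rewrite rng_src. Qed.

Lemma ginv_unit x : src x = x -> ginv x = x.
Proof.
move=> e; rewrite -{1}e /src /src_of ginv_gmul ?ginvK //; exact: composable_Vg.
Qed.

Lemma gmul_unit x : src x = x -> gmul x x = x.
Proof. by move=> e; rewrite -{2}e gmul_src. Qed.

Lemma composable_unit x : src x = x -> composable x x.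
Proof. by move=> e; rewrite /composable e rng_unit. Qed.

End GroupoidTheory.

Section FibreOperations.
Variables (R : realType) (G : etaleGroupoid) (B : fellBundle R G).
Implicit Types (g h k x z w : G) (b : B).

Lemma proj_inc x (v : fib B x) : Defs.proj (inc B v) = x.
Proof. by have : range (@inc _ _ B x) (inc B v) by []; rewrite inc_range. Qed.

Lemma inc_fib_at x b : Defs.proj b = x -> inc B (fib_at x b) = b.
Proof.
move=> e; have : (@Defs.proj _ _ B @^-1` [set x]) b by [].
by rewrite -inc_range => -[v _ vb]; apply: (@xgetPex _ 0 [set v | inc B v = b]); exists v.
Qed.

Lemma fib_atK x (v : fib B x) : fib_at x (inc B v) = v.
Proof. by apply: (@Defs.inc_inj _ _ B x); rewrite inc_fib_at // proj_inc. Qed.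

(** [bval (inc B v)] lies over [proj (inc B v)], which equals [x] only by a proof. Quantifying [P]
    over all fibres allows that equality to be eliminated. *)
Lemma bval_inc x (v : fib B x) (P : forall y, fib B y -> B -> Prop) :
  P x v (inc B v) -> P (Defs.proj (inc B v)) (bval (inc B v)) (inc B v).
Proof.
have : inc B v = inc B v by [].
move: {2}(inc B v) => b e.
have pb : Defs.proj b = x by rewrite -e proj_inc.
have -> : inc B v = b by [].
move: v e; case: x / pb => v e p.
by have -> : bval b = v by rewrite -(fib_atK v) e.
Qed.

Lemma badd_inc x (v w : fib B x) : badd (inc B v) (inc B w) = inc B (v + w).
Proof.
rewrite /badd.
apply: (@bval_inc x v (fun y v' b =>
  Defs.proj b = y -> inc B (v' + fib_at y (inc B w)) = inc B (v + w))) => //.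
by rewrite fib_atK.
Qed.

Lemma bscale_inc x (k : R[i]) (v : fib B x) : bscale k (inc B v) = inc B (k *: v).
Proof.
by rewrite /bscale; apply: (@bval_inc x v (fun y v' b => inc B (k *: v') = inc B (k *: v))).
Qed.

Lemma bnorm_inc x (v : fib B x) : bnorm (inc B v) = rnorm v.
Proof.
by rewrite /bnorm; apply: (@bval_inc x v (fun y v' b => complex.Re `|v'| = rnorm v)).
Qed.

(* [fm z a b] and [fs z a] are the product and the adjoint viewed in the fibre
   over [z]; they are meaningful when [gmul g h = z], resp. [ginv g = z].
   Carrying [z] along avoids transports between equal fibres. *)
Definition fm z g h (a : fib B g) (b : fib B h) : fib B z :=
  fib_at z (fmul (inc B a) (inc B b)).

Definition fs z g (a : fib B g) : fib B z := fib_at z (fstar (inc B a)).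

Lemma composable_inc g h (a : fib B g) (b : fib B h) :
  composable g h -> composable (Defs.proj (inc B a)) (Defs.proj (inc B b)).
Proof. by rewrite !proj_inc. Qed.

Lemma inc_fm z g h (a : fib B g) (b : fib B h) :
  composable g h -> gmul g h = z -> inc B (fm z a b) = fmul (inc B a) (inc B b).
Proof.
by move=> c e; rewrite inc_fib_at // proj_mul ?proj_inc.
Qed.

Lemma inc_fs z g (a : fib B g) : ginv g = z -> inc B (fs z a) = fstar (inc B a).
Proof. by move=> e; rewrite inc_fib_at // proj_star proj_inc. Qed.

Section Bilinear.
Variables (z g h : G).
Hypotheses (c : composable g h) (e : gmul g h = z).

Lemma fmDl (a a' : fib B g) (b : fib B h) : fm z (a + a') b = fm z a b + fm z a' b.
Proof.
apply: (@Defs.inc_inj _ _ B); rewrite -badd_inc !inc_fm // -badd_inc.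
by apply: fmulDl; rewrite !proj_inc.
Qed.

Lemma fmDr (a : fib B g) (b b' : fib B h) : fm z a (b + b') = fm z a b + fm z a b'.
Proof.
apply: (@Defs.inc_inj _ _ B); rewrite -badd_inc !inc_fm // -badd_inc.
by apply: fmulDr; rewrite !proj_inc.
Qed.

Lemma fmZl (k : R[i]) (a : fib B g) (b : fib B h) : fm z (k *: a) b = k *: fm z a b.
Proof.
apply: (@Defs.inc_inj _ _ B); rewrite -bscale_inc !inc_fm // -bscale_inc.
by apply: fmulZl; rewrite !proj_inc.
Qed.

Lemma fmZr (k : R[i]) (a : fib B g) (b : fib B h) : fm z a (k *: b) = k *: fm z a b.
Proof.
apply: (@Defs.inc_inj _ _ B); rewrite -bscale_inc !inc_fm // -bscale_inc.
by apply: fmulZr; rewrite !proj_inc.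
Qed.

Lemma fm0l (b : fib B h) : fm z (0 : fib B g) b = 0.
Proof. by rewrite -(scale0r 0) fmZl scale0r. Qed.

Lemma fm0r (a : fib B g) : fm z a (0 : fib B h) = 0.
Proof. by rewrite -(scale0r 0) fmZr scale0r. Qed.

Lemma fmNl (a : fib B g) (b : fib B h) : fm z (- a) b = - fm z a b.
Proof. by rewrite -scaleN1r fmZl scaleN1r. Qed.

Lemma fmNr (a : fib B g) (b : fib B h) : fm z a (- b) = - fm z a b.
Proof. by rewrite -scaleN1r fmZr scaleN1r. Qed.

Lemma fm_suml (I : Type) (s : seq I) (P : pred I) (f : I -> fib B g) (b : fib B h) :
  fm z (\sum_(i <- s | P i) f i) b = \sum_(i <- s | P i) fm z (f i) b.
Proof.
by apply: (big_morph (fun v : fib B g => fm z v b)); [move=> ? ?; exact: fmDl | exact: fm0l].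
Qed.

Lemma fm_sumr (I : Type) (s : seq I) (P : pred I) (f : I -> fib B h) (a : fib B g) :
  fm z a (\sum_(i <- s | P i) f i) = \sum_(i <- s | P i) fm z a (f i).
Proof.
by apply: (big_morph (fun v : fib B h => fm z a v)); [move=> ? ?; exact: fmDr | exact: fm0r].
Qed.

Lemma rnorm_fm (a : fib B g) (b : fib B h) : rnorm (fm z a b) <= rnorm a * rnorm b.
Proof.
by rewrite -!bnorm_inc inc_fm //; apply: fmul_norm; exact: composable_inc.
Qed.

Lemma fs_fm z' g' h' (a : fib B g) (b : fib B h) :
  ginv z = z' -> ginv g = g' -> ginv h = h' ->
  fs z' (fm z a b) = fm z' (fs h' b) (fs g' a).
Proof.
move=> ez eg eh; apply: (@Defs.inc_inj _ _ B).
have c' : composable h' g' by rewrite -eg -eh /composable src_ginv rng_ginv c.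
rewrite inc_fs // inc_fm // inc_fm //; last by rewrite -eg -eh -ginv_gmul // e.
rewrite !inc_fs //; have [_ _ sM] := fell_semigroupoid B.
by have [_ ->] := sM _ _ (composable_inc a b c).
Qed.

End Bilinear.

Lemma fmA g h k z z' w (a : fib B g) (b : fib B h) (d : fib B k) :
  composable g h -> composable h k -> gmul g h = z -> gmul h k = z' -> gmul z k = w ->
  fm w (fm z a b) d = fm w a (fm z' b d).
Proof.
move=> gh hk ez ez' ew; apply: (@Defs.inc_inj _ _ B).
have zk : composable z k by rewrite -ez /composable src_gmul.
have gz' : composable g z' by rewrite -ez' /composable rng_gmul.
have ew' : gmul g z' = w by rewrite -ew -ez -ez' gmulA.
rewrite !inc_fm //; have [sA _ _] := fell_semigroupoid B.
have [_ h2] := sA (inc B a) (inc B b) (inc B d).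
apply: h2; first exact: composable_inc.
by rewrite -(inc_fm a b gh ez); exact: composable_inc.
Qed.

Section Star.
Variables (z g : G).
Hypothesis e : ginv g = z.

Lemma fsD (a a' : fib B g) : fs z (a + a') = fs z a + fs z a'.
Proof.
apply: (@Defs.inc_inj _ _ B); rewrite -badd_inc !inc_fs // -badd_inc.
by apply: fstarD; rewrite !proj_inc.
Qed.

Lemma fsZ (k : R[i]) (a : fib B g) : fs z (k *: a) = conjc k *: fs z a.
Proof.
by apply: (@Defs.inc_inj _ _ B); rewrite -bscale_inc !inc_fs // -bscale_inc fstarZ.
Qed.

Lemma fs0 : fs z (0 : fib B g) = 0.
Proof. by rewrite -(scale0r 0) fsZ conjc0 scale0r. Qed.

Lemma fsN (a : fib B g) : fs z (- a) = - fs z a.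
Proof. by rewrite -scaleN1r fsZ rmorphN1 scaleN1r. Qed.

Lemma fs_sum (I : Type) (s : seq I) (P : pred I) (f : I -> fib B g) :
  fs z (\sum_(i <- s | P i) f i) = \sum_(i <- s | P i) fs z (f i).
Proof. by apply: big_morph; [exact: fsD | exact: fs0]. Qed.

Lemma fsK (a : fib B g) : fs g (fs z a) = a.
Proof.
apply: (@Defs.inc_inj _ _ B); rewrite !inc_fs //; last by rewrite -e ginvK.
by have [_ -> _] := fell_semigroupoid B.
Qed.

Lemma rnorm_fs_mul x (a : fib B g) : src g = x -> rnorm (fm x (fs z a) a) = rnorm a ^+ 2.
Proof.
move=> ex; rewrite -!bnorm_inc inc_fm // ?inc_fs ?fstar_norm //.
  by rewrite -e; exact: composable_Vg.
by rewrite -e -ex.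
Qed.

End Star.

Lemma rnorm_fs z g (a : fib B g) : ginv g = z -> rnorm (fs z a) = rnorm a.
Proof.
have h g' z' (b : fib B g') : ginv g' = z' -> rnorm b <= rnorm (fs z' b).
  move=> e; have [->|b0] := eqVneq (rnorm b) 0; first exact: rnorm_ge0.
  have p : 0 < rnorm b by rewrite lt_neqAle eq_sym b0 rnorm_ge0.
  rewrite -(ler_pM2r p) -expr2 -(rnorm_fs_mul e b (erefl (src g'))).
  by apply: rnorm_fm; rewrite -?e //; exact: composable_Vg.
move=> e; apply/eqP; rewrite eq_le h // andbT -{2}(fsK e a); apply: h.
by rewrite -e ginvK.
Qed.

(** The positivity axiom of Fell bundles, moved to the fibre over the source: it makes b^* b
    positive in the C*-algebra over [x] even when b lies over an arrow that is not a unit. *)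
Lemma fs_mul_src z g x (b : fib B g) : ginv g = z -> src g = x ->
  exists a : fib B x, fm x (fs x a) a = fm x (fs z b) b.
Proof.
move=> e ex; have ux : src x = x by rewrite -ex src_src.
have [a [pa ha]] := fstar_pos (inc B b).
have cz : composable z g by rewrite -e; exact: composable_Vg.
have ez : gmul z g = x by rewrite -e.
have pax : Defs.proj a = x by rewrite pa proj_mul ?proj_star !proj_inc //; exact: composable_Vg.
exists (fib_at x a); apply: (@Defs.inc_inj _ _ B).
rewrite (inc_fm _ _ (composable_unit ux) (gmul_unit ux)) (inc_fm _ _ cz ez).
by rewrite (inc_fs _ (ginv_unit ux)) (inc_fs _ e) inc_fib_at.
Qed.

End FibreOperations.

Section FibreAlgebra.
Variables (R : realType) (G : etaleGroupoid) (B : fellBundle R G).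
Variables (x : G) (ux : src x = x).

Let cx : composable x x := composable_unit ux.
Let mx : gmul x x = x := gmul_unit ux.
Let ix : ginv x = x := ginv_unit ux.

Fact fib_cmulA (a b c : fib B x) : fm x a (fm x b c) = fm x (fm x a b) c.
Proof. by rewrite (fmA _ _ _ cx cx mx mx mx). Qed.

Fact fib_cmulPl (k : R[i]) (a b c : fib B x) :
  fm x (k *: a + b) c = k *: fm x a c + fm x b c.
Proof. by rewrite (fmDl cx mx) (fmZl cx mx). Qed.

Fact fib_cmulPr (k : R[i]) (a b c : fib B x) :
  fm x a (k *: b + c) = k *: fm x a b + fm x a c.
Proof. by rewrite (fmDr cx mx) (fmZr cx mx). Qed.

Fact fib_cstarP (k : R[i]) (a b : fib B x) :
  fs x (k *: a + b) = conjc k *: fs x a + fs x b.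
Proof. by rewrite (fsD ix) (fsZ ix). Qed.

Fact fib_cmul_norm (a b : fib B x) : `|fm x a b| <= `|a| * `|b|.
Proof. by rewrite !rnormE -rmorphM lecR (rnorm_fm cx mx). Qed.

Fact fib_cstar_norm (a : fib B x) : `|fm x (fs x a) a| = `|a| ^+ 2.
Proof. by rewrite !rnormE -rmorphXn (rnorm_fs_mul ix _ ux). Qed.

(** The carrier, vector space and norm remain those of [fib B x] up to conversion, so that results
    on C*-algebras apply to the fibre by mere restatement. *)
Definition fibre_cstar : cstarAlgType R := HB.pack (fib B x : Type) (fib B x)
  (isCStarAlgebra.Build R (fib B x) fib_cmulA fib_cmulPl fib_cmulPr
    (fsK ix) fib_cstarP (fun a b => fs_fm cx mx a b ix ix ix)
    fib_cmul_norm fib_cstar_norm).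

Definition fpos (h : fib B x) := @cpos R fibre_cstar h.

Lemma fpos_sum (I : Type) (s : seq I) (P : pred I) (f : I -> fib B x) :
  (forall i, P i -> fpos (f i)) -> fpos (\sum_(i <- s | P i) f i).
Proof. exact: (@cpos_sum R fibre_cstar). Qed.

Lemma fpos_fs_mul z g (a : fib B g) : ginv g = z -> src g = x -> fpos (fm x (fs z a) a).
Proof.
move=> e ex; have [b <-] := fs_mul_src a e ex.
exact: (@cpos_cstar_mul R fibre_cstar b).
Qed.

Lemma rnorm_fpos_le (h k : fib B x) : fpos h -> fpos k -> rnorm h <= rnorm (h + k).
Proof. exact: (@rnorm_cpos_le R fibre_cstar). Qed.

Lemma fpos_cauchy_schwarz (p q a : fib B x) : fpos p ->
  (forall t : R, 0 < t -> fpos (real_complex R (t ^+ 2) *: q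
     - real_complex R (2 * t) *: fm x (fs x a) a + fm x (fs x a) (fm x p a))) ->
  rnorm a ^+ 2 <= rnorm p * rnorm q.
Proof. exact: (@cpos_cauchy_schwarz R fibre_cstar). Qed.

End FibreAlgebra.

(** * The Cauchy-Schwarz inequality for finite columns *)

Section FellCauchySchwarz.
Variables (R : realType) (G : etaleGroupoid) (B : fellBundle R G).
Variable I : eqType.
Implicit Types (s : seq I) (p q : I -> G).

(** The inner product of two finite columns. The arrows [p] and [q] may differ, because partial sums
    of a convolution pair columns over two possibly distinct units. *)
Definition fip z p q (u : forall i, fib B (p i)) (v : forall i, fib B (q i)) s : fib B z :=
  \sum_(i <- s) fm z (fs (ginv (p i)) (u i)) (v i).

Lemma fip_pos x p (u : forall i, fib B (p i)) s (ux : src x = x) :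
  {in s, forall i, src (p i) = x} -> fpos ux (fip x u u s).
Proof.
by move=> h; rewrite /fip big_seq; apply: fpos_sum => i /h; apply: fpos_fs_mul.
Qed.

Lemma fip_cat_le x p (u : forall i, fib B (p i)) s s' :
  src x = x -> {in s ++ s', forall i, src (p i) = x} ->
  rnorm (fip x u u s) <= rnorm (fip x u u (s ++ s')).
Proof.
move=> ux h; rewrite /fip big_cat /=; apply: (rnorm_fpos_le (ux := ux)); apply: fip_pos.
  by move=> i si; apply: h; rewrite mem_cat si.
by move=> i si; apply: h; rewrite mem_cat si orbT.
Qed.

(* With [P = <u, u>] and [a = <u, v>], the expansion of [<w, w> >= 0] for
   [w = t v - u a]. *)
Lemma fip_cauchy_schwarz1 x p (u v : forall i, fib B (p i)) s :
  src x = x -> {in s, forall i, src (p i) = x} ->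
  rnorm (fip x u v s) ^+ 2 <= rnorm (fip x u u s) * rnorm (fip x v v s).
Proof.
move=> ux h; set P := fip x u u s; set Q := fip x v v s; set a := fip x u v s.
apply: (fpos_cauchy_schwarz (ux := ux)); first exact: fip_pos.
move=> t t0.
pose w i := real_complex R t *: v i - fm (p i) (u i) a.
suff -> : real_complex R (t ^+ 2) *: Q - real_complex R (2 * t) *: fm x (fs x a) a +
   fm x (fs x a) (fm x P a) = fip x w w s by exact: fip_pos.
have ix := ginv_unit ux; have cx := composable_unit ux; have mx := gmul_unit ux.
have -> : real_complex R (2 * t) = real_complex R t + real_complex R t.
  by rewrite -rmorphD mulrDl mul1r.
have rx : rng x = x by exact: rng_unit.
have sa : fs x a = \sum_(i <- s) fm x (fs (ginv (p i)) (v i)) (u i).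
  rewrite /a /fip (fs_sum ix) !big_seq; apply: eq_bigr => i si.
  rewrite (fs_fm (composable_Vg _) (h _ si) _ _ ix (ginvK _) (erefl _)).
  by rewrite fsK.
(* Of the two copies of t a^* a, one is expanded in its right factor and the other in its left
   factor, to match the two cross terms of <w, w>. *)
have e1 : fm x (fs x a) a = \sum_(i <- s) fm x (fs x a) (fm x (fs (ginv (p i)) (u i)) (v i)).
  by rewrite {2}/a /fip (fm_sumr cx mx).
have e2 : fm x (fs x a) a = \sum_(i <- s) fm x (fm x (fs (ginv (p i)) (v i)) (u i)) a.
  by rewrite {1}sa (fm_suml cx mx).
have e3 : fm x (fs x a) (fm x P a) =
   \sum_(i <- s) fm x (fs x a) (fm x (fm x (fs (ginv (p i)) (u i)) (u i)) a).
  by rewrite /P /fip (fm_suml cx mx) (fm_sumr cx mx).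
rewrite scalerDl {1}e1 e2 e3 /Q /fip opprD !scaler_sumr addrA -!sumrN -!big_split /=.
rewrite !big_seq; apply: eq_bigr => i si; have sp := h _ si.
have cpx : composable (p i) x by rewrite /composable sp rx.
have mpx : gmul (p i) x = p i by rewrite -sp gmul_src.
have cVp : composable (ginv (p i)) (p i) := composable_Vg _.
have mVp : gmul (ginv (p i)) (p i) = x by rewrite -sp.
have cxV : composable x (ginv (p i)) by rewrite /composable rng_ginv sp.
have mxV : gmul x (ginv (p i)) = ginv (p i) by rewrite -sp -rng_ginv gmul_rng.
rewrite /w (fsD (erefl _)) (fsN (erefl _)) (fsZ (erefl _)) conjc_real.
rewrite (fs_fm cpx mpx _ _ (erefl _) (erefl _) ix).
rewrite (fmDl cVp mVp) !(fmDr cVp mVp) !(fmNl cVp mVp) !(fmNr cVp mVp).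
rewrite !(fmZl cVp mVp) !(fmZr cVp mVp).
rewrite scalerA -rmorphM -expr2.
rewrite [fm x (fm _ (fs x a) _) (v i)](fmA _ _ _ cxV cVp mxV mVp mVp).
rewrite (fmA _ _ _ cVp cpx mVp mpx mx).
have -> : fm x (fm (ginv (p i)) (fs x a) (fs (ginv (p i)) (u i))) (fm (p i) (u i) a) =
  fm x (fs x a) (fm x (fm x (fs (ginv (p i)) (u i)) (u i)) a).
  rewrite (fmA _ _ _ cxV cVp mxV mVp mVp); congr (fm _ _ _).
  by rewrite (fmA _ _ _ cVp cpx mVp mpx mx).
by rewrite opprK addrA; congr (_ + _); rewrite addrAC.
Qed.

(* Reduced to the case of a single fibre by multiplying each [v i] by [a^*]
   on the right, where [a] is the left-hand side. *)
Lemma fip_cauchy_schwarz x y z p q (u : forall i, fib B (p i)) (v : forall i, fib B (q i)) s :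
  rng z = x -> src z = y ->
  {in s, forall i, composable (ginv (p i)) (q i) /\ gmul (ginv (p i)) (q i) = z} ->
  rnorm (fip z u v s) ^+ 2 <= rnorm (fip x u u s) * rnorm (fip y v v s).
Proof.
move=> rz sz h; set a := fip z u v s.
have ux : src x = x by rewrite -rz src_rng.
have uy : src y = y by rewrite -sz src_src.
pose a' := fs (ginv z) a.
have hp i : i \in s -> src (p i) = x.
  by move=> /h[c e]; rewrite -rz -e rng_gmul // rng_ginv.
have hq i : i \in s -> src (q i) = y.
  by move=> /h[c e]; rewrite -sz -e src_gmul.
have hqz i : i \in s -> composable (q i) (ginv z) /\ gmul (q i) (ginv z) = p i.
  move=> si; have [c e] := h _ si.
  have c' : composable (ginv (q i)) (p i).
    by move: c; rewrite /composable !src_ginv.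
  split; first by rewrite /composable rng_ginv sz hq.
  rewrite -e (ginv_gmul c) ginvK.
  by have := gmulKV c'; rewrite ginvK.
pose v' i := fm (p i) (v i) a'.
have cz : composable z (ginv z) := composable_gV _.
have mz : gmul z (ginv z) = x by rewrite -rz.
(* <u, v'> = a a^* has norm |a|^2, and <v', v'> = a <v, v> a^* has norm at most |a|^2 |<v, v>|; a
   factor |a|^2 cancels in the end. *)
have E1 : fip x u v' s = fm x a a'.
  rewrite /a /fip (fm_suml cz mz) !big_seq; apply: eq_bigr => i si.
  have [c e] := h _ si; have [c' e'] := hqz _ si.
  by rewrite /v' -(fmA _ _ _ c c' e e' mz).
have E2 : fip x v' v' s = fm x (fm z a (fip y v v s)) a'.
  have cy : composable z y by rewrite /composable sz rng_unit.
  have my : gmul z y = z by rewrite -sz gmul_src.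
  rewrite /fip (fm_sumr cy my) (fm_suml cz mz) !big_seq; apply: eq_bigr => i si.
  have [c e] := h _ si; have [c' e'] := hqz _ si.
  have czq : composable z (ginv (q i)) by rewrite /composable rng_ginv sz hq.
  have mzq : gmul z (ginv (q i)) = ginv (p i).
    by rewrite -e; apply: gmulVK.
  rewrite {1}/v' (fs_fm c' e' _ _ (erefl _) (erefl _) (ginvK _)).
  rewrite /a' fsK //.
  have cVq := composable_Vg (q i).
  have mVq : gmul (ginv (q i)) (q i) = y by rewrite -(hq _ si).
  rewrite -(fmA _ _ _ czq cVq mzq mVq e).
  by rewrite /v' (fmA _ _ _ c c' e e' mz).
have := fip_cauchy_schwarz1 u v' ux hp.
rewrite E1 E2.
have na' : rnorm a' = rnorm a by rewrite /a' rnorm_fs.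
have -> : rnorm (fm x a a') = rnorm a ^+ 2.
  rewrite -na' -[a](fsK (erefl (ginv z))) -/a'.
  by apply: rnorm_fs_mul; rewrite ?ginvK // src_ginv.
move=> le1; have [->|a0] := eqVneq (rnorm a) 0.
  by rewrite expr0n mulr_ge0 ?rnorm_ge0.
have p0 : 0 < rnorm a ^+ 2 by rewrite exprn_gt0 // lt_neqAle eq_sym a0 rnorm_ge0.
rewrite -(ler_pM2r p0) -expr2; apply: le_trans le1 _.
rewrite -mulrA; apply: ler_wpM2l; first exact: rnorm_ge0.
apply: le_trans (rnorm_fm cz mz _ _) _; rewrite na' expr2 mulrA.
apply: ler_wpM2r; first exact: rnorm_ge0.
rewrite mulrC; apply: rnorm_fm; first by rewrite /composable sz rng_unit.
by rewrite -sz gmul_src.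
Qed.

End FellCauchySchwarz.

(** * Convolution of sections *)

Section FiniteSubsetNets.
Variables (I : choiceType) (D : set I).

Global Instance finite_subsets_proper : ProperFilter (finite_subsets_filter D).
Proof.
apply: filter_from_proper; last by move=> F DF; exists F; split.
apply: filter_from_filter; first by exists set0; exact: fsets_set0.
move=> F F' [fF FD] [fF' FD']; exists (F `|` F').
  by split; [rewrite finite_setU | move=> i [/FD|/FD']].
by move=> K [DK sK]; split; split=> // i ?; apply: sK; [left|right].
Qed.

Lemma fsetsU (F F' : set I) : fsets D F -> fsets D F' -> fsets D (F `|` F').
Proof. by move=> [a b] [c d]; split; [rewrite finite_setU | move=> i [/b|/d]]. Qed.

Lemma fsetsD (F F' : set I) : fsets D F -> fsets D (F `\` F').
Proof. by move=> [a b]; split; [exact: finite_setD | move=> i [/b]]. Qed.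

Lemma fsetsI (F F' : set I) : fsets D F -> fsets D (F `&` F').
Proof. by move=> [a b]; split; [exact: finite_setIl | move=> i [/b]]. Qed.

Lemma fsum_split (V : zmodType) (u : I -> V) (F F0 : set I) : finite_set F -> F0 `<=` F ->
  \sum_(i \in F) u i = \sum_(i \in F0) u i + \sum_(i \in F `\` F0) u i.
Proof.
move=> fF s; rewrite (fsbigID F0) //=; congr (_ + _).
by apply: eq_fsbigl; apply/seteqP; split=> i; [case | move=> h; split=> //; exact: s].
Qed.

End FiniteSubsetNets.

(** A finite set controlling the tail for [D'] is pulled back to one for [D] by the inverse
    bijection [h]. All changes of index in convolutions go through this lemma. *)
Lemma rlim_net_reindex (R : realType) (V : normedModType R[i]) (I J : choiceType)
    (D : set I) (D' : set J) (f : I -> J) (h : J -> I) (u : J -> V) (l : V) :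
  (forall i, D i -> D' (f i) /\ h (f i) = i) ->
  (forall j, D' j -> D (h j) /\ f (h j) = j) ->
  rlim (finite_subsets_filter D') (fun F => \sum_(j \in F) u j) l ->
  rlim (finite_subsets_filter D) (fun F => \sum_(i \in F) u (f i)) l.
Proof.
move=> hf hh lim e e0; have [F0 [fF0 F0D] hF0] := lim _ e0.
exists (h @` F0).
  by split; [exact: finite_image | move=> _ [j /F0D/hh[? _] <-]].
move=> F [[fF FD] sF] /=.
have injf : set_inj F f.
  move=> i i'; rewrite !inE => /FD/hf[_ e1] /FD/hf[_ e2] e3.
  by rewrite -e1 -e2 e3.
rewrite -fsbig_image //; apply: hF0; split.
  by split; [exact: finite_image | move=> _ [i /FD/hf[? _] <-]].
move=> j F0j; exists (h j); first by apply: sF; exists j.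
by have [_] := hh _ (F0D _ F0j).
Qed.

Section SectionModule.
Variables (R : realType) (G : etaleGroupoid) (B : fellBundle R G).

HB.instance Definition _ := gen_eqMixin (bsection B).
HB.instance Definition _ := gen_choiceMixin (bsection B).

Lemma bsection_ext (u v : bsection B) : (forall g, u g = v g) -> u = v.
Proof. by move=> h; apply: functional_extensionality_dep. Qed.

Let add (u v : bsection B) : bsection B := fun g => u g + v g.
Let opp (u : bsection B) : bsection B := fun g => - u g.
Let zero : bsection B := fun g => 0.

Fact bsection_addA : associative add.
Proof. by move=> u v w; apply: bsection_ext => g; rewrite /add addrA. Qed.
Fact bsection_addC : commutative add.
Proof. by move=> u v; apply: bsection_ext => g; rewrite /add addrC. Qed.
Fact bsection_add0 : left_id zero add.
Proof. by move=> u; apply: bsection_ext => g; rewrite /add add0r. Qed.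
Fact bsection_addN : left_inverse zero opp add.
Proof. by move=> u; apply: bsection_ext => g; rewrite /add addNr. Qed.

HB.instance Definition _ := GRing.isZmodule.Build (bsection B)
  bsection_addA bsection_addC bsection_add0 bsection_addN.

Let scale (k : R[i]) (u : bsection B) : bsection B := fun g => k *: u g.

Fact bsection_scaleA k l u : scale k (scale l u) = scale (k * l) u.
Proof. by apply: bsection_ext => g; rewrite /scale scalerA. Qed.
Fact bsection_scale1 : left_id 1 scale.
Proof. by move=> u; apply: bsection_ext => g; rewrite /scale scale1r. Qed.
Fact bsection_scaleDr : right_distributive scale +%R.
Proof. by move=> k u v; apply: bsection_ext => g; exact: scalerDr. Qed.
Fact bsection_scaleDl u : {morph scale^~ u : k l / k + l}.
Proof. by move=> k l; apply: bsection_ext => g; exact: scalerDl. Qed.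

HB.instance Definition _ := GRing.Zmodule_isLmodule.Build R[i] (bsection B)
  bsection_scaleA bsection_scale1 bsection_scaleDr bsection_scaleDl.

Lemma bsectionDE (u v : bsection B) g : (u + v) g = u g + v g. Proof. by []. Qed.
Lemma bsectionBE (u v : bsection B) g : (u - v) g = u g - v g. Proof. by []. Qed.
Lemma bsectionZE k (u : bsection B) g : (k *: u) g = k *: u g. Proof. by []. Qed.
End SectionModule.

(** * Column norms over finite sets of arrows *)

Section ColumnNorm.
Variables (R : realType) (G : etaleGroupoid) (B : fellBundle R G).
Implicit Types (u v : bsection B) (F : set G) (x : G).

Definition colnorm u x F : R := Num.sqrt (rnorm (square_sum u x F)).

Lemma square_sumE u x F : finite_set F ->
  square_sum u x F = fip x (fun g => u g) (fun g => u g) (finmap.enum_fset (fset_set F)).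
Proof.
move=> fF; rewrite /square_sum fsbig_finite // /fip; apply: eq_bigr => g _.
by rewrite /fm inc_fs.
Qed.

Lemma colnorm_ge0 u x F : 0 <= colnorm u x F.
Proof. exact: sqrtr_ge0. Qed.

Lemma colnorm_sqr u x F : colnorm u x F ^+ 2 = rnorm (square_sum u x F).
Proof. by rewrite sqr_sqrtr ?rnorm_ge0. Qed.

Lemma colnorm_set0 u x : colnorm u x set0 = 0.
Proof. by rewrite /colnorm /square_sum fsbig_set0 rnorm0 sqrtr0. Qed.

Lemma eq_colnorm u v x F : (forall g, F g -> u g = v g) -> colnorm u x F = colnorm v x F.
Proof.
move=> h; congr (Num.sqrt (rnorm _)); apply: eq_fsbigr => g /set_mem Fg.
by rewrite h.
Qed.

Lemma colnorm_le u x F F' : src x = x -> fsets (src_fibre x) F' -> F `<=` F' ->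
  colnorm u x F <= colnorm u x F'.
Proof.
move=> ux [fF' sF'] FF'.
have fF : finite_set F by apply: sub_finite_set fF'.
rewrite ler_wsqrtr // /square_sum [in leRHS](fsum_split _ fF' FF').
have fD := finite_setD F fF'.
rewrite -!/(square_sum _ _ _) !square_sumE // /fip -big_cat /=.
apply: fip_cat_le => // g; rewrite mem_cat !in_fset_set //.
by case/orP => /set_mem; [move=> /FF'/sF' | move=> [/sF']].
Qed.

Lemma rnorm_section_le u x F g : src x = x -> fsets (src_fibre x) F -> F g ->
  rnorm (u g) <= colnorm u x F.
Proof.
move=> ux fF Fg; have := fF.2 _ Fg => sg.
have : colnorm u x [set g] <= colnorm u x F.
  by apply: colnorm_le => // _ ->.
rewrite {1}/colnorm /square_sum fsbig_set1 -(inc_fs _ (erefl (ginv g))) -/(fm _ _ _).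
by rewrite rnorm_fs_mul // sqrtr_sqr ger0_norm // rnorm_ge0.
Qed.

Lemma colnormZ (k : R[i]) u x F : fsets (src_fibre x) F ->
  colnorm (k *: u) x F = complex.Re `|k| * colnorm u x F.
Proof.
move=> [fF sF]; rewrite /colnorm !square_sumE // /fip.
rewrite (_ : \sum_(i <- _) _ = (conjc k * k) *: fip x (fun g => u g) (fun g => u g)
  (finmap.enum_fset (fset_set F))); last first.
  rewrite scaler_sumr !big_seq; apply: eq_bigr => g.
  rewrite in_fset_set // => /set_mem/sF sg.
  have c := composable_Vg g; have m : gmul (ginv g) g = x by [].
  by rewrite bsectionZE (fsZ (erefl _)) (fmZl c m) (fmZr c m) scalerA.
rewrite rnormZ normrM normcJ -expr2.
have -> : complex.Re (`|k| ^+ 2) = complex.Re `|k| ^+ 2.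
  by rewrite -[`|k|]RRe_real ?normr_real // -rmorphXn.
by rewrite sqrtrM ?sqr_ge0 // sqrtr_sqr ger0_norm // Re_norm_ge0.
Qed.

(** Minkowski's inequality: Cauchy-Schwarz bounds the cross terms <u, v> and <v, u>. *)
Lemma colnormD u v x F : src x = x -> fsets (src_fibre x) F ->
  colnorm (u + v) x F <= colnorm u x F + colnorm v x F.
Proof.
move=> ux [fF sF]; set s := finmap.enum_fset (fset_set F).
have hs : {in s, forall g, src g = x} by move=> g; rewrite in_fset_set // => /set_mem/sF.
have -> : colnorm u x F + colnorm v x F = Num.sqrt ((colnorm u x F + colnorm v x F) ^+ 2).
  by rewrite sqrtr_sqr ger0_norm // addr_ge0 ?colnorm_ge0.
rewrite ler_wsqrtr // sqrrD !colnorm_sqr !square_sumE //.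
rewrite -/s.
have -> : fip x (fun g => (u + v) g) (fun g => (u + v) g) s =
   (fip x u u s + fip x v v s) + (fip x u v s + fip x v u s).
  rewrite /fip -!big_split !big_seq; apply: eq_bigr => g sg.
  have c := composable_Vg g; have m : gmul (ginv g) g = x by exact: hs.
  rewrite bsectionDE (fsD (erefl _)) (fmDl c m) !(fmDr c m) /=.
  by rewrite [X in _ + X]addrC addrACA.
apply: le_trans (rnormD _ _) _; apply: le_trans (lerD (rnormD _ _) (rnormD _ _)) _.
have cs w w' : rnorm (fip x w w' s) <= colnorm w x F * colnorm w' x F.
  rewrite -ler_sqr ?nnegrE ?rnorm_ge0 ?mulr_ge0 ?colnorm_ge0 //.
  by rewrite exprMn !colnorm_sqr !square_sumE //; exact: fip_cauchy_schwarz1.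
have := cs u v; have := cs v u; rewrite [colnorm v x F * _]mulrC; lra.
Qed.

(** A crude estimate, enough to pass from entrywise limits to column norms on a fixed finite set. *)
Lemma colnorm_sum_le u x F : fsets (src_fibre x) F ->
  colnorm u x F ^+ 2 <= \sum_(g \in F) rnorm (u g) ^+ 2.
Proof.
move=> [fF sF]; rewrite colnorm_sqr square_sumE // /fip fsbig_finite //.
apply: le_trans (rnorm_sum _ _ _) _; rewrite !big_seq; apply: ler_sum => g.
by rewrite in_fset_set // => /set_mem/sF sg; rewrite rnorm_fs_mul.
Qed.

Lemma colnormU u x F F' : src x = x -> fsets (src_fibre x) F -> fsets (src_fibre x) F' ->
  colnorm u x (F `|` F') <= colnorm u x F + colnorm u x F'.
Proof.
move=> ux fF fF'.
have -> : F `|` F' = F `|` (F' `\` F) by rewrite setDE setUIr setUv setIT.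
have fD := fsetsD F fF'.
have h : colnorm u x (F `|` F' `\` F) <= colnorm u x F + colnorm u x (F' `\` F).
  rewrite -ler_sqr ?nnegrE ?addr_ge0 ?colnorm_ge0 // sqrrD !colnorm_sqr.
  rewrite /square_sum fsbigU0 //; [|exact: fF.1|exact: fD.1|by move=> g [? []]].
  apply: le_trans (rnormD _ _) _; rewrite -addrA lerD2l ler_wpDl //.
  by rewrite mulrn_wge0 // mulr_ge0 ?colnorm_ge0.
apply: le_trans h _; rewrite lerD2l; apply: colnorm_le => // g; by case.
Qed.

End ColumnNorm.

(** * Partial sums and values of a convolution *)

Section ConvolutionNets.
Variables (R : realType) (G : etaleGroupoid) (B : fellBundle R G).
Implicit Types (a b u v : bsection B) (F : set G) (g h x : G).

Lemma eq_fm_section z (a : bsection B) g g' h (d : fib B h) :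
  g = g' -> fm z (a g) d = fm z (a g') d.
Proof. by move=> ->. Qed.

Lemma sstarE a g h : h = ginv g -> sstar a g = fs g (a h).
Proof. by move=> ->. Qed.

Lemma fs_sstar a g h : h = ginv g -> fs h (sstar a g) = a h.
Proof. by move=> e; rewrite (sstarE _ e) fsK // e ginvK. Qed.

Lemma sstarK : involutive (@sstar R G B).
Proof. by move=> a; apply: bsection_ext => g; rewrite (sstarE _ (erefl _)) fs_sstar // ginvK. Qed.

Lemma sstarD a b : sstar (a + b) = sstar a + sstar b.
Proof. by apply: bsection_ext => g; exact: (fsD (ginvK g)). Qed.

Lemma sstarZ (k : R[i]) a : sstar (k *: a) = conjc k *: sstar a.
Proof. by apply: bsection_ext => g; exact: (fsZ (ginvK g)). Qed.

Lemma sstarB a b : sstar (a - b) = sstar a - sstar b.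
Proof. by rewrite -scaleN1r sstarD sstarZ rmorphN1 scaleN1r. Qed.

(* The factorizations [g = (g h^-1) h] are indexed by the second factor [h]. *)
Definition cterm a b g h : fib B g := fm g (a (gmul g (ginv h))) (b h).

Definition cpart a b g F : fib B g := \sum_(h \in F) cterm a b g h.

(** A relation, so that limits at one arrow can be handled before [convolution_defined] is known;
    [convolutionE] recovers the value of [convolution]. *)
Definition cvalue a b g (v : fib B g) :=
  rlim (finite_subsets_filter (src_fibre (src g))) (cpart a b g) v.

Lemma composable_gVh g h : src h = src g -> composable g (ginv h).
Proof. by rewrite /composable rng_ginv. Qed.

Lemma composable_gVh_h g h : src h = src g -> composable (gmul g (ginv h)) h.
Proof. by move=> e; rewrite /composable (src_gmul (composable_gVh e)) src_ginv. Qed.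

Lemma gmulVhK g h : src h = src g -> gmul (gmul g (ginv h)) h = g.
Proof. by move=> e; have := gmulVK (composable_gVh e); rewrite ginvK. Qed.

Lemma ginv_gVh g h : src h = src g -> ginv (gmul g (ginv h)) = gmul h (ginv g).
Proof. by move=> e; rewrite (ginv_gmul (composable_gVh e)) ginvK. Qed.

Lemma src_gVh g h : src h = src g -> src (gmul g (ginv h)) = rng h.
Proof. by move=> e; rewrite (src_gmul (composable_gVh e)) src_ginv. Qed.

Lemma rng_gVh g h : src h = src g -> rng (gmul g (ginv h)) = rng g.
Proof. by move=> e; rewrite (rng_gmul (composable_gVh e)). Qed.

Lemma cvalueP a b g (v : fib B g) : cvalue a b v <->
  rlim (finite_subsets_filter (factorizations g)) (convolution_partial a b g) v.
Proof.
have fD h : src_fibre (src g) h ->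
    factorizations g (gmul g (ginv h), h) /\ (gmul g (ginv h), h).2 = h.
  move=> e; split=> //; split; first exact: composable_gVh_h.
  exact: gmulVhK.
have Df p : factorizations g p ->
    src_fibre (src g) p.2 /\ (gmul g (ginv p.2), p.2) = p.
  case: p => h k /= [c e]; split; first by rewrite /src_fibre /= -e src_gmul.
  by rewrite -e gmulVK.
split=> L.
- have := @rlim_net_reindex _ _ _ _ (factorizations g) (src_fibre (src g)) snd
    (fun h => (gmul g (ginv h), h)) (cterm a b g) v Df fD L.
  move=> {}L e e0; have [F0 F0D hF0] := L e e0; exists F0 => // F FF.
  have := hF0 _ FF; congr (rnorm (_ - _) <= _).
  apply: eq_fsbigr => -[h k] /set_mem Fp; have [[_ FD] _] := FF.
  have [_ e1] := Df _ (FD _ Fp); rewrite /cterm /=.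
  apply: eq_fm_section; by case: e1.
- have := @rlim_net_reindex _ _ _ _ (src_fibre (src g)) (factorizations g)
    (fun h => (gmul g (ginv h), h)) snd (convolution_term a b g) v fD Df L.
  by [].
Qed.

Lemma convolution_definedP a b :
  convolution_defined a b <-> forall g, exists v : fib B g, cvalue a b v.
Proof.
split=> h g.
  by have /cvg_ex[v /rlimP cv] := h g; exists v; apply/cvalueP.
by have [v /cvalueP/rlimP cv] := h g; apply/cvg_ex; exists v.
Qed.

Lemma convolutionE a b g (v : fib B g) : cvalue a b v -> convolution a b g = v.
Proof. by move=> /cvalueP/rlim_lim. Qed.

Lemma convolutionP a b g : convolution_defined a b -> cvalue a b (convolution a b g).
Proof. by move=> /convolution_definedP/(_ g)[v cv]; rewrite (convolutionE cv). Qed.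

(** Since a(g h^-1) is the adjoint of a^* at h g^-1, the entries of a in a partial sum over F come
    from the column of a^* on the right translate F g^-1. *)
Definition rtrans g F : set G := (fun h => gmul h (ginv g)) @` F.

Lemma rtrans_fsets g F : fsets (src_fibre (src g)) F -> fsets (src_fibre (rng g)) (rtrans g F).
Proof.
move=> [fF sF]; split; first exact: finite_image.
move=> _ [h /sF e <-]; rewrite /src_fibre /= src_gVh //; exact: esym.
Qed.

(** The partial sum is the inner product of the translated column of a^* over the range of [g] with
    the column of b over its source. *)
Lemma cpart_cauchy_schwarz a b g F : fsets (src_fibre (src g)) F ->
  rnorm (cpart a b g F) <=
    colnorm (sstar a) (rng g) (rtrans g F) * colnorm b (src g) F.
Proof.
move=> fF; have [finF sF] := fF.
have sF' h : F h -> src g = src h by move=> /sF.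
rewrite -ler_sqr ?nnegrE ?rnorm_ge0 ?mulr_ge0 ?colnorm_ge0 // exprMn !colnorm_sqr.
set s := finmap.enum_fset (fset_set F).
have hs h : h \in s -> F h by rewrite in_fset_set // => /set_mem.
have -> : cpart a b g F = fip g (fun h => sstar a (gmul h (ginv g))) (fun h => b h) s.
  rewrite /cpart fsbig_finite // /fip !big_seq; apply: eq_bigr => h /hs Fh.
  have e := ginv_gVh (sF' h Fh).
  rewrite fs_sstar // /cterm; apply: eq_fm_section.
  by rewrite e.
have -> : square_sum (sstar a) (rng g) (rtrans g F) =
    fip (rng g) (fun h => sstar a (gmul h (ginv g))) (fun h => sstar a (gmul h (ginv g))) s.
  rewrite /square_sum fsbig_image; last first.
    move=> h k /set_mem Fh /set_mem Fk e.
    rewrite -(gmulVhK (sF' h Fh)) e.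
    exact: (gmulVhK (sF' k Fk)).
  rewrite fsbig_finite // /fip; apply: eq_bigr => h _.
  by rewrite /fm inc_fs.
rewrite square_sumE // -/s.
apply: fip_cauchy_schwarz => // h /hs Fh.
have e := ginv_gVh (sF' h Fh); have sh : src h = src g := sF _ Fh.
by rewrite e; split; [exact: composable_gVh_h | exact: gmulVhK].
Qed.

End ConvolutionNets.

(** * Bounded and square summable columns *)

Section Columns.
Variables (R : realType) (G : etaleGroupoid) (B : fellBundle R G).
Implicit Types (a b u v : bsection B) (F : set G) (g h x : G) (K L e : R).

Definition col_bounded u x K :=
  forall F, fsets (src_fibre x) F -> colnorm u x F <= K.

(** The Cauchy criterion for the sum of the u(g)^* u(g), phrased with finite sets away from [F0]. In
    a Hilbert module it is stronger than [col_bounded]. *)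
Definition square_summable u x := forall e, 0 < e ->
  exists2 F0, fsets (src_fibre x) F0 &
    forall F, fsets (src_fibre x) F -> F `&` F0 `<=` set0 -> colnorm u x F <= e.

Definition restr F u : bsection B := fun g => if g \in F then u g else 0.

Lemma col_bounded_ge0 u x K : col_bounded u x K -> 0 <= K.
Proof. by move=> /(_ _ (fsets_set0 _)); rewrite colnorm_set0. Qed.

Lemma col_boundedW u x K L : K <= L -> col_bounded u x K -> col_bounded u x L.
Proof. by move=> KL h F /h/le_trans; apply. Qed.

Lemma col_boundedD u v x K L : src x = x ->
  col_bounded u x K -> col_bounded v x L -> col_bounded (u + v) x (K + L).
Proof.
move=> ux h h' F fF; apply: le_trans (colnormD _ _ ux fF) _.
by apply: lerD; [exact: h | exact: h'].
Qed.

Lemma col_boundedZ (k : R[i]) u x K :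
  col_bounded u x K -> col_bounded (k *: u) x (complex.Re `|k| * K).
Proof.
by move=> h F fF; rewrite colnormZ //; apply: ler_wpM2l; [exact: Re_norm_ge0 | exact: h].
Qed.

Lemma eq_col_bounded u v x K : (forall g, src g = x -> u g = v g) ->
  col_bounded u x K -> col_bounded v x K.
Proof. by move=> E h F fF; rewrite -(eq_colnorm x (u := u)); [exact: h | move=> g /fF.2/E]. Qed.

Lemma colnorm_restr u x F F' : fsets (src_fibre x) F' ->
  colnorm (restr F u) x F' = colnorm u x (F' `&` F).
Proof.
move=> [fF' sF']; congr (Num.sqrt (rnorm _)); rewrite /square_sum fsbig_mkcondr.
apply: eq_fsbigr => g /set_mem/sF' sg; rewrite /restr; case: ifP => // _.
rewrite -(inc_fs _ (erefl (ginv g))) -/(fm _ _ _) fm0r //; exact: composable_Vg.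
Qed.

Lemma col_bounded_restr u x K F : src x = x ->
  col_bounded u x K -> col_bounded (restr F u) x K.
Proof. by move=> ux h F' fF'; rewrite colnorm_restr //; apply/h/fsetsI. Qed.

Lemma rnorm_col_bounded u g K : col_bounded u (src g) K -> rnorm (u g) <= K.
Proof.
have fg : fsets (src_fibre (src g)) [set g].
  by split; [exact: finite_set1 | move=> _ ->].
by move=> /(_ _ fg); apply: le_trans; apply: rnorm_section_le => //; exact: src_src.
Qed.

Lemma square_summable_bounded u x : src x = x -> square_summable u x ->
  exists K, col_bounded u x K.
Proof.
move=> ux /(_ 1 ltr01)[F0 fF0 h]; exists (1 + colnorm u x F0) => F fF.
apply: (@le_trans _ _ (colnorm u x (F `\` F0 `|` F0))).
  apply: colnorm_le => //; first by apply: fsetsU => //; exact: fsetsD.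
  by move=> g Fg; have [?|?] := pselect (F0 g); [right | left].
apply: le_trans (colnormU _ _ _ _) _ => //; first exact: fsetsD.
by rewrite lerD2r; apply: h; [exact: fsetsD | move=> g [[]]].
Qed.

Lemma square_summable_closed u x : src x = x ->
  (forall e, 0 < e -> exists2 v, square_summable v x & col_bounded (u - v) x e) ->
  square_summable u x.
Proof.
move=> ux h e e0; have e2 : 0 < e / 2 by rewrite divr_gt0.
have [v sv bv] := h _ e2; have [F0 fF0 hF0] := sv _ e2.
exists F0 => // F fF dF; rewrite -[u](subrK v).
by apply: le_trans (colnormD _ _ ux fF) _; have := bv _ fF; have := hF0 _ fF dF; lra.
Qed.

Lemma square_summableD u v x : src x = x ->
  square_summable u x -> square_summable v x -> square_summable (u + v) x.
Proof.
move=> ux h h' e e0; have e2 : 0 < e / 2 by rewrite divr_gt0.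
have [F0 fF0 hF0] := h _ e2; have [F1 fF1 hF1] := h' _ e2.
exists (F0 `|` F1); first exact: fsetsU.
move=> F fF dF; apply: le_trans (colnormD _ _ ux fF) _.
have d0 : F `&` F0 `<=` set0 by move=> g [Fg F0g]; apply: (dF g); split=> //; left.
have d1 : F `&` F1 `<=` set0 by move=> g [Fg F1g]; apply: (dF g); split=> //; right.
by have := hF0 _ fF d0; have := hF1 _ fF d1; lra.
Qed.

Lemma square_summableZ (k : R[i]) u x : square_summable u x -> square_summable (k *: u) x.
Proof.
move=> h e e0; have k0 := Re_norm_ge0 k.
have e2 : 0 < e / (complex.Re `|k| + 1) by rewrite divr_gt0 //; lra.
have [F0 fF0 hF0] := h _ e2; exists F0 => // F fF dF; rewrite colnormZ //.
apply: le_trans (ler_wpM2l k0 (hF0 _ fF dF)) _.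
rewrite mulrA ler_pdivrMr; [nra | lra].
Qed.

Lemma eq_square_summable u v x : (forall g, src g = x -> u g = v g) ->
  square_summable u x -> square_summable v x.
Proof.
move=> E h e e0; have [F0 fF0 hF0] := h _ e0; exists F0 => // F fF dF.
by rewrite -(eq_colnorm x (u := u)); [exact: hF0 | move=> g /fF.2/E].
Qed.

Lemma square_summable0 x : square_summable 0 x.
Proof.
move=> e e0; exists set0; first exact: fsets_set0.
move=> F fF _; have := @colnormZ _ _ B 0 0 x F fF; rewrite scale0r normr0 mul0r => ->.
exact: ltW.
Qed.

Lemma square_summable_sum (I : Type) (s : seq I) (P : pred I) (w : I -> bsection B) x :
  src x = x -> (forall i, P i -> square_summable (w i) x) ->
  square_summable (\sum_(i <- s | P i) w i) x.
Proof.
move=> ux h; apply: (big_ind (fun u => square_summable u x)) => //; first exact: square_summable0.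
by move=> u v; exact: square_summableD.
Qed.

Lemma square_summable_tail u x e : src x = x -> square_summable u x -> 0 < e ->
  exists2 F0, fsets (src_fibre x) F0 & col_bounded (u - restr F0 u) x e.
Proof.
move=> ux h e0; have [F0 fF0 hF0] := h _ e0; exists F0 => // F fF.
have -> : u - restr F0 u = restr (~` F0) u.
  apply: bsection_ext => g; rewrite bsectionBE /restr in_setC.
  by case: ifP => _ /=; rewrite ?subrr ?subr0.
rewrite colnorm_restr //; apply: hF0; first exact: fsetsI.
by move=> g [[_ ?]].
Qed.

(** Bounds are tested on finite sets, where entrywise convergence suffices: if F has n elements,
    entrywise errors e / (n + 1) give a column of norm at most e. *)
Lemma col_bounded_lim (T : Type) (Phi : set_system T) (FF : ProperFilter Phi)
    (v : T -> bsection B) u x K : src x = x ->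
  (forall g, src g = x -> rlim Phi (fun t => v t g) (u g)) ->
  Phi [set t | col_bounded (v t) x K] -> col_bounded u x K.
Proof.
move=> ux lim hK F fF; have [finF sF] := fF; apply/ler_addgt0Pr => e e0.
pose n := (size (finmap.enum_fset (fset_set F)))%:R : R; have n0 : 0 <= n := ler0n _ _.
have d0 : 0 < e / (n + 1) by rewrite divr_gt0 //; lra.
have near (s : seq G) : {in s, forall g, src g = x} ->
    Phi [set t | {in s, forall g, rnorm (u g - v t g) <= e / (n + 1)}].
  elim: s => [|g s IH] hs; first exact: filterE.
  have h1 : {in s, forall g, src g = x} by move=> k ks; apply: hs; rewrite inE ks orbT.
  have h2 : src g = x by apply: hs; rewrite inE eqxx.
  apply: filterS2 (lim _ h2 _ d0) (IH h1) => t /= a b k; rewrite inE.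
  by case/orP=> [/eqP->|/b].
have hs : {in finmap.enum_fset (fset_set F), forall g, src g = x}.
  by move=> g; rewrite in_fset_set // => /set_mem/sF.
have [t [/= a b]] := filter_ex (filterI (near _ hs) hK).
rewrite -[u](subrK (v t)) addrC; apply: le_trans (colnormD _ _ ux fF) _.
apply: lerD; first exact: b.
rewrite -ler_sqr ?nnegrE ?colnorm_ge0 ?(ltW e0) //.
apply: le_trans (colnorm_sum_le _ fF) _; rewrite fsbig_finite //.
rewrite /=; apply: (@le_trans _ _
  (\sum_(g <- finmap.enum_fset (fset_set F)) (e / (n + 1)) ^+ 2 : R)).
  rewrite !big_seq; apply: ler_sum => g sg.
  by rewrite ler_sqr ?nnegrE ?rnorm_ge0 ?(ltW d0) //; exact: a.
rewrite big_const_seq iter_addr_0 count_predT -mulr_natl.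
have -> : (size (finmap.enum_fset (fset_set F)))%:R = n by [].
rewrite exprMn mulrCA -[leRHS]mulr1; apply: ler_wpM2l; first exact: sqr_ge0.
by rewrite exprVn ler_pdivrMr; nra.
Qed.

End Columns.

(** * Existence of convolutions and bounded action on columns *)

Section ConvolutionTheory.
Variables (R : realType) (G : etaleGroupoid) (B : fellBundle R G).
Implicit Types (a b c u v f : bsection B) (F : set G) (g h x : G) (K L M e : R).

Lemma fsets_near (I : choiceType) (D : set I) : finite_subsets_filter D (fsets D).
Proof. by exists set0; [exact: fsets_set0 | move=> F []]. Qed.

Lemma cpartB_split a b g F F0 : fsets (src_fibre (src g)) F -> F0 `<=` F ->
  cpart a b g F - cpart a b g F0 = cpart a b g (F `\` F0).
Proof. by move=> [fF _] s; rewrite {1}/cpart (fsum_split _ fF s) addrC addKr. Qed.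

(** By Cauchy-Schwarz, a partial sum away from [F0] is at most K times a small tail of b, so the net
    is Cauchy. *)
Lemma cvalue_exists a b g K : col_bounded (sstar a) (rng g) K ->
  square_summable b (src g) -> exists v : fib B g, cvalue a b v.
Proof.
move=> hK hb; have K0 := col_bounded_ge0 hK; apply: rcauchy_lim => e e0.
have d0 : 0 < e / 2 / (K + 1) by rewrite !divr_gt0 //; lra.
have [F0 fF0 hF0] := hb _ d0.
exists [set F | fsets (src_fibre (src g)) F /\ F0 `<=` F]; first by exists F0.
have key F : fsets (src_fibre (src g)) F -> F0 `<=` F ->
    rnorm (cpart a b g F - cpart a b g F0) <= e / 2.
  move=> fF s; rewrite cpartB_split //; have fD := fsetsD F0 fF.
  apply: le_trans (cpart_cauchy_schwarz a b fD) _.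
  have h1 := hK _ (rtrans_fsets fD).
  have h2 : colnorm b (src g) (F `\` F0) <= e / 2 / (K + 1).
    by apply: hF0 => // h [[]].
  apply: le_trans (ler_pM (colnorm_ge0 _ _ _) (colnorm_ge0 _ _ _) h1 h2) _.
  by rewrite mulrA ler_pdivrMr; nra.
move=> F F' [fF s] [fF' s']; apply: le_trans (rnorm_tri _ (cpart a b g F0) _) _.
by have := key _ fF s; have := key _ fF' s'; rewrite [rnorm (cpart a b g F' - _)]rnormC; lra.
Qed.

Lemma square_sum_cpart a x F : src x = x -> fsets (src_fibre x) F ->
  square_sum a x F = cpart (sstar a) a x F.
Proof.
move=> ux [fF sF]; apply: eq_fsbigr => g /set_mem/sF sg.
rewrite -(inc_fs _ (erefl (ginv g))) -/(fm _ _ _) /cterm.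
have e : ginv g = gmul x (ginv g) by rewrite -sg -[in RHS]rng_ginv gmul_rng.
rewrite -(eq_fm_section _ (sstar a) _ e).
by rewrite (sstarE _ (esym (ginvK g))).
Qed.

(** Units decide: there the partial sums of a^* a are the square sums of a column, and convergence
    at every other arrow follows by Cauchy-Schwarz. *)
Lemma convolution_defined_sstarP a :
  convolution_defined (sstar a) a <-> forall x, src x = x -> square_summable a x.
Proof.
split=> [/convolution_definedP h x ux|h].
- have [l cl] := h x; move=> e e0.
  have e2 : 0 < e ^+ 2 / 2 by rewrite divr_gt0 // exprn_gt0.
  have [F0] := cl _ e2; rewrite ux => fF0 hF0; exists F0 => // F fF dF.
  rewrite -ler_sqr ?nnegrE ?colnorm_ge0 ?(ltW e0) // colnorm_sqr.
  have fU := fsetsU fF fF0.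
  (* Both partial sums are within e^2 / 2 of the limit, and F is disjoint from [F0]. *)
  have -> : square_sum a x F = cpart (sstar a) a x (F `|` F0) - cpart (sstar a) a x F0.
    have fU' : fsets (src_fibre (src x)) (F `|` F0) by rewrite ux.
    rewrite (cpartB_split _ _ fU' (@subsetUr _ _ _)).
    have -> : (F `|` F0) `\` F0 = F.
      apply/seteqP; split=> g; first by case=> [[]].
      by move=> Fg; split; [left | move=> F0g; exact: (dF g)].
    exact: square_sum_cpart.
  apply: le_trans (rnorm_tri _ l _) _; rewrite rnormC.
  have := hF0 _ (conj fU (@subsetUr _ _ _)); have := hF0 _ (conj fF0 (@subset_refl _ _)).
  by rewrite /=; lra.
- apply/convolution_definedP => g.
  have [K hK] := square_summable_bounded (src_rng g) (h _ (src_rng g)).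
  apply: (@cvalue_exists _ _ _ K); first by rewrite sstarK.
  by apply: h; exact: src_src.
Qed.

Lemma cvalue_finite a b g F : fsets (src_fibre (src g)) F ->
  (forall h, src h = src g -> ~ F h -> b h = 0) -> cvalue a b (cpart a b g F).
Proof.
move=> fF h0 e e0; exists F => // F' [[fF' sF'] s] /=.
rewrite rnormC cpartB_split // /cpart fsbig1 ?rnorm0 ?ltW // => h [/sF' sh nFh].
by rewrite /cterm h0 // fm0r // ?gmulVhK //; exact: composable_gVh_h.
Qed.

Lemma cpart_lin a b b' g F (k : R[i]) : fsets (src_fibre (src g)) F ->
  cpart a (k *: b + b') g F = k *: cpart a b g F + cpart a b' g F.
Proof.
move=> [fF sF]; rewrite /cpart !fsbig_finite // scaler_sumr -big_split /= !big_seq.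
apply: eq_bigr => h; rewrite in_fset_set // => /set_mem/sF sh.
have c := composable_gVh_h sh; have m := gmulVhK sh.
by rewrite /cterm bsectionDE bsectionZE (fmDr c m) (fmZr c m).
Qed.

Lemma cpart_linl a a' b g F (k : R[i]) : fsets (src_fibre (src g)) F ->
  cpart (k *: a + a') b g F = k *: cpart a b g F + cpart a' b g F.
Proof.
move=> [fF sF]; rewrite /cpart !fsbig_finite // scaler_sumr -big_split /= !big_seq.
apply: eq_bigr => h; rewrite in_fset_set // => /set_mem/sF sh.
have c := composable_gVh_h sh; have m := gmulVhK sh.
by rewrite /cterm bsectionDE bsectionZE (fmDl c m) (fmZl c m).
Qed.

Lemma cvalue_lin a b b' g (v v' : fib B g) (k : R[i]) :
  cvalue a b v -> cvalue a b' v' -> cvalue a (k *: b + b') (k *: v + v').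
Proof.
move=> h h'; apply: rlim_near (rlimD (rlimZ k h) h').
by apply: filterS (fsets_near _) => F fF /=; rewrite cpart_lin.
Qed.

Lemma cvalue_linl a a' b g (v v' : fib B g) (k : R[i]) :
  cvalue a b v -> cvalue a' b v' -> cvalue (k *: a + a') b (k *: v + v').
Proof.
move=> h h'; apply: rlim_near (rlimD (rlimZ k h) h').
by apply: filterS (fsets_near _) => F fF /=; rewrite cpart_linl.
Qed.

Lemma cvalueB a b b' g (v v' : fib B g) :
  cvalue a b v -> cvalue a b' v' -> cvalue a (b - b') (v - v').
Proof.
move=> h h'; rewrite [b - b']addrC [v - v']addrC -scaleN1r -[- v']scaleN1r.
exact: cvalue_lin.
Qed.

Lemma restr_finitely_supported F u : finite_set F -> finitely_supported (restr F u).
Proof.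
move=> fF; apply: sub_finite_set fF => g; rewrite /supp /restr /=.
by case: ifP => [/set_mem//|_]; rewrite eqxx.
Qed.

Lemma finitely_supported_fsets f x : finitely_supported f ->
  fsets (src_fibre x) (supp f `&` src_fibre x).
Proof. by move=> h; split; [exact: finite_setIl | move=> g []]. Qed.

Lemma cvalue_finitely_supported a f g : finitely_supported f ->
  cvalue a f (cpart a f g (supp f `&` src_fibre (src g))).
Proof.
move=> h; apply: cvalue_finite; first exact: finitely_supported_fsets.
by move=> k sk nk; apply/eqP/negP => /negP f0; apply: nk.
Qed.

Lemma finitely_supportedP a f g : finitely_supported f ->
  cvalue a f (convolution a f g).
Proof.
by move=> h; have := cvalue_finitely_supported a g h => c; rewrite (convolutionE c).
Qed.

Lemma convolution_restr a b g F : fsets (src_fibre (src g)) F ->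
  convolution a (restr F b) g = cpart a b g F.
Proof.
move=> fF; have -> : cpart a b g F = cpart a (restr F b) g F.
  by apply: eq_fsbigr => h Fh; rewrite /cterm /restr Fh.
apply: convolutionE; apply: cvalue_finite => // h _ nF.
by rewrite /restr memNset.
Qed.

(** Equivalent to [normb a <= M] by [normb_leP], but free of quotients: one column at a time, with
    any bound K on it. *)
Definition op_bounded a M := 0 <= M /\
  forall f, finitely_supported f -> forall x K, src x = x ->
    col_bounded f x K -> col_bounded (convolution a f) x (M * K).

(** The truncations of b are finitely supported and are mapped to columns bounded by M K; the
    entrywise limit keeps this bound. *)
Lemma op_bounded_ext a b c x M K : src x = x -> op_bounded a M -> col_bounded b x K ->
  (forall g, src g = x -> cvalue a b (c g)) -> col_bounded c x (M * K).
Proof.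
move=> ux [M0 ha] hb hc.
apply: (@col_bounded_lim _ _ _ _ (finite_subsets_filter (src_fibre x)) _
  (fun F => convolution a (restr F b))) => //.
- move=> g sg; have := hc g sg; rewrite /cvalue sg => h.
  apply: rlim_near h; apply: filterS (fsets_near _) => F fF /=.
  by rewrite convolution_restr // sg.
- apply: filterS (fsets_near _) => F [fF sF] /=; apply: ha => //.
    exact: restr_finitely_supported.
  exact: col_bounded_restr.
Qed.

Lemma rtrans_ginv_sub h F F0 : F `<=` src_fibre (src h) ->
  F `&` rtrans (ginv h) F0 `<=` set0 -> rtrans h F `&` F0 `<=` set0.
Proof.
move=> sF d k [[g Fg gk] F0k]; apply: (d g); split=> //.
by exists k => //; rewrite ginvK -gk gmulVhK //; exact/esym/sF.
Qed.

(** With k = g h^-1, each term is b(h)^* a(k)^* a(k) b(h): right multiplication by b(h) carries the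
    column of a over the range of [h] to a column over its source. *)
Lemma square_sum_cterm a b h x F : src h = x -> fsets (src_fibre x) F ->
  square_sum (fun g => cterm a b g h) x F =
  fm x (fm (ginv h) (fs (ginv h) (b h)) (square_sum a (rng h) (rtrans h F))) (b h).
Proof.
move=> sh [fF sF].
have c1 : composable (ginv h) (rng h) by rewrite /composable src_ginv rng_rng.
have m1 : gmul (ginv h) (rng h) = ginv h by rewrite -src_ginv gmul_src.
have c2 := composable_Vg h; have m2 : gmul (ginv h) h = x by rewrite -sh.
have shg g : F g -> src h = src g by move=> /sF ->.
rewrite {2}/square_sum fsbig_image; last first.
  move=> g k /set_mem Fg /set_mem Fk e.
  by rewrite -(gmulVhK (shg g Fg)) e (gmulVhK (shg k Fk)).
rewrite /square_sum !fsbig_finite // (fm_sumr c1 m1) (fm_suml c2 m2) !big_seq.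
apply: eq_bigr => g; rewrite in_fset_set // => /set_mem Fg.
have e := shg g Fg; have sg : src g = x := sF g Fg.
set k := gmul g (ginv h).
have ckh : composable k h := composable_gVh_h e.
have mkh : gmul k h = g := gmulVhK e.
rewrite -(inc_fs _ (erefl (ginv g))) -(inc_fs _ (erefl (ginv k))) -!/(fm _ _ _).
rewrite /cterm -/k (fs_fm ckh mkh _ _ (erefl _) (erefl _) (erefl _)).
have sk : src k = rng h := ckh.
have cVhVk : composable (ginv h) (ginv k) by rewrite /composable src_ginv rng_ginv sk.
have mVhVk : gmul (ginv h) (ginv k) = ginv g by rewrite -(ginv_gmul ckh) mkh.
have cVkk := composable_Vg k; have mVkk : gmul (ginv k) k = rng h by rewrite -sk.
have cVgk : composable (ginv g) k by rewrite /composable src_ginv -mkh rng_gmul.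
have mVgk : gmul (ginv g) k = ginv h.
  by rewrite -mVhVk gmulA // mVkk.
rewrite -(fmA _ _ _ cVgk ckh mVgk mkh m2).
by rewrite (fmA _ _ _ cVhVk cVkk mVhVk mVkk mVgk).
Qed.

Lemma colnorm_cterm a b h x F : src h = x -> fsets (src_fibre x) F ->
  colnorm (fun g => cterm a b g h) x F <= rnorm (b h) * colnorm a (rng h) (rtrans h F).
Proof.
move=> sh fF; rewrite -ler_sqr ?nnegrE ?mulr_ge0 ?colnorm_ge0 ?rnorm_ge0 //.
rewrite exprMn !colnorm_sqr square_sum_cterm //.
have c1 : composable (ginv h) (rng h) by rewrite /composable src_ginv rng_rng.
have m1 : gmul (ginv h) (rng h) = ginv h by rewrite -src_ginv gmul_src.
have c2 := composable_Vg h; have m2 : gmul (ginv h) h = x by rewrite -sh.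
apply: le_trans (rnorm_fm c2 m2 _ _) _; rewrite mulrC expr2 -mulrA.
apply: ler_wpM2l; first exact: rnorm_ge0.
by apply: le_trans (rnorm_fm c1 m1 _ _) _; rewrite rnorm_fs.
Qed.

Lemma square_summable_cterm a b h x : src h = x -> square_summable a (rng h) ->
  square_summable (fun g => cterm a b g h) x.
Proof.
move=> sh ha e e0; have b0 := rnorm_ge0 (b h).
have d0 : 0 < e / (rnorm (b h) + 1) by rewrite divr_gt0 //; lra.
have [F0 fF0 hF0] := ha _ d0.
exists (rtrans (ginv h) F0).
  by rewrite -sh -rng_ginv; apply: rtrans_fsets; rewrite src_ginv.
move=> F fF dF; apply: le_trans (colnorm_cterm a b sh fF) _.
have fr : fsets (src_fibre (rng h)) (rtrans h F) by apply: rtrans_fsets; rewrite sh.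
have := hF0 _ fr (rtrans_ginv_sub _ dF); rewrite sh => /(_ fF.2) h1.
apply: le_trans (ler_wpM2l b0 h1) _.
by rewrite mulrA ler_pdivrMr; nra.
Qed.

Lemma square_summable_convolution_restr a b x F : src x = x ->
  (forall y, src y = y -> square_summable a y) -> fsets (src_fibre x) F ->
  square_summable (convolution a (restr F b)) x.
Proof.
move=> ux ha fF; have [finF sF] := fF.
pose w : bsection B := \sum_(h <- finmap.enum_fset (fset_set F) | h \in F)
   ((fun g => cterm a b g h) : bsection B).
have wE g : w g = \sum_(h <- finmap.enum_fset (fset_set F) | h \in F) cterm a b g h.
  by rewrite /w; elim/big_rec2: _ => // h y1 y2 _ <-.
apply: (@eq_square_summable _ _ _ w).
  move=> g sg; rewrite convolution_restr ?sg // wE /cpart fsbig_finite //.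
  by rewrite [RHS]big_seq; apply: eq_bigl => h; rewrite in_fset_set.
apply: square_summable_sum => // h /set_mem/sF sh.
by apply: square_summable_cterm => //; apply: ha; exact: src_rng.
Qed.

(** Truncations of b yield square summable columns, and these approximate c in column norm because a
    is bounded. *)
Lemma square_summable_mul a b c x M : src x = x ->
  (forall y, src y = y -> square_summable a y) -> op_bounded a M ->
  square_summable b x -> (forall g, src g = x -> cvalue a b (c g)) ->
  square_summable c x.
Proof.
move=> ux ha oa hb hc; have M0 := oa.1.
apply: square_summable_closed => // e e0.
have d0 : 0 < e / (M + 1) by rewrite divr_gt0 //; lra.
have [F0 fF0 hF0] := square_summable_tail ux hb d0.
exists (convolution a (restr F0 b)); first exact: square_summable_convolution_restr.
apply: (@col_boundedW _ _ _ _ _ (M * (e / (M + 1)))).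
  by rewrite mulrA ler_pdivrMr; nra.
apply: (op_bounded_ext ux oa hF0) => g sg.
apply: cvalueB; first exact: hc.
by apply: finitely_supportedP; apply: restr_finitely_supported; exact: fF0.1.
Qed.

Lemma fs_square_sum a x F : src x = x -> fsets (src_fibre x) F ->
  fs x (square_sum a x F) = square_sum a x F.
Proof.
move=> ux [fF sF]; rewrite square_sumE // /fip (fs_sum (ginv_unit ux)) !big_seq.
apply: eq_bigr => g; rewrite in_fset_set // => /set_mem/sF sg.
have c := composable_Vg g; have m : gmul (ginv g) g = x by [].
by rewrite (fs_fm c m _ _ (ginv_unit ux) (ginvK g) (erefl _)) fsK.
Qed.

(* Test [a] on the section supported at [x] with value
   [c = \sum_(g in F) (a g)^* (a g)]: the square sum of its image is [c^3]. *)
Lemma op_bounded_col a x M : src x = x -> op_bounded a M -> col_bounded a x M.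
Proof.
move=> ux [M0 ha] F fF; have [finF sF] := fF.
set c := square_sum a x F.
(* [fib_at g] returns its default value 0 unless [g] is [x], so no transport between fibres is
   needed to define this section. *)
pose f : bsection B := fun g => fib_at g (inc B c).
have fx : f x = c by rewrite /f fib_atK.
have f0 g : g <> x -> f g = 0.
  move=> gx; rewrite /f /fib_at; apply: xgetPN => v /= e.
  by apply: gx; rewrite -(proj_inc v) e proj_inc.
have ff : finitely_supported f.
  apply: (@sub_finite_set _ _ [set x]); last exact: finite_set1.
  move=> g; rewrite /supp /=; have [//|/f0 ->] := pselect (g = x).
  by rewrite eqxx.
have f1 : fsets (src_fibre x) [set x] by split; [exact: finite_set1 | move=> _ ->].
have bf : col_bounded f x (rnorm c).
  move=> F' fF'; have -> : f = restr [set x] f.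
    apply: bsection_ext => g; rewrite /restr; case: ifP => // /negP gx.
    by apply: f0 => e; apply: gx; rewrite e in_setE.
  rewrite colnorm_restr //; apply: (@le_trans _ _ (colnorm f x [set x])).
    by apply: colnorm_le => // g [].
  rewrite /colnorm /square_sum fsbig_set1 -(inc_fs _ (erefl (ginv x))) -/(fm _ _ _).
  by rewrite rnorm_fs_mul // sqrtr_sqr ger0_norm ?rnorm_ge0 // fx.
have := ha f ff x (rnorm c) ux bf F fF.
have -> : colnorm (convolution a f) x F = colnorm (fun g => cterm a f g x) x F.
  apply: eq_colnorm => g Fg; have sg : src g = x := sF g Fg.
  rewrite (@convolutionE _ _ _ a f g (cpart a f g [set x])); last first.
    by apply: cvalue_finite; rewrite ?sg // => h _ nh; apply: f0.
  by rewrite /cpart fsbig_set1.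
have rF : rtrans x F = F.
  have eg g : F g -> gmul g (ginv x) = g.
    by move=> /sF sg; rewrite ginv_unit // -[in LHS](sg : src g = x) gmul_src.
  apply/seteqP; split=> [_ [g Fg <-]|g Fg]; first by rewrite eg.
  by exists g => //; exact: eg.
have ix := ginv_unit ux; have rx := rng_unit ux.
have cx := composable_unit ux; have mx := gmul_unit ux.
have -> : colnorm (fun g => cterm a f g x) x F = Num.sqrt (rnorm (fm x (fm x c c) c)).
  rewrite /colnorm square_sum_cterm // rF fx ix rx -/c.
  by rewrite /c fs_square_sum.
have [c0|c0] := eqVneq (rnorm c) 0.
  by move=> _; rewrite /colnorm -/c c0 sqrtr0.
have cp : 0 < rnorm c by rewrite lt_neqAle eq_sym c0 rnorm_ge0.
have sc : fs x c = c by exact: fs_square_sum.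
have n2 : rnorm (fm x c c) = rnorm c ^+ 2.
  by have := rnorm_fs_mul ix c ux; rewrite sc.
have n4 : rnorm (fm x (fm x c c) (fm x c c)) = rnorm c ^+ 4.
  have s2 : fs x (fm x c c) = fm x c c by rewrite (fs_fm cx mx _ _ ix ix ix) sc.
  by have := rnorm_fs_mul ix (fm x c c) ux; rewrite s2 n2 -exprM.
(* |c|^4 = |c^4| <= |c^3| |c| as c is self-adjoint. Together with |c^3| <= (M |c|)^2 this gives |c|
   <= M^2. *)
have n3 : rnorm c ^+ 3 <= rnorm (fm x (fm x c c) c).
  rewrite -(ler_pM2r cp) -exprSr -n4 -(fmA _ _ _ cx cx mx mx mx).
  exact: rnorm_fm.
move=> h.
have n3' : rnorm (fm x (fm x c c) c) <= (M * rnorm c) ^+ 2.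
  rewrite -(sqr_sqrtr (rnorm_ge0 (fm x (fm x c c) c))).
  by rewrite ler_sqr ?nnegrE ?sqrtr_ge0 ?mulr_ge0 ?rnorm_ge0.
have : rnorm c <= M ^+ 2.
  have c2 : 0 < rnorm c ^+ 2 by rewrite exprn_gt0.
  by rewrite -(ler_pM2r c2) -exprS -exprMn; apply: le_trans n3 n3'.
move=> cM; rewrite /colnorm -/c -[M]ger0_norm // -sqrtr_sqr ler_wsqrtr //.
Qed.

End ConvolutionTheory.

(** * Associativity, adjoints and the C*-identity for bounded sections *)

Section AlgebraOfSections.
Variables (R : realType) (G : etaleGroupoid) (B : fellBundle R G).
Implicit Types (a b c u v w f : bsection B) (F S : set G) (g h k x : G) (K L M N e : R).

Lemma rlim_fml (T : Type) (Phi : set_system T) (FF : ProperFilter Phi) z g h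
    (v : T -> fib B g) (l : fib B g) (d : fib B h) :
  composable g h -> gmul g h = z ->
  rlim Phi v l -> rlim Phi (fun t => fm z (v t) d) (fm z l d).
Proof.
move=> c m hl e e0; have d0 := rnorm_ge0 d.
have e2 : 0 < e / (rnorm d + 1) by rewrite divr_gt0 //; lra.
apply: filterS (hl _ e2) => t /= le1.
rewrite -(fmNl c m) -(fmDl c m); apply: le_trans (rnorm_fm c m _ _) _.
apply: le_trans (ler_wpM2r d0 le1) _.
by rewrite mulrAC ler_pdivrMr; nra.
Qed.

Lemma rlim_fs (T : Type) (Phi : set_system T) (FF : ProperFilter Phi) z g
    (v : T -> fib B g) (l : fib B g) : ginv g = z ->
  rlim Phi v l -> rlim Phi (fun t => fs z (v t)) (fs z l).
Proof.
move=> ez hl e e0; apply: filterS (hl _ e0) => t /=.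
by rewrite -(fsN ez) -(fsD ez) rnorm_fs.
Qed.

Lemma eq_cvalue a b b' g (v : fib B g) : (forall h, src h = src g -> b h = b' h) ->
  cvalue a b v -> cvalue a b' v.
Proof.
move=> E; apply: rlim_near; apply: filterS (fsets_near _) => F [fF sF] /=.
by apply: eq_fsbigr => h /set_mem/sF sh; rewrite /cterm E.
Qed.

Lemma cvalueD a b b' g (v v' : fib B g) :
  cvalue a b v -> cvalue a b' v' -> cvalue a (b + b') (v + v').
Proof. by move=> h h'; have := cvalue_lin 1 h h'; rewrite !scale1r. Qed.

Lemma cvalue_sum a g (I : eqType) (s : seq I) (w : I -> bsection B) (v : I -> fib B g) :
  {in s, forall i, cvalue a (w i) (v i)} ->
  cvalue a (\sum_(i <- s) w i) (\sum_(i <- s) v i).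
Proof.
elim: s => [|i s IH] h.
  rewrite !big_nil; have := @cvalue_finite _ _ _ a 0 g set0 (fsets_set0 _).
  by rewrite {1}/cpart fsbig_set0; apply.
rewrite !big_cons; apply: cvalueD; first by apply: h; rewrite inE eqxx.
by apply: IH => j js; apply: h; rewrite inE js orbT.
Qed.

Lemma sum_bsectionE (I : Type) (s : seq I) (w : I -> bsection B) g :
  (\sum_(i <- s) w i) g = \sum_(i <- s) w i g.
Proof. by elim/big_rec2: _ => // i y1 y2 _ <-. Qed.

(** Right multiplication by f(h) commutes with limits, and k -> k h^-1 identifies the arrows
    indexing the sum at g with those indexing the sum at g h^-1. *)
Lemma cvalue_cterm a b c (f : bsection B) g h : src h = src g ->
  (forall k, cvalue a b (c k)) ->
  cvalue a (fun k => cterm b f k h) (cterm c f g h).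
Proof.
move=> sh hc; set g' := gmul g (ginv h).
have cg : composable g' h := composable_gVh_h sh.
have mg : gmul g' h = g := gmulVhK sh.
have sg' : src g' = rng h := cg.
have r1 i : src_fibre (src g) i ->
    src_fibre (src g') (gmul i (ginv h)) /\ gmul (gmul i (ginv h)) h = i.
  move=> si; have e : src h = src i by rewrite sh -si.
  by split; [rewrite /src_fibre /= src_gVh // | exact: gmulVhK].
have r2 j : src_fibre (src g') j ->
    src_fibre (src g) (gmul j h) /\ gmul (gmul j h) (ginv h) = j.
  move=> sj; have cj : composable j h by rewrite /composable sj sg'.
  by split; [rewrite /src_fibre /= src_gmul | exact: gmulVK].
have L := rlim_net_reindex r1 r2 (hc g').
apply: (rlim_near _ (rlim_fml _ (f h) cg mg L)).
apply: filterS (fsets_near _) => F [fF sF] /=.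
rewrite /cpart !fsbig_finite // (fm_suml cg mg) !big_seq; apply: eq_bigr => k.
rewrite in_fset_set // => /set_mem/sF sk.
have ek : src h = src k by rewrite sh -sk.
set k' := gmul k (ginv h).
have ck : composable k' h := composable_gVh_h ek.
have mk : gmul k' h = k := gmulVhK ek.
have e1 : gmul g' (ginv k') = gmul g (ginv k).
  have chk : composable h (ginv k) by rewrite /composable rng_ginv.
  rewrite /k' ginv_gVh // /g' gmulA ?gmulKV //; first by rewrite /composable rng_ginv.
  by rewrite /composable src_ginv rng_gmul.
have c1 : composable (gmul g' (ginv k')) k' by apply: composable_gVh_h; rewrite ck -sg'.
have m1 : gmul (gmul g' (ginv k')) k' = g' by apply: gmulVhK; rewrite ck -sg'.
rewrite /cterm -/k' (fmA _ _ _ c1 ck m1 mk mg).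
exact: eq_fm_section.
Qed.

Lemma cvalue_assoc_fin a b c f g : finitely_supported f ->
  (forall k, cvalue a b (c k)) ->
  cvalue a (convolution b f) (convolution c f g).
Proof.
move=> ff hc; set S := supp f `&` src_fibre (src g).
have fS : fsets (src_fibre (src g)) S := finitely_supported_fsets _ ff.
have [finS sS] := fS.
have E h : src h = src g -> f h != 0 -> S h by move=> sh fh; split.
have CS u k : src k = src g -> convolution u f k = cpart u f k S.
  move=> sk; apply: convolutionE; apply: cvalue_finite; first by rewrite sk.
  by move=> h; rewrite sk => sh nS; apply/eqP/negP => /negP fh; apply/nS/E.
set s := finmap.enum_fset (fset_set S).
pose w : bsection B := \sum_(h <- s) ((fun g => cterm b f g h) : bsection B).
have wE k : src k = src g -> w k = convolution b f k.
  by move=> sk; rewrite CS // /cpart fsbig_finite // /w sum_bsectionE.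
apply: (eq_cvalue wE); rewrite CS // /cpart fsbig_finite // /w -/s.
have hs : {in s, forall h, src h = src g}.
  by move=> h; rewrite in_fset_set // => /set_mem/sS.
by apply: cvalue_sum => h /hs sh; exact: cvalue_cterm.
Qed.

Lemma op_bounded_mul a b c M N : op_bounded a M -> op_bounded b N ->
  (forall g, cvalue a b (c g)) -> op_bounded c (M * N).
Proof.
move=> ha hb hc; split; first by rewrite mulr_ge0 ?ha.1 ?hb.1.
move=> f ff x K ux hf; rewrite -mulrA.
apply: (op_bounded_ext ux ha (hb.2 f ff x K ux hf)) => g _.
exact: cvalue_assoc_fin.
Qed.

(** Both [abc] and [q] are compared with the product of [ab] and a truncation of c: associativity
    holds for the truncation, and bounded sections keep the remainder small. *)
Lemma cvalue_assoc a b c (ab bc abc : bsection B) g M N : op_bounded a M -> op_bounded b N ->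
  square_summable c (src g) ->
  (forall k, cvalue a b (ab k)) -> (forall k, cvalue b c (bc k)) ->
  (forall k, cvalue ab c (abc k)) -> (exists q : bsection B, forall k, cvalue a bc (q k)) ->
  cvalue a bc (abc g).
Proof.
move=> ha hb hc hab hbc habc [q hq]; have M0 := ha.1; have N0 := hb.1.
have ux : src (src g) = src g := src_src g.
suff -> : abc g = q g by [].
apply/eqP; rewrite -subr_eq0; apply/eqP/rnorm_le0/ler_addgt0Pr => e e0.
have MN : 0 <= M * N by rewrite mulr_ge0.
(* The remainder of c enters two comparisons, each multiplying it by M N. *)
have d0 : 0 < e / (M * N * 2 + 1) by rewrite divr_gt0 //; lra.
have [F0 fF0 hF0] := square_summable_tail ux hc d0.
have ff : finitely_supported (restr F0 c) by apply: restr_finitely_supported; exact: fF0.1.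
have h1 : col_bounded (abc - convolution ab (restr F0 c)) (src g)
    (M * N * (e / (M * N * 2 + 1))).
  apply: (op_bounded_ext ux (op_bounded_mul ha hb hab) hF0) => k _.
  by apply: cvalueB => //; exact: finitely_supportedP.
have h2 : col_bounded (bc - convolution b (restr F0 c)) (src g) (N * (e / (M * N * 2 + 1))).
  apply: (op_bounded_ext ux hb hF0) => k _.
  by apply: cvalueB => //; exact: finitely_supportedP.
have h3 : col_bounded (q - convolution ab (restr F0 c)) (src g)
    (M * (N * (e / (M * N * 2 + 1)))).
  apply: (op_bounded_ext ux ha h2) => k _.
  by apply: cvalueB => //; exact: cvalue_assoc_fin.
have := rnorm_col_bounded h1; have := rnorm_col_bounded h3; rewrite !bsectionBE => r1 r2.
apply: le_trans (rnorm_tri _ (convolution ab (restr F0 c) g) _) _.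
rewrite add0r [X in _ + X]rnormC; apply: le_trans (lerD r2 r1) _.
rewrite mulrA -mulr2n -[X in X <= _]mulr_natr mulrAC mulrA ler_pdivrMr; nra.
Qed.

(** Exchanging two finite sums gives <w, a^* f> = <a w, f>, the source of both the bound on a^* and
    the C*-identity. *)
Lemma adjoint_finite a f w x F S : fsets (src_fibre x) F -> fsets (src_fibre x) S ->
  \sum_(h \in F) fm x (fs (ginv h) (w h)) (cpart (sstar a) f h S) =
  \sum_(g \in S) fm x (fs (ginv g) (cpart a w g F)) (f g).
Proof.
move=> [fF sF] [fS sS].
rewrite !fsbig_finite //.
transitivity (\sum_(h <- finmap.enum_fset (fset_set F)) \sum_(g <- finmap.enum_fset (fset_set S))
   fm x (fs (ginv h) (w h)) (cterm (sstar a) f h g)).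
  rewrite !big_seq; apply: eq_bigr => h; rewrite in_fset_set // => /set_mem/sF sh.
  rewrite /cpart fsbig_finite // (fm_sumr (composable_Vg h)) //.
rewrite exchange_big /= !big_seq; apply: eq_bigr => g; rewrite in_fset_set // => /set_mem/sS sg.
rewrite /cpart fsbig_finite // (fs_sum (erefl _)) (fm_suml (composable_Vg g)) // !big_seq.
apply: eq_bigr => h; rewrite in_fset_set // => /set_mem/sF sh.
have egh : src h = src g by rewrite sg.
have ehg : src g = src h by [].
rewrite /cterm (fs_fm (composable_gVh_h egh) (gmulVhK egh) _ _ (erefl _) (ginv_gVh egh) (erefl _)).
have c1 : composable (ginv h) (gmul h (ginv g)).
  by rewrite /composable src_ginv rng_gVh.
have m1 : gmul (ginv h) (gmul h (ginv g)) = ginv g by apply: gmulKV; exact: composable_gVh.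
have m2 : gmul (ginv g) g = x by [].
rewrite (fmA _ _ _ c1 (composable_gVh_h ehg) m1 (gmulVhK ehg) m2).
congr (fm _ _ (fm _ _ _)); apply: sstarE; exact/esym/ginv_gVh.
Qed.

Lemma square_sum_fip u x F : square_sum u x F =
  \sum_(h \in F) fm x (fs (ginv h) (u h)) (u h).
Proof. by apply: eq_fsbigr => h _; rewrite -(inc_fs _ (erefl (ginv h))). Qed.

Lemma section_cauchy_schwarz u v x S : src x = x -> fsets (src_fibre x) S ->
  rnorm (\sum_(h \in S) fm x (fs (ginv h) (u h)) (v h)) <= colnorm u x S * colnorm v x S.
Proof.
move=> ux [fS sS].
rewrite -ler_sqr ?nnegrE ?rnorm_ge0 ?mulr_ge0 ?colnorm_ge0 // exprMn !colnorm_sqr.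
rewrite !square_sumE // fsbig_finite //; apply: fip_cauchy_schwarz1 => // g.
by rewrite in_fset_set // => /set_mem/sS.
Qed.

(* If [w] is the truncation of [a^* f] to [F], then [<w, w> = <a w, f>]. *)
Lemma op_bounded_sstar a M : op_bounded a M -> op_bounded (sstar a) M.
Proof.
move=> [M0 ha]; split=> // f ff x K ux hf F fF; have [finF sF] := fF.
set S := supp f `&` src_fibre x.
have fS : fsets (src_fibre x) S := finitely_supported_fsets _ ff.
set w := convolution (sstar a) f; set N := colnorm w x F.
have wE h : src h = x -> w h = cpart (sstar a) f h S.
  move=> sh; apply: convolutionE; rewrite /S -sh; exact: cvalue_finitely_supported.
have hw : col_bounded (restr F w) x N.
  by move=> F' fF'; rewrite colnorm_restr //; apply: colnorm_le => // g [].
have haw := ha _ (restr_finitely_supported w finF) x N ux hw.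
have e1 : square_sum w x F =
    \sum_(g \in S) fm x (fs (ginv g) (convolution a (restr F w) g)) (f g).
  rewrite square_sum_fip.
  rewrite (eq_fsbigr (fun h => fm x (fs (ginv h) (w h)) (cpart (sstar a) f h S))); last first.
    by move=> h /set_mem/sF sh; rewrite -wE.
  rewrite adjoint_finite //; apply: eq_fsbigr => g /set_mem[_ sg].
  by rewrite convolution_restr // sg.
have := section_cauchy_schwarz (convolution a (restr F w)) f ux fS.
rewrite -e1 -colnorm_sqr -/N => h1.
have K0 := col_bounded_ge0 hf; have N0 : 0 <= N := colnorm_ge0 _ _ _.
have h2 := haw _ fS; have h3 := hf _ fS.
have h4 : N ^+ 2 <= M * N * K.
  by apply: le_trans h1 _; apply: ler_pM; rewrite ?colnorm_ge0.
have [->|N1] := eqVneq N 0; first exact: mulr_ge0.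
have Np : 0 < N by rewrite lt_neqAle eq_sym N1 N0.
by rewrite -(ler_pM2r Np) -expr2; apply: le_trans h4 _; rewrite mulrAC.
Qed.

(** The involution turns a factorization g^-1 = k h into g = h^-1 k^-1; right translation by g^-1
    reindexes the sum. *)
Lemma cvalue_sstar a b c g : (forall k, cvalue a b (c k)) ->
  cvalue (sstar b) (sstar a) (sstar c g).
Proof.
move=> hc; set g' := ginv g.
have sg' : src g' = rng g by rewrite src_ginv.
have r1 i : src_fibre (src g) i ->
    src_fibre (src g') (gmul i g') /\ gmul (gmul i g') g = i.
  move=> si; split; first by rewrite /src_fibre /= src_gmul // /composable rng_ginv.
  by apply: gmulVhK; rewrite si.
have r2 j : src_fibre (src g') j ->
    src_fibre (src g) (gmul j g) /\ gmul (gmul j g) g' = j.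
  move=> sj; have cj : composable j g by rewrite /composable sj sg'.
  by split; [rewrite /src_fibre /= src_gmul | exact: gmulVK].
have L := rlim_net_reindex r1 r2 (hc g').
apply: (rlim_near _ (rlim_fs _ (ginvK g) L)).
apply: filterS (fsets_near _) => F [fF sF] /=.
rewrite /cpart !fsbig_finite // (fs_sum (ginvK g)) !big_seq; apply: eq_bigr => h.
rewrite in_fset_set // => /set_mem/sF sh.
have eh : src g = src h by rewrite sh.
set k := gmul h g'.
have ek : src k = src g' by rewrite src_gVh // sg'.
rewrite /cterm (fs_fm (composable_gVh_h ek) (gmulVhK ek) _ _ (ginvK g) (erefl _) (erefl _)).
have e1 : ginv k = gmul g (ginv h) by exact: ginv_gVh.
have e2 : ginv (gmul g' (ginv k)) = h.
  by rewrite ginv_gVh // /g' ginvK; apply: gmulVhK.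
have -> : fs (ginv k) (b k) = sstar b (ginv k) by rewrite (sstarE _ (esym (ginvK k))).
have -> : fs (ginv (gmul g' (ginv k))) (a (gmul g' (ginv k))) =
    sstar a (ginv (gmul g' (ginv k))) by rewrite (sstarE _ (esym (ginvK _))).
by rewrite e2 (eq_fm_section _ _ _ e1).
Qed.

(* In the limit over [F], [<a f, a f> = <a^* a f, f>]. *)
Lemma op_bounded_cstar a c N : op_bounded c N -> (forall g, cvalue (sstar a) a (c g)) ->
  op_bounded a (Num.sqrt N).
Proof.
move=> [N0 hN] hc; split; first exact: sqrtr_ge0.
move=> f ff x K ux hf F fF; have K0 := col_bounded_ge0 hf.
set S := supp f `&` src_fibre x.
have fS : fsets (src_fibre x) S := finitely_supported_fsets _ ff.
have [finS sS] := fS.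
set w := convolution a f.
have wE h : src h = x -> w h = cpart (sstar (sstar a)) f h S.
  move=> sh; apply: convolutionE; rewrite sstarK /S -sh; exact: cvalue_finitely_supported.
pose s := \sum_(g \in S) fm x (fs (ginv g) (convolution c f g)) (f g).
have lim : rlim (finite_subsets_filter (src_fibre x)) (square_sum w x) s.
  rewrite /s fsbig_finite //.
  have l1 : rlim (finite_subsets_filter (src_fibre x))
    (fun F' => \sum_(g <- finmap.enum_fset (fset_set S))
       fm x (fs (ginv g) (cpart (sstar a) w g F')) (f g))
    (\sum_(g <- finmap.enum_fset (fset_set S))
       fm x (fs (ginv g) (convolution c f g)) (f g)).
    apply: rlim_sum => g; rewrite in_fset_set // => /set_mem/sS sg.
    have lg : rlim (finite_subsets_filter (src_fibre x)) (cpart (sstar a) w g) (convolution c f g).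
      by rewrite -(sg : src g = x); apply: cvalue_assoc_fin.
    have mg : gmul (ginv g) g = x by [].
    exact: (rlim_fml _ (f g) (composable_Vg g) mg (rlim_fs _ (erefl _) lg)).
  apply: rlim_near l1; apply: filterS (fsets_near _) => F' fF' /=.
  rewrite square_sum_fip.
  rewrite (eq_fsbigr (fun h => fm x (fs (ginv h) (w h)) (cpart (sstar (sstar a)) f h S))); last first.
    by move=> h /set_mem/fF'.2 sh; rewrite -wE.
  by rewrite adjoint_finite // fsbig_finite.
have sle : rnorm s <= N * K * K.
  apply: le_trans (section_cauchy_schwarz (convolution c f) f ux fS) _.
  by apply: ler_pM; rewrite ?colnorm_ge0 //; [exact: hN | exact: hf].
(* The norms of square sums increase with the finite set, so each is at most the norm of the
   limit. *)
have key : rnorm (square_sum w x F) <= rnorm s.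
  apply/ler_addgt0Pr => e e0; have [F0 fF0 hF0] := lim _ e0.
  have fU := fsetsU fF fF0.
  have := hF0 _ (conj fU (@subsetUr _ _ _)) => /= h.
  have : rnorm (square_sum w x F) <= rnorm (square_sum w x (F `|` F0)).
    rewrite -!colnorm_sqr ler_sqr ?nnegrE ?colnorm_ge0 //.
    by apply: colnorm_le => // g; left.
  move=> h2; apply: le_trans h2 _.
  have := rnorm_tri (square_sum w x (F `|` F0)) s 0; rewrite !subr0 [X in _ <= X + _]rnormC; lra.
rewrite -ler_sqr ?nnegrE ?colnorm_ge0 ?mulr_ge0 ?sqrtr_ge0 //.
rewrite colnorm_sqr exprMn sqr_sqrtr // expr2 mulrA.
exact: le_trans key sle.
Qed.

Lemma convolution_linl a a' f (k : R[i]) : finitely_supported f ->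
  convolution (k *: a + a') f = k *: convolution a f + convolution a' f.
Proof.
move=> ff; apply: bsection_ext => g; apply: convolutionE.
by apply: cvalue_linl; exact: finitely_supportedP.
Qed.

Lemma op_bounded_lin a a' M M' (k : R[i]) : op_bounded a M -> op_bounded a' M' ->
  op_bounded (k *: a + a') (complex.Re `|k| * M + M').
Proof.
move=> [M0 h] [M0' h']; split; first by rewrite addr_ge0 // mulr_ge0 // Re_norm_ge0.
move=> f ff x K ux hf; rewrite convolution_linl // mulrDl -mulrA.
apply: col_boundedD => //; first by apply: col_boundedZ; exact: h.
exact: h'.
Qed.

Lemma op_boundedW a M M' : M <= M' -> op_bounded a M -> op_bounded a M'.
Proof.
move=> MM' [M0 h]; split; first exact: le_trans MM'.
move=> f ff x K ux hf; apply: (@col_boundedW _ _ _ _ _ (M * K)); last exact: h.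
by apply: ler_wpM2r => //; exact: col_bounded_ge0 hf.
Qed.

(** For finitely supported f, each entry of the convolution is a finite sum, so entrywise limits of
    sections give entrywise limits of their images. *)
Lemma op_bounded_lim (T : Type) (Phi : set_system T) (FF : ProperFilter Phi)
    (v : T -> bsection B) a M :
  (forall g, rlim Phi (fun t => v t g) (a g)) ->
  Phi [set t | op_bounded (v t) M] -> op_bounded a M.
Proof.
move=> lim hM; have [t0 [M0 _]] := filter_ex hM.
split=> // f ff x K ux hf.
apply: (@col_bounded_lim _ _ _ T Phi FF (fun t => convolution (v t) f)) => //; last first.
  by apply: filterS hM => t /= [_]; apply.
move=> g sg.
have fS := finitely_supported_fsets (src g) ff; have [finS sS] := fS.
rewrite (convolutionE (cvalue_finitely_supported a g ff)).
apply: rlim_near (_ : rlim Phi (fun t => cpart (v t) f g (supp f `&` src_fibre (src g))) _).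
  by apply: filterE => t /=; rewrite (convolutionE (cvalue_finitely_supported (v t) g ff)).
rewrite /cpart fsbig_finite //.
under [X in rlim _ X]eq_fun do rewrite fsbig_finite //.
apply: rlim_sum => h; rewrite in_fset_set // => /set_mem/sS sh.
exact: (rlim_fml _ (f h) (composable_gVh_h sh) (gmulVhK sh) (lim _)).
Qed.

End AlgebraOfSections.

(** * The C*-algebra of sections *)

Section OperatorNorm.
Variables (R : realType) (G : etaleGroupoid) (B : fellBundle R G).
Implicit Types (a b c u v w f : bsection B) (g h k x : G) (K L M N e : R).

Lemma norm2_ge0 f : (0 <= norm2 f)%E.
Proof. by apply: ereal_sup_ubound; left. Qed.

Lemma norm2_leP f K : 0 <= K ->
  (norm2 f <= K%:E)%E <-> forall x, src x = x -> col_bounded f x K.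
Proof.
move=> K0; split=> [h x ux F fF|h].
  rewrite -lee_fin; apply: le_trans h; apply: ereal_sup_ubound; right.
  by exists x, F; split.
apply: ge_ereal_sup => _ [->|[x [F [ux fF ->]]]]; first by rewrite lee_fin.
by rewrite lee_fin; exact: h.
Qed.

Lemma norm2_eq0 f : norm2 f = 0%E -> f = 0.
Proof.
move=> e; have : (norm2 f <= 0%:E)%E by rewrite e.
move=> /(norm2_leP f (lexx 0)) h; apply: bsection_ext => g.
exact/rnorm_le0/rnorm_col_bounded/h/src_src.
Qed.

Lemma col_bounded0 x : col_bounded (0 : bsection B) x 0.
Proof.
move=> F fF; have := @colnormZ _ _ B 0 0 x F fF.
by rewrite scale0r normr0 mul0r => ->.
Qed.

Lemma convolution0r a : convolution a 0 = 0 :> bsection B.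
Proof.
apply: bsection_ext => g; apply: convolutionE.
have := @cvalue_finite _ _ _ a 0 g set0 (fsets_set0 _).
by rewrite {1}/cpart fsbig_set0; apply.
Qed.

Lemma normb_leP a M : 0 <= M -> (normb a <= M%:E)%E <-> op_bounded a M.
Proof.
move=> M0; split=> [h|[_ h]].
- split=> // f ff x K ux hf; have K0 := col_bounded_ge0 hf.
  (* [norm2] looks at all units at once, so the other columns of f are first replaced by 0. *)
  set f' := restr (src_fibre x) f.
  have ff' : finitely_supported f'.
    apply: sub_finite_set ff => g; rewrite /supp /f' /restr /=.
    by case: ifP => //; rewrite eqxx.
  have hf' : (norm2 f' <= K%:E)%E.
    apply/norm2_leP => // y uy; have [e|ny] := pselect (y = x).
      by rewrite e; apply: col_bounded_restr.
    apply: (@eq_col_bounded _ _ _ 0); last by apply: col_boundedW K0 _; exact: col_bounded0.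
    by move=> g sg; rewrite /f' /restr memNset // /src_fibre /= sg.
  have E g : src g = x -> convolution a f' g = convolution a f g.
    move=> sg; apply: convolutionE; apply: eq_cvalue (finitely_supportedP _ _ ff).
    by move=> k sk; rewrite /f' /restr mem_set // /src_fibre /= sk.
  apply: (eq_col_bounded E).
  have le1 : (norm2 (convolution a f') / norm2 f' <= M%:E)%E.
    by apply: le_trans h; apply: ereal_sup_ubound; exists f'.
  have r0 := norm2_ge0 f'.
  case er : (norm2 f') hf' le1 r0 => [r| |] //.
  rewrite !lee_fin => rK le1 r0.
  have [r1|r1] := eqVneq r 0.
    have f0 : f' = 0 by apply: norm2_eq0; rewrite er r1.
    rewrite f0 convolution0r; apply: (@col_boundedW _ _ _ _ _ 0); last exact: col_bounded0.
    exact: mulr_ge0.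
  have rp : 0 < r by rewrite lt_neqAle eq_sym r1 r0.
  have /norm2_leP : (norm2 (convolution a f') <= (M * r)%:E)%E.
    rewrite EFinM -lee_pdivrMr //.
    by move: le1; rewrite inver (negbTE r1).
  move=> /(_ (mulr_ge0 M0 r0) x ux); apply: col_boundedW.
  exact: ler_wpM2l.
- apply: ge_ereal_sup => _ [f ff <-].
  have r0 := norm2_ge0 f.
  case er : (norm2 f) r0 => [r| |] //.
    rewrite lee_fin => r0.
    have le1 : (norm2 (convolution a f) <= (M * r)%:E)%E.
      apply/norm2_leP; first exact: mulr_ge0.
      move=> x ux; apply: h => //; move: x ux; apply/norm2_leP => //.
      by rewrite er.
    (* For r = 0 the bound already forces the numerator to be 0, and the convention 0 / 0 = 0
       applies. *)
    have [r1|r1] := eqVneq r 0.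
      have -> : norm2 (convolution a f) = 0%E.
        by apply/eqP; rewrite eq_le norm2_ge0 andbT; move: le1; rewrite r1 mulr0.
      by rewrite mul0e lee_fin.
    have rp : 0 < r by rewrite lt_neqAle eq_sym r1 r0.
    by rewrite inver (negbTE r1) lee_pdivrMr // -EFinM.
  (* Here [norm2 f] is infinite; its inverse is 0, and so is the quotient, whatever the
     numerator. *)
  by rewrite invey mule0 lee_fin.
Qed.

Lemma normb_ge0 a : (0 <= normb a)%E.
Proof.
apply: ereal_sup_ubound; exists (0%R : bsection B).
  by apply: (@sub_finite_set _ _ set0) => // g; rewrite /supp /= eqxx.
rewrite convolution0r; suff -> : norm2 (0%R : bsection B) = 0%E by rewrite mul0e.
apply/eqP; rewrite eq_le norm2_ge0 andbT.
by apply/norm2_leP => // x _; exact: col_bounded0.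
Qed.

Definition normbr a : R := fine (normb a).

Lemma op_bounded_normb a M : op_bounded a M -> normb a = (normbr a)%:E.
Proof.
move=> h; have := h.1 => M0; have /normb_leP - /(_ M0) hM := h.
rewrite /normbr fineK //; apply/fin_numPlt/andP; split.
  by apply: lt_le_trans (normb_ge0 a).
exact: le_lt_trans hM (ltry _).
Qed.

Lemma normbr_ge0 a : 0 <= normbr a.
Proof. exact/fine_ge0/normb_ge0. Qed.

Lemma normbr_le a M : op_bounded a M -> normbr a <= M.
Proof. by move=> h; rewrite -lee_fin -(op_bounded_normb h); apply/normb_leP => //; exact: h.1. Qed.

Lemma op_bounded_normbr a M : op_bounded a M -> op_bounded a (normbr a).
Proof.
by move=> h; apply/normb_leP; [exact: normbr_ge0 | rewrite (op_bounded_normb h)].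
Qed.

Definition in_algebra a := [/\ exists M, op_bounded a M,
  forall x, src x = x -> square_summable a x &
  forall x, src x = x -> square_summable (sstar a) x].

Lemma BsectionsP a : Bsections a <-> in_algebra a.
Proof.
split=> [[b /convolution_defined_sstarP d1 d2]|[[M h] d1 d2]].
  split=> //; last by apply/convolution_defined_sstarP; rewrite sstarK.
  have : (normb a < +oo)%E by [].
  case e : (normb a) (normb_ge0 a) => [r| |] //; rewrite lee_fin => r0 _.
  by exists r; apply/normb_leP => //; rewrite e.
split.
- by rewrite /bounded_sections /= (op_bounded_normb h) ltry.
- exact/convolution_defined_sstarP.
- by have /convolution_defined_sstarP := d2; rewrite sstarK.
Qed.

Lemma in_algebra_lin a b (k : R[i]) : in_algebra a -> in_algebra b -> in_algebra (k *: a + b).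
Proof.
move=> [[M h] d1 d2] [[N h'] e1 e2]; split.
- by exists (complex.Re `|k| * M + N); exact: op_bounded_lin.
- move=> x ux; apply: square_summableD => //; first by apply: square_summableZ; exact: d1.
  exact: e1.
- move=> x ux; rewrite sstarD sstarZ; apply: square_summableD => //.
    by apply: square_summableZ; exact: d2.
  exact: e2.
Qed.

Lemma op_bounded0 : op_bounded (0 : bsection B) 0.
Proof.
split=> // f ff x K ux hf; rewrite mul0r.
have -> : convolution 0 f = 0 :> bsection B.
  by have := convolution_linl 0 0 (-1) ff; rewrite scaler0 addr0 scaleN1r addNr.
exact: col_bounded0.
Qed.

Lemma in_algebra0 : in_algebra 0.
Proof.
have s0 : sstar 0 = 0 :> bsection B by rewrite -[0](scale0r 0) sstarZ conjc0 !scale0r.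
split; last 1 first.
- by move=> x _; rewrite s0; exact: square_summable0.
- by exists 0; exact: op_bounded0.
- by move=> x _; exact: square_summable0.
Qed.

Lemma in_algebra_defined a b : in_algebra a -> in_algebra b -> convolution_defined a b.
Proof.
move=> [_ _ d2] [_ e1 _]; apply/convolution_definedP => g.
have [K hK] := square_summable_bounded (src_rng g) (d2 _ (src_rng g)).
by apply: cvalue_exists hK _; apply: e1; exact: src_src.
Qed.

Lemma in_algebra_star a : in_algebra a -> in_algebra (sstar a).
Proof.
move=> [[M h] d1 d2]; split=> //; last by rewrite sstarK.
by exists M; exact: op_bounded_sstar.
Qed.

Lemma sstar_convolution a b : in_algebra a -> in_algebra b ->
  sstar (convolution a b) = convolution (sstar b) (sstar a).
Proof.
move=> ha hb; apply: bsection_ext => g; apply/esym/convolutionE/cvalue_sstar => k.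
exact/convolutionP/in_algebra_defined.
Qed.

Lemma in_algebra_mul a b : in_algebra a -> in_algebra b -> in_algebra (convolution a b).
Proof.
have sm u v : in_algebra u -> in_algebra v ->
    forall x, src x = x -> square_summable (convolution u v) x.
  move=> hu hv x ux; have [[M h] d1 _] := hu; have [_ e1 _] := hv.
  apply: (square_summable_mul ux d1 h (e1 x ux)) => g _.
  exact/convolutionP/in_algebra_defined.
move=> ha hb; split; [|exact: sm|].
- have [[M h] _ _] := ha; have [[N h'] _ _] := hb.
  exists (M * N); apply: (op_bounded_mul h h') => g.
  exact/convolutionP/in_algebra_defined.
- by rewrite sstar_convolution //; apply: sm; exact: in_algebra_star.
Qed.

Lemma convolutionA a b c : in_algebra a -> in_algebra b -> in_algebra c ->
  convolution a (convolution b c) = convolution (convolution a b) c.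
Proof.
move=> ha hb hc; have hab := in_algebra_mul ha hb; have hbc := in_algebra_mul hb hc.
have [[M h] _ _] := ha; have [[N h'] _ _] := hb; have [_ e1 _] := hc.
apply: bsection_ext => g; apply: convolutionE.
apply: (@cvalue_assoc _ _ _ a b c (convolution a b) (convolution b c) _ g M N) => //.
- by apply: e1; exact: src_src.
- by move=> k; exact/convolutionP/in_algebra_defined.
- by move=> k; exact/convolutionP/in_algebra_defined.
- by move=> k; exact/convolutionP/in_algebra_defined.
- by exists (convolution a (convolution b c)) => k; exact/convolutionP/in_algebra_defined.
Qed.

(** An entry is at most the norm of its column, which is at most the operator bound. Evaluation at
    [g] is thus contractive, which gives definiteness of the norm and entrywise limits. *)
Lemma rnorm_normbr a g : in_algebra a -> rnorm (a g) <= normbr a.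
Proof.
move=> [[M h] _ _]; apply: rnorm_col_bounded; apply: op_bounded_col; first exact: src_src.
exact: op_bounded_normbr h.
Qed.

End OperatorNorm.

(** * Algebra structure, norm and completeness *)

Section SectionAlgebra.
Variables (R : realType) (G : etaleGroupoid) (B : fellBundle R G).

Definition algebra_pred : {pred bsection B} := fun a => `[< in_algebra a >].

Fact algebra_pred_zmod : zmod_closed algebra_pred.
Proof.
split=> [|a b /asboolP ha /asboolP hb]; apply/asboolP; first exact: in_algebra0.
by rewrite addrC -scaleN1r; exact: in_algebra_lin.
Qed.

Fact algebra_pred_scale : GRing.scaler_closed algebra_pred.
Proof.
move=> k a /asboolP ha; apply/asboolP; rewrite -[k *: a]addr0.
by apply: in_algebra_lin => //; exact: in_algebra0.
Qed.

HB.instance Definition _ := GRing.isZmodClosed.Build (bsection B) algebra_pred algebra_pred_zmod.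
HB.instance Definition _ :=
  GRing.isScaleClosed.Build R[i] (bsection B) algebra_pred algebra_pred_scale.

Record section_algebra := SectionAlgebra {
  section_of :> bsection B; section_ofP : section_of \in algebra_pred }.

HB.instance Definition _ := [isSub for section_of].
HB.instance Definition _ := [Choice of section_algebra by <:].
HB.instance Definition _ := [SubChoice_isSubLmodule of section_algebra by <:].

Implicit Types s t : section_algebra.

Lemma section_in s : in_algebra s.
Proof. exact/asboolP/section_ofP. Qed.

Lemma section_op_bounded s : op_bounded s (normbr s).
Proof. by have [[M h] _ _] := section_in s; exact: op_bounded_normbr h. Qed.

Let nrm s : R[i] := real_complex R (normbr s).

Fact nrmD s t : nrm (s + t) <= nrm s + nrm t.
Proof.
rewrite /nrm -rmorphD lecR; apply: normbr_le.
have := op_bounded_lin 1 (section_op_bounded s) (section_op_bounded t).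
by rewrite scale1r normr1 mul1r.
Qed.

Fact nrmZ (k : R[i]) s : nrm (k *: s) = `|k| * nrm s.
Proof.
(* One inequality for all scalars is enough: the reverse one is this applied to k^-1 and k s. *)
have le1 (l : R[i]) t : normbr (l *: t) <= complex.Re `|l| * normbr t.
  apply: normbr_le; have := op_bounded_lin l (section_op_bounded t) (op_bounded0 B).
  by rewrite !addr0.
have -> : `|k| = real_complex R (complex.Re `|k|) by rewrite RRe_real // normr_real.
rewrite /nrm -rmorphM; congr (real_complex R _); apply/eqP; rewrite eq_le le1 andTb.
have [->|k0] := eqVneq k 0; first by rewrite normr0 mul0r; exact: normbr_ge0.
have kp : 0 < complex.Re `|k| by rewrite -ltcR RRe_real ?normr_real // normr_gt0.
have := le1 k^-1 (k *: s); rewrite scalerA mulVf // scale1r => h.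
rewrite -ler_pdivlMl //; apply: le_trans h _.
have -> : complex.Re `|k^-1| = (complex.Re `|k|)^-1 by exact: Normc.normcV.
by [].
Qed.

Fact nrm_eq0 s : nrm s = 0 -> s = 0.
Proof.
move=> /complexI e; apply: val_inj; apply: bsection_ext => g.
by apply: rnorm_le0; rewrite -e; apply: rnorm_normbr; exact: section_in.
Qed.

HB.instance Definition _ := Lmodule_isNormed.Build R[i] section_algebra nrmD nrmZ nrm_eq0.

Lemma section_normE s : `|s| = real_complex R (normbr s).
Proof. by []. Qed.

(** Operator bounds on differences pass to the entrywise limit, which gives convergence in norm.
    Square summability of the limit and of its adjoint follows since operator bounds dominate column
    norms. *)
Fact section_algebra_complete (F : set_system section_algebra) :
  ProperFilter F -> cauchy F -> cvg F.
Proof.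
move=> FF /cauchyP cF.
have key (e : R) : 0 < e -> exists2 S, F S & forall s t, S s -> S t -> rnorm (s - t) <= e.
  move=> e0; have e2 : 0 < real_complex R (e / 2) by rewrite ltcR divr_gt0.
  have [s0 Fs0] := cF _ e2; exists (ball s0 (real_complex R (e / 2))) => //.
  have b t : ball s0 (real_complex R (e / 2)) t -> rnorm (s0 - t) < e / 2.
    by rewrite -ball_normE /= rnormE ltcR.
  move=> s t /b hs /b ht; apply: le_trans (rnorm_tri s s0 t) _.
  have := ltW (ltrD hs ht); rewrite -splitr; apply: le_trans.
  by rewrite [rnorm (s - s0)]rnormC.
have pt g : exists l : fib B g, rlim F (fun t => section_of t g) l.
  apply: rcauchy_lim => e /key[S FS hS]; exists S => // s t Ss St.
  by apply: le_trans (hS _ _ Ss St); apply: (rnorm_normbr g (section_in (s - t))).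
pose a : bsection B := fun g => projT1 (cid (pt g)).
have ha g : rlim F (fun t => section_of t g) (a g) := projT2 (cid (pt g)).
have close (e : R) : 0 < e -> exists2 S, F S & forall s, S s -> op_bounded (a - section_of s) e.
  move=> /key[S FS hS]; exists S => // s Ss.
  apply: (@op_bounded_lim _ _ _ _ F FF (fun t => section_of t - section_of s)).
    move=> g; apply: rlimD; first exact: ha.
    exact: rlim_cst.
  apply: filterS FS => t St; apply: op_boundedW (hS t s St Ss) _.
  exact: (section_op_bounded (t - s)).
have ina : in_algebra a.
  have [S FS hS] := close 1 ltr01; have [s0 Ss0] := filter_ex FS.
  split.
  - have := op_bounded_lin 1 (hS _ Ss0) (section_op_bounded s0).
    by rewrite scale1r subrK => h; eexists; exact: h.
  - move=> x ux; apply: square_summable_closed => // e e0.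
    have [S' FS' hS'] := close e e0; have [s Ss] := filter_ex FS'.
    exists (section_of s); first by have [_ d _] := section_in s; exact: d.
    by apply: op_bounded_col => //; exact: hS'.
  - move=> x ux; apply: square_summable_closed => // e e0.
    have [S' FS' hS'] := close e e0; have [s Ss] := filter_ex FS'.
    exists (sstar s); first by have [_ _ d] := section_in s; exact: d.
    rewrite -sstarB; apply: op_bounded_col => //; apply: op_bounded_sstar; exact: hS'.
pose s : section_algebra := SectionAlgebra (asboolT ina : a \in algebra_pred).
apply/cvg_ex; exists s.
have /rlimP : rlim F id s.
  move=> e e0; have [S FS hS] := close e e0; apply: filterS FS => t St /=.
  by apply: normbr_le; exact: hS.
by [].

Qed.

HB.instance Definition _ := Uniform_isComplete.Build section_algebra section_algebra_complete.

Fact section_mul_in s t : convolution s t \in algebra_pred.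
Proof. by apply/asboolP; apply: in_algebra_mul; exact: section_in. Qed.

Definition section_mul s t := SectionAlgebra (section_mul_in s t).

Fact section_star_in s : sstar s \in algebra_pred.
Proof. by apply/asboolP; apply: in_algebra_star; exact: section_in. Qed.

Definition section_star s := SectionAlgebra (section_star_in s).

Lemma section_cvalue s t g : cvalue s t (convolution s t g).
Proof. by apply/convolutionP/in_algebra_defined; exact: section_in. Qed.

Fact section_mulA s t u : section_mul s (section_mul t u) = section_mul (section_mul s t) u.
Proof. by apply: val_inj; apply: convolutionA; exact: section_in. Qed.

Fact section_mulPl (k : R[i]) s t u :
  section_mul (k *: s + t) u = k *: section_mul s u + section_mul t u.
Proof.
apply: val_inj; apply: bsection_ext => g; apply: convolutionE.
by apply: cvalue_linl; exact: section_cvalue.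
Qed.

Fact section_mulPr (k : R[i]) s t u :
  section_mul s (k *: t + u) = k *: section_mul s t + section_mul s u.
Proof.
apply: val_inj; apply: bsection_ext => g; apply: convolutionE.
by apply: cvalue_lin; exact: section_cvalue.
Qed.

Fact section_starK s : section_star (section_star s) = s.
Proof. by apply: val_inj; exact: sstarK. Qed.

Fact section_starP (k : R[i]) s t :
  section_star (k *: s + t) = conjc k *: section_star s + section_star t.
Proof.
apply: val_inj; transitivity (sstar (k *: section_of s + section_of t)); first by [].
by rewrite sstarD sstarZ.
Qed.

Fact section_starM s t :
  section_star (section_mul s t) = section_mul (section_star t) (section_star s).
Proof. by apply: val_inj; apply: sstar_convolution; exact: section_in. Qed.

Lemma normbr_mul s t : normbr (convolution s t) <= normbr s * normbr t.
Proof.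
apply: normbr_le.
apply: (op_bounded_mul (section_op_bounded s) (section_op_bounded t)) => g.
exact: section_cvalue.
Qed.

(** One inequality is submultiplicativity with |s^*| <= |s|; for the other, [op_bounded_cstar]
    bounds s by the square root of |s^* s|. *)
Lemma normbr_star_mul s : normbr (convolution (sstar s) s) = normbr s ^+ 2.
Proof.
apply/eqP; rewrite eq_le; apply/andP; split.
  apply: le_trans (normbr_mul (section_star s) s) _; rewrite expr2.
  apply: ler_wpM2r; first exact: normbr_ge0.
  by apply: normbr_le; apply: op_bounded_sstar; exact: section_op_bounded.
set c := convolution _ _; have c0 : 0 <= normbr c := normbr_ge0 c.
have cb : op_bounded c (normbr c) := section_op_bounded (section_mul (section_star s) s).
rewrite -[leRHS]sqr_sqrtr // ler_sqr ?nnegrE ?normbr_ge0 ?sqrtr_ge0 //.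
apply: normbr_le; apply: op_bounded_cstar cb _ => g.
exact: (section_cvalue (section_star s) s g).
Qed.

Fact section_mul_norm s t : `|section_mul s t| <= `|s| * `|t|.
Proof.
rewrite (section_normE s) (section_normE t) (section_normE (section_mul s t)).
by rewrite -(rmorphM (real_complex R)) lecR; exact: normbr_mul.
Qed.

Fact section_star_norm s : `|section_mul (section_star s) s| = `|s| ^+ 2.
Proof.
rewrite (section_normE s) (section_normE (section_mul (section_star s) s)).
by rewrite -(rmorphXn (real_complex R)) -normbr_star_mul.
Qed.

HB.instance Definition _ := isCStarAlgebra.Build R section_algebra
  section_mulA section_mulPl section_mulPr section_starK section_starP
  section_starM section_mul_norm section_star_norm.

End SectionAlgebra.

Theorem theorem3p4 (R : realType) (G : etaleGroupoid) (B : fellBundle R G) :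
  exists (A : cstarAlgType R) (j : A -> bsection B),
    [/\ injective j /\ range j = Bsections (B := B),
        forall (k : R[i]) (x y : A) (g : G),
          j (k *: x + y) g = k *: j x g + j y g,
        forall x y : A,
          convolution_defined (j x) (j y) /\
          j (cmul x y) = convolution (j x) (j y),
        forall x : A, j (cstar x) = sstar (j x) &
        forall x : A, (complex.Re `|x|)%:E = normb (j x)].
Proof.
exists (section_algebra B), (@section_of R G B); split.
- split; first exact: val_inj.
  apply/seteqP; split=> [_ [s _ <-]|a /BsectionsP ha].
    exact/BsectionsP/section_in.
  by exists (SectionAlgebra (asboolT ha : a \in @algebra_pred R G B)).
- by [].
- by move=> x y; split=> //; apply: in_algebra_defined; exact: section_in.
- by [].
- by move=> x; rewrite section_normE (op_bounded_normb (section_op_bounded x)).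
Qed.
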